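(* Let $\alpha^2>0$, $\nu>0$, $\beta\ge 0$, $x_0>0$ be real constants. Consider the problem of identifying $f\in L^2(\mathbb{R})$ from noisy data $y_\delta\in L^2(\mathbb{R})$ measured at the position $x_0$, where $\delta>0$ is the noise level, $\|y-y_\delta\|_{L^2(\mathbb{R})}\le\delta$, $y(t)=u(x_0,t)$, $y\in L^2(\mathbb{R})$, and $u$ (with $u(x,\cdot)\in L^2(\mathbb{R})$) and $f$ satisfy $$\begin{cases} u_t(x,t)=\alpha^2u_{xx}(x,t)-\beta u_x(x,t)-\nu u(x,t)+f(t), & x\in\mathbb{R},\ t>0,\\ u(0,t)=0, & t>0,\\ \lim_{x\to\infty}|u(x,t)|<M, & t>0,\ \text{for some } M\in\mathbb{R},\end{cases}$$ this system being understood through its Fourier transform in $t$ as described in the context, so that $f=Ty$. For $\mu\in(0,1)$ let $R_\mu:L^2(\mathbb{R})\to L^2(\mathbb{R})$ be $$R_\mu y(t)=\frac{1}{\sqrt{2\pi}}\int_{-\infty}^{+\infty}e^{i\xi t}\,\frac{\Lambda(\xi)}{1+\mu^2\xi^2}\,\hat y(\xi)\,d\xi,\qquad \Lambda(\xi)=\frac{\nu+i\xi}{1-e^{\frac{\beta-\sqrt{\beta^2+4\alpha^2(\nu+i\xi)}}{2\alpha^2}x_0}}.$$ Then for every such $y=u(x_0,\cdot)$ there exists an a-priori parameter choice rule for $\mu>0$ such that the pair $(R_\mu,\mu)$ is a convergent regularization method for solving the identification problem $f=Ty$.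
   Context: $\hat g(\xi)$ denotes the (unitary) Fourier transform of $g\in L^2(\mathbb{R})$ in the variable $t$, with inverse $g(t)=\frac{1}{\sqrt{2\pi}}\int_{-\infty}^{+\infty}e^{i\xi t}\hat g(\xi)\,d\xi$ (in the $L^2$ sense). $\sqrt{\cdot}$ is the principal square root of complex numbers. Frequency formulation. With $z(\xi)=\nu+i\xi$, the system together with $u(x_0,t)=y(t)$ is understood as: $-\alpha^2\hat u_{xx}(x,\xi)+\beta\hat u_x(x,\xi)+z(\xi)\hat u(x,\xi)=\hat f(\xi)$ for $x,\xi\in\mathbb{R}$; $\hat u(0,\xi)=0$; $\hat u(x_0,\xi)=\hat y(\xi)$; and $\lim_{x\to\infty}|\hat u(x,\xi)|<M^*$ for some $M^*\in\mathbb{R}$. Solving this ordinary differential equation in $x$ gives $\hat f(\xi)=\Lambda(\xi)\hat y(\xi)$, i.e. $f=Ty$, where $T$ is the unbounded operator on $L^2(\mathbb{R})$ given by $Ty(t)=\frac{1}{\sqrt{2\pi}}\int_{-\infty}^{+\infty}e^{i\xi t}\Lambda(\xi)\hat y(\xi)\,d\xi$, with domain $\{y\in L^2(\mathbb{R}):\Lambda\hat y\in L^2(\mathbb{R})\}$. Regularization. A regularization strategy for $T$ is a family of bounded linear operators $R_\mu$ such that $\lim_{\mu\to0}R_\mu y=Ty$ for all $y$ in the domain of $T$. An a-priori parameter choice rule is a function $\mu=\mu(\delta)$ of the noise level $\delta$ only (not of the data $y_\delta$). For $y$ in the domain of $T$, the pair $(R_\mu,\mu)$ is a convergent regularization method for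 solving $f=Ty$ if, as $\delta\to0$, $\mu(\delta)\to0$ and $\sup\{\|R_{\mu(\delta)}y_\delta-Ty\|_{L^2(\mathbb{R})}: y_\delta\in L^2(\mathbb{R}),\ \|y-y_\delta\|_{L^2(\mathbb{R})}\le\delta\}\to0$. *)

(* Defs.v *)
From HB Require Import structures.
From mathcomp Require Import all_boot all_order all_algebra.
From mathcomp Require Import all_classical all_reals all_analysis.
From mathcomp Require Import complex.

Set Implicit Arguments.
Unset Strict Implicit.
Unset Printing Implicit Defensive.

Import Order.TTheory GRing.Theory Num.Theory.
Import numFieldNormedType.Exports.

Local Open Scope classical_set_scope.
Local Open Scope ring_scope.
Local Open Scope complex_scope.

Section ComplexFunctions.
Context {R : realType}.
Implicit Types (g h : R -> R[i]) (z : R[i]).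

Definition cmod z : R := Normc.normc z.

Definition expi (theta : R) : R[i] := cos theta +i* sin theta.

Definition cexp z : R[i] := (expR (complex.Re z))%:C * expi (complex.Im z).

(* R[i] is not a normed module over R in the library: differentiation and
   integration of complex functions of a real variable are componentwise. *)
Definition cderivable g (x : R) : Prop :=
  derivable (fun s => complex.Re (g s)) x 1 /\
  derivable (fun s => complex.Im (g s)) x 1.

Definition cderive g : R -> R[i] := fun x =>
  derive1 (fun s => complex.Re (g s)) x +i*
  derive1 (fun s => complex.Im (g s)) x.

Definition cintegral (D : set R) g : R[i] :=
  (\int[lebesgue_measure]_(x in D) complex.Re (g x)) +i*
  (\int[lebesgue_measure]_(x in D) complex.Im (g x)).

Definition L2norm g : \bar R :=
  Lnorm lebesgue_measure 2%:E (fun t => (cmod (g t))%:E).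

(* Elements of L^2(R) are represented by functions; equality in L^2(R) is
   equality almost everywhere. *)
Definition L2 g : Prop :=
  [/\ measurable_fun setT (fun t => complex.Re (g t)),
      measurable_fun setT (fun t => complex.Im (g t)) &
      (L2norm g < +oo)%E].

Definition L2dist g h : \bar R := L2norm (fun t => g t - h t).

End ComplexFunctions.

Section FourierTransform.
Context {R : realType}.
Implicit Types (g h : R -> R[i]).

(* The sign s is -1 for the Fourier transform and 1 for its inverse. *)
Definition truncated_ft (s A : R) g : R -> R[i] := fun xi =>
  ((Num.sqrt (2 * pi))^-1)%:C *
  cintegral `[- A, A] (fun t => expi (s * (xi * t)) * g t).

Definition is_L2_ft (s : R) g h : Prop :=
  L2 h /\ (L2dist (truncated_ft s A g) h @[A --> +oo%R] --> 0%E).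

(* The L^2 limit exists for every g in L^2(R) by Plancherel's theorem; the
   value (chosen among a.e. equal ones) is only meaningful for such g. *)
Definition fourier g : R -> R[i] := xget (cst 0) [set h | is_L2_ft (-1) g h].
Definition ifourier g : R -> R[i] := xget (cst 0) [set h | is_L2_ft 1 g h].

End FourierTransform.

Section Regularization.
Context {R : realType}.
Implicit Types (A T : (R -> R[i]) -> (R -> R[i])) (y : R -> R[i]).

(* Linearity and boundedness imply that A respects a.e. equality. *)
Definition bounded_linear_L2 A : Prop :=
  [/\ forall g, L2 g -> L2 (A g),
      forall (a b : R[i]) g h, L2 g -> L2 h ->
        {ae lebesgue_measure, forall t,
           A (fun s => a * g s + b * h s) t = a * A g t + b * A h t} &
      exists C : R, forall g, L2 g -> (L2norm (A g) <= C%:E * L2norm g)%E].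

Definition regularization_strategy (dom : set (R -> R[i])) T
    (Rmu : R -> (R -> R[i]) -> (R -> R[i])) : Prop :=
  (forall mu : R, 0 < mu < 1 -> bounded_linear_L2 (Rmu mu)) /\
  (forall y, dom y -> L2dist (Rmu mu y) (T y) @[mu --> 0^'+] --> 0%E).

(* The rule mu depends on the noise level only. *)
Definition a_priori_rule (mu : R -> R) : Prop :=
  forall delta : R, 0 < delta -> 0 < mu delta < 1.

Definition convergent_regularization T
    (Rmu : R -> (R -> R[i]) -> (R -> R[i])) (mu : R -> R) y : Prop :=
  (mu delta @[delta --> 0^'+] --> (0 : R)) /\
  (ereal_sup [set L2dist (Rmu (mu delta) yd) (T y) |
                yd in [set yd | L2 yd /\ (L2dist y yd <= delta%:E)%E]]
     @[delta --> 0^'+] --> 0%E).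

End Regularization.

Section SourceIdentification.
Context {R : realType}.
Variables (alpha beta nu x0 : R).

Definition zfreq (xi : R) : R[i] := nu +i* xi.

(* sqrtc is the principal square root, unlike sqrtC, whose values have
   nonnegative imaginary part. *)
Definition Lambda (xi : R) : R[i] :=
  zfreq xi /
  (1 - cexp ((beta%:C - sqrtc ((beta ^+ 2)%:C + (4 * alpha ^+ 2)%:C * zfreq xi))
             / (2 * alpha ^+ 2)%:C * x0%:C)).

Definition T_op (y : R -> R[i]) : R -> R[i] :=
  ifourier (fun xi => Lambda xi * fourier y xi).

Definition T_dom : set (R -> R[i]) :=
  [set y | L2 y /\ L2 (fun xi => Lambda xi * fourier y xi)].

Definition R_op (mu : R) (y : R -> R[i]) : R -> R[i] :=
  ifourier (fun xi => Lambda xi / (1 + mu ^+ 2 * xi ^+ 2)%:C * fourier y xi).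

(* uhat x is a representative of the Fourier transform of u x = u(x, .), chosen
   so that, for almost every xi, uhat ^~ xi can be differentiated. The bound M
   may depend on the frequency. *)
Definition frequency_system (u : R -> R -> R[i]) (y f : R -> R[i]) : Prop :=
  exists2 uhat : R -> R -> R[i],
    forall x, {ae lebesgue_measure, forall xi, uhat x xi = fourier (u x) xi} &
    {ae lebesgue_measure, forall xi,
      let v := uhat ^~ xi in
      [/\ forall x, [/\ cderivable v x, cderivable (cderive v) x &
            - (alpha ^+ 2)%:C * cderive (cderive v) x + beta%:C * cderive v x
              + zfreq xi * v x = fourier f xi],
          v 0 = 0,
          v x0 = fourier y xi &
          exists M l : R, (cmod (v x) @[x --> +oo%R] --> l) /\ l < M]}.

End SourceIdentification.

(* Main.v *)
Require Import Defs.
From HB Require Import structures.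
From mathcomp Require Import all_boot all_order all_algebra.
From mathcomp Require Import all_classical all_reals all_analysis.
From mathcomp Require Import measurable_realfun complex zify ring lra.

Import Order.TTheory GRing.Theory Num.Theory.
Import numFieldNormedType.Exports.

Local Open Scope classical_set_scope.
Local Open Scope ring_scope.

Set Implicit Arguments.
Unset Strict Implicit.
Unset Printing Implicit Defensive.

(** The operator [T] is the Fourier multiplier with symbol [Lambda], and [R_mu]
    the one with symbol [Lambda / (1 + mu^2 xi^2)].

    At a fixed frequency the equation is a linear second order equation in [x]
    with constant coefficients. Its characteristic roots have real parts of
    opposite strict signs, because [Re (sqrt (beta^2 + 4 alpha^2 z)) > beta]. A
    solution with a bounded modulus at infinity has no growing component, so the
    value 0 at [x = 0] determines it, and its value at [x0] gives
    [fhat = Lambda * yhat] ([bounded_ode_solution], [frequency_system_Lambda]).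
    Hence [y] is in the domain of [T], and [T y = f] by Fourier inversion.

    The decay rate of the bounded exponential is bounded below uniformly in the
    frequency, so [|Lambda xi| <= C (nu + |xi|)], and the symbol of [R_mu] is
    bounded by [K / mu] ([cmod_regularized_le]). Thus [R_mu] is bounded of norm
    [O (1 / mu)], while [R_mu y] tends to [T y] on the domain of [T] by dominated
    convergence on the frequency side ([regularized_cvg]). For noisy data the
    error is at most [O (delta / mu)] plus the error for exact data, and both
    tend to 0 for [mu] equal to [sqrt delta] for small [delta]
    ([choice_rule_convergent]).

    This rests on the L^2 theory of the Fourier transform: the transform exists
    as an L^2 limit of truncated integrals, is bounded, linear, and inverted by
    the transform of opposite sign. The real cosine and sine transforms of a
    truncated function are studied first. With the weight [exp (- e |x|)] in
    frequency, Fubini's theorem expresses their weighted inner products through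
    the Poisson kernel ([weighted_plancherel_cos]). Schur's test for this kernel
    bounds the transforms on L^2 ([ktr_bound]), which with the completeness of
    L^2 ([L2r_complete]) yields the transform of every L^2 function. The Poisson
    kernel is an approximate identity, so letting [e] tend to 0 gives Parseval's
    formula against indicators of intervals ([parseval_itv_cos]); since the
    transforms are symmetric ([is_ktr_adjoint]), the function and its twice
    transformed image have equal integrals over all intervals, hence agree
    almost everywhere ([is_ktr_inversion_cos], [ftK]). *)

(** * Square integrable real functions *)

Section RealL2.
Context {R : realType}.
Local Notation mu := (@lebesgue_measure R).
Implicit Types (f g h : R -> R).

(** Square integrability is measured by the squared norm [nsq]: it is a plain
    real integral, so that linearity, dominated convergence and Fubini's theorem
    apply to it directly. *)
Definition integr f : Prop := mu.-integrable setT (EFin \o f).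

Definition L2r f : Prop :=
  measurable_fun setT f /\ integr (fun x => f x ^+ 2).

Definition nsq f : R := \int[mu]_x (f x ^+ 2).

(** Inference does not find this filter through the measurable type that carries
    Lebesgue measure. *)
#[global] Instance ae_lebesgue_filter :
  Filter (nbhs (almost_everywhere (@lebesgue_measure R))).
Proof. exact: (ae_filter_ringOfSetsType (@lebesgue_measure R)). Qed.

Lemma integr_measurable f : integr f -> measurable_fun setT f.
Proof. by move=> /measurable_int /measurable_EFinP. Qed.

Lemma measEFin f : measurable_fun setT f -> measurable_fun setT (EFin \o f).
Proof. by move=> mf; apply/measurable_EFinP. Qed.

Lemma integr_le f g : measurable_fun setT f -> integr g ->
  (forall x, `|f x| <= g x) -> integr f.
Proof.
move=> mf ig fg; apply: le_integrable ig => //; first exact: measEFin.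
by move=> x _ /=; rewrite lee_fin (le_trans (fg x))// ler_norm.
Qed.

Lemma integrD f g : integr f -> integr g -> integr (fun x => f x + g x).
Proof. by move=> If Ig; have := integrableD measurableT If Ig. Qed.

Lemma integrB f g : integr f -> integr g -> integr (fun x => f x - g x).
Proof. by move=> If Ig; have := integrableB measurableT If Ig. Qed.

Lemma integrZ (c : R) f : integr f -> integr (fun x => c * f x).
Proof. by move=> If; have := integrableZl measurableT c If. Qed.

Lemma integr_norm f : integr f -> integr (fun x => `|f x|).
Proof. by move=> If; have := integrable_norm If. Qed.

Lemma integr_bddM f g (c : R) : integr f -> measurable_fun setT g ->
  (forall x, `|g x| <= c) -> integr (fun x => f x * g x).
Proof.
move=> If mg gc.
apply: (@integr_le _ (fun x => c * `|f x|)).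
- by apply: measurable_funM => //; exact: integr_measurable.
- exact/integrZ/integr_norm.
- by move=> x; rewrite normrM mulrC ler_wpM2r.
Qed.

Lemma integr_EFin f : integr f ->
  (\int[mu]_x (f x)%:E = (\int[mu]_x f x)%:E)%E.
Proof. by move=> If; rewrite /Rintegral fineK// integrable_fin_num. Qed.

Lemma integr_ge0P f : measurable_fun setT f -> (forall x, 0 <= f x) ->
  (\int[mu]_x (f x)%:E < +oo)%E -> integr f.
Proof.
move=> mf f0 foo; apply/integrableP; split; first exact: measEFin.
by under eq_integral do rewrite /= ger0_norm//.
Qed.

Lemma dominated_Rintegral (fn : nat -> R -> R) f g :
  (forall n, measurable_fun setT (fn n)) -> measurable_fun setT f ->
  integr g -> (forall n x, `|fn n x| <= g x) ->
  {ae mu, forall x, fn n x @[n --> \oo] --> f x} ->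
  integr f /\ \int[mu]_x fn n x @[n --> \oo] --> \int[mu]_x f x.
Proof.
move=> mfn mf ig fng fnf.
have [] := @dominated_convergence _ _ _ mu setT measurableT
  (fun n => EFin \o fn n) (EFin \o f) (EFin \o g).
- by move=> n; exact: measEFin.
- exact: measEFin.
- by apply: filterS fnf => x fx _; apply/fine_cvgP; split => //; exact: nearW.
- exact: ig.
- by apply: aeW => x n _; rewrite /= lee_fin.
- move=> If _ cf; split => //.
  have Ifn n : integr (fn n) by exact: integr_le ig (fng n).
  by apply: fine_cvg; rewrite integr_EFin in cf => //.
Qed.

Lemma fatou_Rintegral (fn : nat -> R -> R) f (c : R) :
  (forall n, integr (fn n)) -> measurable_fun setT f ->
  (forall n x, 0 <= fn n x) -> (forall x, 0 <= f x) ->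
  {ae mu, forall x, fn n x @[n --> \oo] --> f x} ->
  (forall n, \int[mu]_x fn n x <= c) ->
  integr f /\ \int[mu]_x f x <= c.
Proof.
move=> ifn mf fn0 f0 fnf fnc.
have mfn n : measurable_fun setT (EFin \o fn n).
  by apply: measEFin; exact: integr_measurable.
have le : (\int[mu]_x (f x)%:E <= c%:E)%E.
  apply: (@le_trans _ _ (\int[mu]_x (limn_einf (fun n => (fn n x)%:E)))%E).
    apply: ae_ge0_le_integral => //.
    - by move=> x _; rewrite lee_fin.
    - exact: measEFin.
    - move=> x _; rewrite limn_einf_lim; apply: lime_ge.
        exact: is_cvg_einfs.
      apply: nearW => n; apply: le_ereal_inf_tmp => _ [m _ <-].
      by rewrite lee_fin.
    - apply: (emeasurable_fun_cvg (fun n x => einfs (fun m => (fn m x)%:E) n)).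
        by move=> n; exact: (measurable_fun_einfs mfn).
      by move=> x _; rewrite limn_einf_lim; exact: is_cvg_einfs.
    - apply: filterS fnf => x fx _.
      rewrite (@cvg_limn_einf_sup _ (fun n => (fn n x)%:E) (f x)%:E)//.
      by apply/fine_cvgP; split => //; exact: nearW.
  apply: (le_trans (@fatou _ _ _ mu setT measurableT
    (fun n => EFin \o fn n) mfn _)).
    by move=> n x _; rewrite lee_fin.
  rewrite limn_einf_lim; apply: lime_le; first exact: is_cvg_einfs.
  apply: nearW => n; apply: (@le_trans _ _ (\int[mu]_x (fn n x)%:E)%E).
    by apply: ereal_inf_lbound; exists n => /=.
  by rewrite integr_EFin// lee_fin.
have If : integr f by apply: integr_ge0P => //; exact: le_lt_trans le (ltry _).
by split => //; rewrite -lee_fin -integr_EFin.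
Qed.

Lemma L2r_mul f g : L2r f -> L2r g -> integr (fun x => f x * g x).
Proof.
move=> [mf If] [mg Ig].
apply: (@integr_le _ (fun x => f x ^+ 2 + g x ^+ 2)).
- exact: measurable_funM.
- exact: integrD.
- move=> x; rewrite ler_norml; have := sqr_ge0 (f x + g x);
    have := sqr_ge0 (f x - g x); have := sqr_ge0 (f x); have := sqr_ge0 (g x); nra.
Qed.

Lemma L2r_le f g (c : R) : measurable_fun setT f -> L2r g ->
  (forall x, `|f x| <= c * `|g x|) -> L2r f.
Proof.
move=> mf [mg Ig] fg; split => //.
apply: (@integr_le _ (fun x => c ^+ 2 * g x ^+ 2)).
- exact: measurable_funX.
- exact: integrZ.
- move=> x; rewrite normrX -(real_normK (num_real (g x))) -exprMn.
  by rewrite lerXn2r ?nnegrE// (le_trans _ (fg x)).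
Qed.

Lemma L2rZ (c : R) f : L2r f -> L2r (fun x => c * f x).
Proof.
move=> Hf; apply: (@L2r_le _ f `|c|) => //; last by move=> x; rewrite normrM.
by apply: measurable_funM => //; case: Hf.
Qed.

Lemma L2rD f g : L2r f -> L2r g -> L2r (fun x => f x + g x).
Proof.
move=> Hf Hg; have [mf If] := Hf; have [mg Ig] := Hg.
split; first exact: measurable_funD.
rewrite (_ : (fun x => _) = (fun x => (f x ^+ 2 + g x ^+ 2) + 2 * (f x * g x))).
  by apply: integrD; [exact: integrD|exact/integrZ/L2r_mul].
by apply/funext => x; ring.
Qed.

Lemma L2rN f : L2r f -> L2r (fun x => - f x).
Proof.
move=> /(L2rZ (-1)); congr L2r; apply/funext => x; exact: mulN1r.
Qed.

Lemma L2rB f g : L2r f -> L2r g -> L2r (fun x => f x - g x).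
Proof. by move=> Hf Hg; apply: L2rD => //; exact: L2rN. Qed.

Lemma nsq_ge0 f : 0 <= nsq f.
Proof. by apply: Rintegral_ge0 => x _; exact: sqr_ge0. Qed.

Lemma nsq_le f g (c : R) : measurable_fun setT f -> L2r g ->
  (forall x, `|f x| <= c * `|g x|) -> nsq f <= c ^+ 2 * nsq g.
Proof.
move=> mf Hg fg; have [_ If] := L2r_le mf Hg fg.
rewrite /nsq -RintegralZl//; last by case: Hg.
apply: le_Rintegral => //; first exact/integrZ/Hg.2.
move=> x _; rewrite -(real_normK (num_real (g x))) -(real_normK (num_real (f x))).
by rewrite -exprMn lerXn2r ?nnegrE// (le_trans _ (fg x)).
Qed.

Lemma nsqZ (c : R) f : L2r f -> nsq (fun x => c * f x) = c ^+ 2 * nsq f.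
Proof.
move=> [_ If]; rewrite /nsq -RintegralZl//.
by apply: eq_Rintegral => x _; rewrite exprMn.
Qed.

Lemma nsqN f : nsq (fun x => - f x) = nsq f.
Proof. by apply: eq_Rintegral => x _; rewrite sqrrN. Qed.

Lemma nsqBC f g : nsq (fun x => f x - g x) = nsq (fun x => g x - f x).
Proof. by rewrite -nsqN; apply: eq_Rintegral => x _; rewrite opprB. Qed.

(** A triangle inequality up to a factor; squares are easier to handle than
    norms, and only smallness is ever at stake. *)
Lemma nsqD_le f g : L2r f -> L2r g ->
  nsq (fun x => f x + g x) <= 2 * nsq f + 2 * nsq g.
Proof.
move=> Hf Hg; have [_ Ifg] := L2rD Hf Hg; have [_ If] := Hf; have [_ Ig] := Hg.
rewrite /nsq -!RintegralZl// -RintegralD//; [|exact: integrZ..].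
apply: le_Rintegral => //; first by apply: integrD; exact: integrZ.
by move=> x _; have := sqr_ge0 (f x - g x); nra.
Qed.

Lemma nsqB_le f g : L2r f -> L2r g ->
  nsq (fun x => f x - g x) <= 2 * nsq f + 2 * nsq g.
Proof.
by move=> Hf Hg; apply: le_trans (nsqD_le Hf (L2rN Hg)) _; rewrite nsqN.
Qed.

Lemma nsq_eq0 f : L2r f -> nsq f = 0 -> {ae mu, forall x, f x = 0}.
Proof.
move=> [mf If] f0.
have mf2 : measurable_fun setT (fun x => (f x ^+ 2)%:E).
  by apply: measEFin; exact: measurable_funX.
have [+ _] := @ae_eq_integral_abs _ _ _ mu setT measurableT _ mf2.
have -> : (\int[mu]_x `|(f x ^+ 2)%:E| = 0)%E.
  transitivity (nsq f)%:E; last by rewrite f0.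
  rewrite /nsq -integr_EFin//; apply: eq_integral => x _ /=.
  by rewrite ger0_norm// sqr_ge0.
move=> /(_ erefl); apply: filterS => x /(_ Logic.I) /= [] /eqP.
by rewrite sqrf_eq0 => /eqP.
Qed.

(** The inner product is continuous in one argument; this is the
    Cauchy-Schwarz inequality in the form 2|fg| <= k f^2 + g^2 / k. *)
Lemma nsq_cvg0_pairing (T : Type) (F : set_system T) {FF : Filter F}
    (fn : T -> R -> R) g :
  (forall n, L2r (fn n)) -> L2r g -> nsq (fn n) @[n --> F] --> (0 : R) ->
  \int[mu]_x (fn n x * g x) @[n --> F] --> (0 : R).
Proof.
move=> Hfn Hg fn0; apply/cvgr0Pnorm_le => e e0.
pose k := (nsq g + 1) / e.
have k0 : 0 < k by rewrite divr_gt0// ltr_wpDl// nsq_ge0.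
have ek0 : 0 < e / k by rewrite divr_gt0.
move/cvgr0Pnorm_le : fn0 => /(_ _ ek0); apply: filterS => n.
rewrite ger0_norm ?nsq_ge0// => nfn.
have [_ Ifn] := Hfn n; have [_ Ig] := Hg.
apply: (le_trans (le_normr_Rintegral measurableT (L2r_mul (Hfn n) Hg))).
apply: (@le_trans _ _ (\int[mu]_x ((k / 2) * fn n x ^+ 2 + (2 * k)^-1 * g x ^+ 2))).
  apply: le_Rintegral => //.
  - exact/integr_norm/L2r_mul.
  - by apply: integrD; exact: integrZ.
  - move=> x _.
    have -> : k / 2 * fn n x ^+ 2 + (2 * k)^-1 * g x ^+ 2 =
      (2 * k)^-1 * ((k * fn n x) ^+ 2 + g x ^+ 2) by field; rewrite gt_eqF.
    have -> : `|fn n x * g x| = (2 * k)^-1 * (2 * (`|k * fn n x| * `|g x|)).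
      rewrite (normrM k) (normrM (fn n x)) (gtr0_norm k0).
      by field; rewrite gt_eqF.
    apply: ler_wpM2l; first by rewrite invr_ge0 mulr_ge0// (ltW k0).
    rewrite -(real_normK (num_real (k * fn n x))).
    rewrite -(real_normK (num_real (g x))).
    by have := sqr_ge0 (`|k * fn n x| - `|g x|); nra.
rewrite RintegralD//; [|exact: integrZ..].
rewrite !RintegralZl// -/(nsq _) -/(nsq _).
have h1 : k / 2 * nsq (fn n) <= e / 2.
  rewrite (_ : e / 2 = k / 2 * (e / k)); last by field; rewrite gt_eqF.
  by rewrite ler_wpM2l// divr_ge0// ltW.
have h2 : (2 * k)^-1 * nsq g <= e / 2.
  rewrite /k invfM invf_div mulrA -mulrA [e / 2]mulrC -mulrA ler_wpM2l//.
  rewrite -mulrA ler_piMr ?(ltW e0)// mulrC ler_pdivrMr ?mul1r ?lerDl//.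
  by rewrite ltr_wpDl// nsq_ge0.
by rewrite (splitr e) lerD.
Qed.

End RealL2.

(** * Completeness of L^2 and truncations *)

Section Completeness.
Context {R : realType}.
Local Notation mu := (@lebesgue_measure R).
Implicit Types (f g h : R -> R).

(** Riesz' argument: summable increments are dominated by a geometric series
    wherever the integrable function [\sum_j 4 ^ j * (F j.+1 - F j) ^ 2] is
    finite. *)
Lemma fast_cauchy_ae_cvg (F : nat -> R -> R) :
  (forall n, L2r (F n)) ->
  (forall j, nsq (fun x => F j.+1 x - F j x) <= (4 ^+ j)^-1 / (2 ^ j.+1)%:R) ->
  {ae mu, forall x, cvgn (F ^~ x)}.
Proof.
move=> LF dF; pose d j x := F j.+1 x - F j x.
have Ld j : L2r (d j) by exact: L2rB.
pose s j x := (4 ^+ j * d j x ^+ 2)%:E.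
have p4 j : 0 < 4 ^+ j :> R by rewrite exprn_gt0// ltr0n.
have s0 j x : (0 <= s j x)%E.
  by rewrite lee_fin; apply: mulr_ge0; [exact: ltW|exact: sqr_ge0].
have ms j : measurable_fun setT (s j).
  apply: measEFin; apply: measurable_funM => //.
  by apply: measurable_funX; case: (Ld j).
have Is : (\int[mu]_x (\sum_(j <oo) s j x) < +oo)%E.
  rewrite integral_nneseries//.
  apply: (@le_lt_trans _ _ 1%E); last exact: ltry.
  apply: le_trans (@epsilon_trick0 R 1 xpredT ler01).
  apply: lee_nneseries => [j _ _|j _]; first by apply: integral_ge0 => x _.
  rewrite integr_EFin; last by apply: integrZ; case: (Ld j).
  rewrite RintegralZl//; last by case: (Ld j).
  by rewrite lee_fin div1r mulrC -ler_pdivlMr// mulrC; exact: dF.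
have iS : mu.-integrable setT (fun x => \sum_(j <oo) s j x)%E.
  apply/integrableP; split.
    by apply: ge0_emeasurable_sum => *; [exact: s0|exact: ms].
  apply: le_lt_trans Is; rewrite le_eqVlt; apply/orP; left; apply/eqP.
  by apply: eq_integral => x _; rewrite gee0_abs// nneseries_ge0.
have [N [mN N0 subN]] := integrable_ae measurableT iS.
exists N; split => //.
apply: subset_trans subN => x /= ncv fx; apply: ncv.
have {}fx := fx Logic.I.
pose M := fine (\sum_(j <oo) s j x)%E.
have M0 : 0 <= M by rewrite fine_ge0// nneseries_ge0.
have dM j : 4 ^+ j * d j x ^+ 2 <= M.
  rewrite -lee_fin /M fineK//.
  rewrite (@nneseriesD1 R (s^~ x) j xpredT (fun k _ => s0 k x) isT).
  by apply: leeDl; apply: nneseries_ge0 => k _ _; exact: s0.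
have dle j : `|d j x| <= geometric (Num.sqrt M) 2^-1 j.
  rewrite /geometric /= -(@ler_pXn2r _ 2%N)// ?nnegrE ?mulr_ge0 ?sqrtr_ge0 ?exprn_ge0//.
  rewrite real_normK ?num_real// exprMn sqr_sqrtr// exprVn exprVn -exprM mulnC exprM.
  rewrite ler_pdivlMr// mulrC.
  by rewrite (_ : 2 ^+ 2 = 4) ?dM//; ring.
have cd : cvgn (series (fun j => d j x)).
  apply: (@normed_cvg R R^o); apply: (series_le_cvg _ _ dle) => //.
    by move=> j; rewrite /geometric/= mulr_ge0 ?sqrtr_ge0 ?exprn_ge0.
  by apply: is_cvg_geometric_series; rewrite ger0_norm// invf_lt1// ltr1n.
rewrite (_ : F ^~ x = (fun n => F 0%N x + series (fun j => d j x) n)).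
  by apply: is_cvgD => //; exact: is_cvg_cst.
by apply/funext => n; exact: (@eq_sum_telescope _ (F ^~ x)).
Qed.

(** Completeness of L^2, with an explicit rate: the limit is within [e n] of
    the n-th term by Fatou's lemma. *)
Lemma L2r_complete (F : nat -> R -> R) (e : nat -> R) :
  (forall n, L2r (F n)) ->
  (forall n m, (n <= m)%N -> nsq (fun x => F m x - F n x) <= e n) ->
  e n @[n --> \oo] --> (0 : R) ->
  exists2 h, L2r h & forall n, nsq (fun x => h x - F n x) <= e n.
Proof.
move=> LF Fe e0.
pose c j : R := (4 ^+ j)^-1 / (2 ^ j.+1)%:R.
have c0 j : 0 < c j by rewrite divr_gt0 ?invr_gt0 ?exprn_gt0 ?ltr0n ?expn_gt0.
have /choice[N NP] : forall j, exists N, forall n, (N <= n)%N -> e n <= c j.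
  move=> j; move/cvgrPdist_le : e0 => /(_ _ (c0 j)) [N _ NP].
  exists N => n /NP /=; rewrite sub0r normrN; exact: le_trans (ler_norm _).
(* The sum makes [k] nondecreasing and at least [N j]; adding [j] makes it
   unbounded. *)
pose k j := (\sum_(i < j.+1) N i + j)%N.
have kS j : (k j <= k j.+1)%N.
  by rewrite /k [X in (_ <= X + _)%N]big_ord_recr /=; lia.
have kN j : (N j <= k j)%N.
  by rewrite /k big_ord_recr /=; lia.
have jk j : (j <= k j)%N by rewrite /k leq_addl.
have [Z [mZ Z0 subZ]] : {ae mu, forall x, cvgn (fun j => F (k j) x)}.
  apply: fast_cauchy_ae_cvg => [n|j]; first exact: LF.
  exact: le_trans (Fe _ _ (kS j)) (NP j _ (kN j)).
pose G j := F (k j) \_ (~` Z).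
have mG j : measurable_fun setT (G j).
  apply/(measurable_restrictT _ _).1; first exact: measurableC.
  by apply: measurable_funTS; case: (LF (k j)).
have cG x : G ^~ x @ \oo --> limn (G ^~ x).
  have [xZ|xZ] := boolP (x \in ~` Z); last first.
    rewrite (_ : G ^~ x = cst 0); first exact: is_cvg_cst.
    by apply/funext => j; rewrite /G patchE (negbTE xZ).
  rewrite (_ : G ^~ x = fun j => F (k j) x).
    by apply: contrapT => nc; move: xZ; rewrite inE => /(_ (subZ _ nc)).
  by apply/funext => j; rewrite /G patchE xZ.
pose h x := limn (G ^~ x).
have mh : measurable_fun setT h.
  by apply: (measurable_fun_cvg mG) => x _; exact: cG.
have aeh : {ae mu, forall x, F (k j) x @[j --> \oo] --> h x}.
  exists Z; split => //; apply: subset_trans (@subset_refl _ Z) => x /= nc.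
  apply: contrapT => xZ; apply: nc.
  rewrite (_ : (fun j => F (k j) x) = G ^~ x); first exact: cG.
  by apply/funext => j; rewrite /G patchE mem_set.
have bnd n : integr (fun x => (h x - F n x) ^+ 2) /\
    nsq (fun x => h x - F n x) <= e n.
  apply: (@fatou_Rintegral _ (fun j x => (F (k (j + n)%N) x - F n x) ^+ 2)).
  - by move=> j; case: (L2rB (LF (k (j + n)%N)) (LF n)).
  - by apply: measurable_funX; apply: measurable_funB => //; case: (LF n).
  - by move=> j x; exact: sqr_ge0.
  - by move=> x; exact: sqr_ge0.
  - apply: filterS aeh => x hx.
    have hx' : F (k (j + n)%N) x - F n x @[j --> \oo] --> h x - F n x.
      apply: cvgB; last exact: cvg_cst.
      by move: hx; rewrite -(cvg_shiftn n).
    by rewrite expr2; under eq_cvg do rewrite expr2; exact: cvgM.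
  - by move=> j; apply: Fe; rewrite (leq_trans _ (jk _))// leq_addl.
exists h; last by move=> n; case: (bnd n).
have -> : h = (fun x => (h x - F 0%N x) + F 0%N x).
  by apply/funext => x; rewrite subrK.
apply: L2rD => //; split; last by case: (bnd 0%N).
by apply: measurable_funB => //; case: (LF 0%N).
Qed.

Definition trunc (A : R) f : R -> R := f \_ `[- A, A].

Lemma truncE A f x : trunc A f x = if - A <= x <= A then f x else 0.
Proof. by rewrite /trunc patchE mem_setE in_itv. Qed.

Lemma restrict_itv_L2r (a b : R) f : L2r f -> L2r (f \_ `[a, b]).
Proof.
move=> Lf; apply: (@L2r_le _ _ f 1) => //.
  apply/(measurable_restrictT _ _).1 => //; apply: measurable_funTS.
  by case: Lf.
by move=> x; rewrite mul1r patchE; case: ifP => // _; rewrite normr0.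
Qed.

Lemma restrict_itv_integr (a b : R) f : L2r f -> integr (f \_ `[a, b]).
Proof.
move=> Lf; have [mf If] := Lf.
apply: (@integr_le _ _ (fun x => \1_`[a, b] x + f x ^+ 2)).
- by case: (restrict_itv_L2r a b Lf).
- by apply: integrD => //; exact: integrable_indic_itv.
- move=> x; rewrite patchE indicE; case: ifP => _.
    rewrite -(real_normK (num_real (f x))) /=.
    by have := sqr_ge0 (`|f x| - 1); have := sqr_ge0 (f x); nra.
  by rewrite normr0 add0r sqr_ge0.
Qed.

Lemma trunc_L2r A f : L2r f -> L2r (trunc A f).
Proof. exact: restrict_itv_L2r. Qed.

Lemma trunc_integr A f : L2r f -> integr (trunc A f).
Proof. exact: restrict_itv_integr. Qed.

Lemma nsq_trunc_le A f : L2r f -> nsq (trunc A f) <= nsq f.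
Proof.
move=> Lf; rewrite -[leRHS]mul1r -(expr1n R 2); apply: nsq_le => //.
  by case: (trunc_L2r A Lf).
by move=> x; rewrite mul1r truncE; case: ifP => // _; rewrite normr0.
Qed.

Lemma nsq_trunc_tail (A B : R) f : A <= B -> L2r f ->
  nsq (fun x => trunc B f x - trunc A f x) <= nsq (fun x => f x - trunc A f x).
Proof.
move=> AB Lf; rewrite -[leRHS]mul1r -(expr1n R 2); apply: nsq_le.
- by case: (L2rB (trunc_L2r B Lf) (trunc_L2r A Lf)).
- by apply: L2rB => //; exact: trunc_L2r.
- move=> x; rewrite mul1r !truncE.
  case: (boolP (- A <= x <= A)) => [/andP[xA Ax]|_].
    by rewrite (le_trans _ xA) ?lerN2// (le_trans Ax).
  by rewrite !subr0; case: ifP => // _; rewrite normr0.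
Qed.

Lemma nsq_trunc_cvg f : L2r f ->
  nsq (fun x => f x - trunc A f x) @[A --> +oo] --> (0 : R).
Proof.
move=> Lf; have [mf If] := Lf; apply/cvg_pinftyP => u /cvgryPge uoo.
have : \int[mu]_x (f x - trunc (u n) f x) ^+ 2 @[n --> \oo] -->
    \int[mu]_x (cst (0 : R) x).
  apply: (@dominated_Rintegral _ _ _ (fun x => f x ^+ 2) _ _ If _ _).2.
  - move=> n; apply: measurable_funX; apply: measurable_funB => //.
    by case: (trunc_L2r (u n) Lf).
  - exact: measurable_cst.
  - move=> n x; rewrite ger0_norm ?sqr_ge0// truncE; case: ifP => _.
      by rewrite subrr expr0n sqr_ge0.
    by rewrite subr0.
  - apply: aeW => x; apply: cvg_near_cst; have := uoo `|x|; apply: filterS => n.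
    by rewrite ler_norml truncE => ->; rewrite subrr expr0n.
by rewrite Rintegral_cst// mul0r.
Qed.

(** The derivative of the vanishing primitive of [f] is [f] at almost every
    point. *)
Lemma itv_integral_eq0_ae f : L2r f ->
  (forall a b, \int[mu]_(x in `[a, b]) f x = 0) -> {ae mu, forall x, f x = 0}.
Proof.
move=> Lf f0.
have If a b : mu.-integrable `[a, b] (EFin \o f).
  apply/integrable_mkcond => //.
  by have := restrict_itv_integr a b Lf; rewrite /integr -restrict_EFin.
have lf : locally_integrable [set: R] f.
  split; [by case: Lf|exact: openT|] => K _ cK.
  have [M [_ MK]] := compact_bounded cK.
  have KM : K `<=` `[- (`|M| + 1), `|M| + 1].
    move=> x /MK /= xM; rewrite in_itv /= -ler_norml; apply: xM.
    by rewrite (le_lt_trans (ler_norm M))// ltrDl.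
  have /integrableP[_] : mu.-integrable K (EFin \o f).
    apply: (@integrableS _ _ _ mu `[- (`|M| + 1), `|M| + 1] K).
    - exact: measurable_itv.
    - exact: compact_measurable.
    - exact: KM.
    - exact: If.
  by [].
have H n : {ae mu, forall x, - n%:R < x -> f x = 0}.
  apply: filterS (@FTC1 R f (BLeft (- n%:R)) (fun y => If _ y) lf).
  move=> x + nx.
  case; first exact: nx.
  move=> _ <-.
  rewrite (_ : (fun _ => _) = cst 0) ?derive1_cst//.
  by apply/funext => y; exact: f0.
apply: filterS (ae_foralln H) => x fx.
apply: (fx (Num.bound `|x|)); rewrite ltrNl.
by apply: le_lt_trans (archi_boundP (normr_ge0 x)); rewrite -normrN ler_norm.
Qed.

End Completeness.

(** * Exponential weights and the Poisson kernel *)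

Section ElementaryIntegrals.
Context {R : realType}.
Local Notation mu := (@lebesgue_measure R).
Implicit Types (f g : R -> R).

Lemma is_derive_continuous f (x df : R) : is_derive x 1 f df ->
  {for x, continuous f}.
Proof.
by move=> [+ _] => fd; apply: differentiable_continuous; exact/derivable1_diffP.
Qed.

Lemma is_derive_Rintegral f g (a b : R) : a <= b -> continuous f ->
  (forall x : R, is_derive x 1 g (f x)) ->
  \int[mu]_(x in `[a, b]) f x = g b - g a.
Proof.
rewrite le_eqVlt => /predU1P[<- _ _|ab cf df].
  by rewrite set_itv1 Rintegral_set1 subrr.
have cg x : {for x, continuous g} by exact: is_derive_continuous.
rewrite /Rintegral (@continuous_FTC2 R f g)//.
- exact: continuous_subspaceT.
- split.
  + by move=> x _; case: (df x).
  + exact/cvg_at_right_filter/cg.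
  + exact/cvg_at_left_filter/cg.
- by move=> x _; rewrite derive1E; apply: derive_val.
Qed.

Lemma is_derive_scale_comp f (df : R -> R) (k x : R) :
  (forall y : R, is_derive y 1 f (df y)) ->
  is_derive x 1 (fun y => f (k * y)) (k * df (k * x)).
Proof.
move=> Hf; rewrite mulrC.
have Hk : is_derive x 1 (fun y => k * y) k.
  apply: (is_derive_eq (is_deriveZ k (is_derive_id x 1))).
  by rewrite /GRing.scale/= mulr1.
exact: (@is_derive1_comp R f (fun y => k * y) x _ _ (Hf _) Hk).
Qed.

Lemma is_derive_scale (c x df : R) f : is_derive x 1 f df ->
  is_derive x 1 (fun y => c * f y) (c * df).
Proof. by move=> Hf; exact: (is_deriveZ c Hf). Qed.

Lemma is_derive_mul f g (x df dg : R) : is_derive x 1 f df ->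
  is_derive x 1 g dg ->
  is_derive x 1 (fun y => f y * g y) (f x * dg + g x * df).
Proof. by move=> Hf Hg; exact: (is_deriveM Hf Hg). Qed.

Lemma is_derive_add f g (x df dg : R) : is_derive x 1 f df ->
  is_derive x 1 g dg -> is_derive x 1 (fun y => f y + g y) (df + dg).
Proof. by move=> Hf Hg; exact: (is_deriveD Hf Hg). Qed.

Lemma continuous_cosM (u : R) : continuous (fun x : R => cos (u * x)).
Proof.
move=> x.
exact: (is_derive_continuous (is_derive_scale_comp u x (@is_derive_cos R))).
Qed.

Lemma continuous_sinM (u : R) : continuous (fun x : R => sin (u * x)).
Proof.
move=> x.
exact: (is_derive_continuous (is_derive_scale_comp u x (@is_derive_sin R))).
Qed.

Section expR_trig.
Variables (k u : R).
Hypothesis ku : k ^+ 2 + u ^+ 2 != 0.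

Definition expR_cos_primitive (x : R) : R :=
  (k ^+ 2 + u ^+ 2)^-1 * (expR (k * x) * (k * cos (u * x) + u * sin (u * x))).

Definition expR_sin_primitive (x : R) : R :=
  (k ^+ 2 + u ^+ 2)^-1 * (expR (k * x) * (k * sin (u * x) + - u * cos (u * x))).

Let dexp x := is_derive_scale_comp k x (@is_derive_expR R).
Let dcos x := is_derive_scale_comp u x (@is_derive_cos R).
Let dsin x := is_derive_scale_comp u x (@is_derive_sin R).

Lemma is_derive_expR_cos (x : R) :
  is_derive x 1 expR_cos_primitive (expR (k * x) * cos (u * x)).
Proof.
apply: (is_derive_eq (is_derive_scale _ (is_derive_mul (dexp x)
  (is_derive_add (is_derive_scale _ (dcos x)) (is_derive_scale _ (dsin x)))))).
by field.
Qed.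

Lemma is_derive_expR_sin (x : R) :
  is_derive x 1 expR_sin_primitive (expR (k * x) * sin (u * x)).
Proof.
apply: (is_derive_eq (is_derive_scale _ (is_derive_mul (dexp x)
  (is_derive_add (is_derive_scale _ (dsin x)) (is_derive_scale _ (dcos x)))))).
by field.
Qed.

End expR_trig.

(** Abel's convergence factor: frequency integrals become absolutely convergent,
    and letting [e] tend to 0 recovers the unweighted ones. *)
Definition weight (e x : R) : R := expR (- (e * `|x|)).

Lemma weight_gt0 e x : 0 < weight e x. Proof. exact: expR_gt0. Qed.

Lemma weight_le1 e x : 0 <= e -> weight e x <= 1.
Proof. by move=> e0; rewrite /weight -expR0 ler_expR oppr_le0 mulr_ge0. Qed.

Lemma continuous_weight e : continuous (weight e).
Proof.
move=> x; apply: (@continuous_comp _ _ _ (fun y => - (e * `|y|)) expR).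
  by apply: cvgN; apply: cvgM; [exact: cvg_cst|exact: norm_continuous].
exact: continuous_expR.
Qed.

Lemma measurable_weight e : measurable_fun setT (weight e).
Proof. by apply: continuous_measurable_fun; exact: continuous_weight. Qed.

Section weight_integral.
Variable e : R.
Hypothesis e0 : 0 < e.

(** The two half-lines contribute the same primitive with opposite rates. *)
Lemma weight_split (f g h : R -> R) (n : R) : 0 <= n ->
  continuous f ->
  (forall x : R, is_derive x 1 g (expR (e * x) * f x)) ->
  (forall x : R, is_derive x 1 h (expR (- e * x) * f x)) ->
  \int[mu]_(x in `[- n, n]) (weight e x * f x) =
  (g 0 - g (- n)) + (h n - h 0).
Proof.
move=> n0 cf dg dh.
have cw : continuous (fun x => weight e x * f x).
  by move=> x; apply: cvgM; [exact: continuous_weight|exact: cf].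
have ce (k : R) : continuous (fun x => expR (k * x) * f x).
  move=> x; apply: cvgM; last exact: cf.
  exact: is_derive_continuous (is_derive_scale_comp k x (@is_derive_expR R)).
have iw : mu.-integrable `[- n, n] (EFin \o (fun x => weight e x * f x)).
  apply: continuous_compact_integrable; first exact: segment_compact.
  exact: continuous_subspaceT.
have nn : - n <= n by rewrite (le_trans _ n0)// oppr_le0.
have -> : \int[mu]_(x in `[- n, n]) (weight e x * f x) =
    \int[mu]_(x in `[- n, 0]) (weight e x * f x) +
    \int[mu]_(x in `]0, n]) (weight e x * f x).
  apply/eqP; rewrite addrC -subr_eq; apply/eqP.
  by apply: Rintegral_itvB => //; rewrite bnd_simp ?oppr_le0.
rewrite Rintegral_itv_obnd_cbnd; last first.
  apply: integrableS iw => //.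
  by apply: subset_itvr; rewrite bnd_simp oppr_le0.
congr (_ + _).
- rewrite -(is_derive_Rintegral _ (ce e) dg) ?oppr_le0//.
  apply: eq_Rintegral => x; rewrite inE/= in_itv/= => /andP[_ x0].
  by rewrite /weight ler0_norm// mulrN opprK.
- rewrite -(is_derive_Rintegral _ (ce (- e)) dh)//.
  apply: eq_Rintegral => x; rewrite inE/= in_itv/= => /andP[x0 _].
  by rewrite /weight ger0_norm// mulNr.
Qed.

Let eu u : e ^+ 2 + u ^+ 2 != 0.
Proof. by rewrite gt_eqF// ltr_pwDl ?exprn_gt0// sqr_ge0. Qed.

Let eu' u : (- e) ^+ 2 + u ^+ 2 != 0. Proof. by rewrite sqrrN. Qed.

Lemma cvg0_expR_bounded (b : nat -> R) (c : R) : (forall n, `|b n| <= c) ->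
  expR (- (e * n%:R)) * b n @[n --> \oo] --> (0 : R).
Proof.
move=> bc.
have E0 : expR (- (e * n%:R)) * c @[n --> \oo] --> (0 : R).
  rewrite -(mul0r c); apply: cvgM; last exact: cvg_cst.
  have ey : e * n%:R @[n --> \oo] --> +oo.
    apply/cvgryPge => A; have /cvgryPge/(_ (A / e)) := @cvgr_idn R.
    by apply: filterS => n; rewrite ler_pdivrMr// mulrC.
  by have := cvg_comp _ _ ey (@cvgr_expR R).
apply/cvgr0Pnorm_le => d d0; move/cvgr0Pnorm_le : E0 => /(_ _ d0).
apply: filterS => n; apply: le_trans; rewrite !normrM ler_wpM2l//.
exact: le_trans (bc n) (ler_norm c).
Qed.

Lemma weight_cos_cvg u :
  \int[mu]_(x in `[- n%:R, n%:R]) (weight e x * cos (u * x)) @[n --> \oo] -->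
  2 * e / (e ^+ 2 + u ^+ 2).
Proof.
pose r n := (e ^+ 2 + u ^+ 2)^-1 * (2 * (u * sin (u * n%:R) - e * cos (u * n%:R))).
have -> : (fun n => \int[mu]_(x in `[- n%:R, n%:R]) (weight e x * cos (u * x))) =
    (fun n => 2 * e / (e ^+ 2 + u ^+ 2) + expR (- (e * n%:R)) * r n).
  apply/funext => n.
  rewrite (weight_split (ler0n _ n) (@continuous_cosM u)
    (is_derive_expR_cos (eu u)) (is_derive_expR_cos (eu' u))).
  rewrite /expR_cos_primitive /r !mulr0 !expR0 cos0 sin0 !mulrN cosN sinN !mulNr sqrrN.
  by field; exact: eu.
rewrite -[X in _ --> X]addr0; apply: cvgD; first exact: cvg_cst.
apply: (@cvg0_expR_bounded _ ((e ^+ 2 + u ^+ 2)^-1 * (2 * (`|u| + `|e|)))) => n.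
have d0 : 0 < e ^+ 2 + u ^+ 2 by rewrite ltr_pwDl ?exprn_gt0// sqr_ge0.
rewrite /r normrM ger0_norm ?invr_ge0 ?(ltW d0)// ler_wpM2l ?invr_ge0 ?(ltW d0)//.
rewrite normrM ger0_norm// ler_wpM2l// (le_trans (ler_normB _ _))// lerD// normrM.
  by rewrite ler_piMr// sin_max.
by rewrite ler_piMr// cos_max.
Qed.

Lemma weight_sin_eq0 u (n : nat) :
  \int[mu]_(x in `[- n%:R, n%:R]) (weight e x * sin (u * x)) = 0.
Proof.
rewrite (weight_split (ler0n _ n) (@continuous_sinM u)
  (is_derive_expR_sin (eu u)) (is_derive_expR_sin (eu' u))).
rewrite /expR_sin_primitive !mulr0 !expR0 cos0 sin0 !mulrN cosN sinN !mulNr sqrrN.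
by field; try exact: eu.
Qed.

Lemma Rintegral_trunc f (n : R) :
  \int[mu]_(x in `[- n, n]) f x = \int[mu]_x trunc n f x.
Proof. by rewrite Rintegral_mkcond. Qed.

Lemma trunc_cvg f x : trunc n%:R f x @[n --> \oo] --> f x.
Proof.
apply: cvg_near_cst; near=> n; rewrite truncE -ler_norml ifT//.
by near: n; exact: nbhs_infty_ger.
Unshelve. all: by end_near. Qed.

Lemma measurable_trunc f (n : R) : measurable_fun setT f ->
  measurable_fun setT (trunc n f).
Proof.
by move=> mf; apply/(measurable_restrictT _ _).1 => //; exact: measurable_funTS.
Qed.

Lemma trunc_norm_le f (n x : R) : `|trunc n f x| <= `|f x|.
Proof. by rewrite truncE; case: ifP => // _; rewrite normr0. Qed.

Lemma Rintegral_trunc_cvg f : integr f ->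
  \int[mu]_(x in `[- n%:R, n%:R]) f x @[n --> \oo] --> \int[mu]_x f x.
Proof.
move=> If; under eq_cvg do rewrite Rintegral_trunc.
have mf := integr_measurable If.
apply: (@dominated_Rintegral _ _ _ (fun x => `|f x|) _ mf _ _ _).2.
- by move=> n; exact: measurable_trunc.
- exact: integr_norm.
- by move=> n x; exact: trunc_norm_le.
- by apply: aeW => x; exact: trunc_cvg.
Qed.

Lemma integr_trunc_continuous f (n : R) : continuous f -> integr (trunc n f).
Proof.
move=> cf.
have If : mu.-integrable `[- n, n] (EFin \o f).
  apply: continuous_compact_integrable; first exact: segment_compact.
  exact: continuous_subspaceT.
have mD : measurable (`[- n, n] : set (measurableTypeR R)) by [].
have [+ _] := @integrable_mkcond _ _ _ mu _ (EFin \o f) mD.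
by move=> /(_ If); rewrite restrict_EFin.
Qed.

(** Fatou's lemma: the integrals over [[-n, n]] converge, by the explicit
    primitive at frequency 0. *)
Lemma integr_weight : integr (weight e).
Proof.
have W0 := @weight_cos_cvg 0.
have [c cP] : exists c, forall n,
    \int[mu]_x (trunc n%:R (weight e) x) <= c.
  have /cvg_seq_bounded[c [_ Hc]] := cvgP _ W0.
  exists (`|c| + 1) => n; rewrite -Rintegral_trunc.
  apply: le_trans (Hc (`|c| + 1) _ n Logic.I); last first.
    by rewrite (le_lt_trans (ler_norm c))// ltrDl.
  apply: le_trans (ler_norm _); rewrite le_eqVlt; apply/orP; left; apply/eqP.
  by apply: eq_Rintegral => x _; rewrite mul0r cos0 mulr1.
have cw := @continuous_weight e.
apply: (fatou_Rintegral _ _ _ _ _ cP).1.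
- by move=> n; exact: integr_trunc_continuous.
- exact: measurable_weight.
- by move=> n x; rewrite truncE; case: ifP => // _; exact/ltW/weight_gt0.
- by move=> x; exact/ltW/weight_gt0.
- by apply: aeW => x; exact: trunc_cvg.
Qed.

Lemma integr_weightM (f : R -> R) (c : R) : measurable_fun setT f ->
  (forall x, `|f x| <= c) -> integr (fun x => weight e x * f x).
Proof. by move=> mf fc; apply: integr_bddM fc => //; exact: integr_weight. Qed.

Lemma measurable_cosM u : measurable_fun setT (fun x : R => cos (u * x)).
Proof.
by apply: continuous_measurable_fun; exact: continuous_cosM.
Qed.

Lemma measurable_sinM u : measurable_fun setT (fun x : R => sin (u * x)).
Proof.
by apply: continuous_measurable_fun; exact: continuous_sinM.
Qed.

(** Up to normalisation the transform of [weight e] is the Poisson kernel of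
    the upper half plane at height [e]. *)
Definition poisson (u : R) : R := 2 * e / (e ^+ 2 + u ^+ 2).

Lemma weight_cosE u : \int[mu]_x (weight e x * cos (u * x)) = poisson u.
Proof.
have If : integr (fun x => weight e x * cos (u * x)).
  by apply: (@integr_weightM _ 1); [exact: measurable_cosM|move=> x; exact: cos_max].
rewrite -(cvg_lim (@Rhausdorff R) (Rintegral_trunc_cvg If)).
exact: (cvg_lim (@Rhausdorff R) (@weight_cos_cvg u)).
Qed.

Lemma weight_sinE u : \int[mu]_x (weight e x * sin (u * x)) = 0.
Proof.
have If : integr (fun x => weight e x * sin (u * x)).
  by apply: (@integr_weightM _ 1); [exact: measurable_sinM|move=> x; exact: sin_max].
rewrite -(cvg_lim (@Rhausdorff R) (Rintegral_trunc_cvg If)).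
apply: (cvg_lim (@Rhausdorff R)).
by under eq_cvg do rewrite weight_sin_eq0; exact: cvg_cst.
Qed.

Lemma poisson_gt0 u : 0 < poisson u.
Proof. by rewrite divr_gt0 ?mulr_gt0// ltr_pwDl ?exprn_gt0// sqr_ge0. Qed.

Lemma is_derive_poisson (s t : R) :
  is_derive t 1 (fun t => 2 * atan (e^-1 * t - e^-1 * s)) (poisson (s - t)).
Proof.
have D : is_derive t 1 (fun t => e^-1 * t - e^-1 * s) e^-1.
  apply: (is_derive_eq (is_derive_add (is_derive_scale e^-1
    (is_derive_id t 1)) (is_derive_cst (- (e^-1 * s)) t 1))).
  by rewrite mulr1 addr0.
apply: (is_derive_eq (is_derive_scale 2
  (@is_derive1_comp R atan _ t _ _ (is_derive1_atan _) D))).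
rewrite /poisson; have : 0 < 1 + (e^-1 * t - e^-1 * s) ^+ 2.
  by rewrite ltr_pwDl// sqr_ge0.
have : 0 < e ^+ 2 + (s - t) ^+ 2 by rewrite ltr_pwDl ?exprn_gt0// sqr_ge0.
move=> /gt_eqF/negbT h1 /gt_eqF/negbT h2.
have -> : 1 + (e^-1 * t - e^-1 * s) ^+ 2 = (e ^+ 2 + (s - t) ^+ 2) / e ^+ 2.
  by field; rewrite gt_eqF.
by field; rewrite h1 gt_eqF.
Qed.

Lemma continuous_poisson s : continuous (fun t => poisson (s - t)).
Proof.
move=> t; apply: cvgM; first exact: cvg_cst.
apply: cvgV.
  by rewrite gt_eqF// ltr_pwDl ?exprn_gt0// sqr_ge0.
apply: cvgD; first exact: cvg_cst.
by rewrite expr2; under eq_cvg do rewrite expr2; apply: cvgM; apply: cvgB => //;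
  exact: cvg_cst.
Qed.

Lemma poisson_itv s (a b : R) : a <= b ->
  \int[mu]_(t in `[a, b]) poisson (s - t) =
  2 * atan (e^-1 * b - e^-1 * s) - 2 * atan (e^-1 * a - e^-1 * s).
Proof.
move=> ab.
exact: (is_derive_Rintegral ab (@continuous_poisson s) (is_derive_poisson s)).
Qed.

Lemma poisson_itv_le s (a b : R) :
  0 <= \int[mu]_(t in `[a, b]) poisson (s - t) <= 2 * pi.
Proof.
have [ab|ba] := leP a b; last first.
  by rewrite set_itv_ge ?bnd_simp -?ltNge// Rintegral_set0 lexx mulr_ge0// pi_ge0.
apply/andP; split; first by apply: Rintegral_ge0 => t _; exact/ltW/poisson_gt0.
rewrite poisson_itv//.
have := atan_ltpi2 (e^-1 * b - e^-1 * s); have := atan_gtNpi2 (e^-1 * a - e^-1 * s).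
by move: (atan _) (atan _) => x y; lra.
Qed.

(** The bound on bounded intervals, read off from the arctangent primitive,
    passes to the line by Fatou's lemma. *)
Lemma poisson_mass s :
  integr (fun t => poisson (s - t)) /\ \int[mu]_t poisson (s - t) <= 2 * pi.
Proof.
apply: (@fatou_Rintegral _ (fun n => trunc n%:R (fun t => poisson (s - t)))).
- by move=> n; apply: integr_trunc_continuous; exact: continuous_poisson.
- by apply: continuous_measurable_fun; exact: continuous_poisson.
- by move=> n x; rewrite truncE; case: ifP => // _; exact/ltW/poisson_gt0.
- by move=> x; exact/ltW/poisson_gt0.
- by apply: aeW => x; exact: trunc_cvg.
- by move=> n; rewrite -Rintegral_trunc; case/andP: (poisson_itv_le s (- n%:R) n%:R).
Qed.

End weight_integral.

End ElementaryIntegrals.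

(** * Cosine and sine integrals and Fubini's theorem *)

Section Kernels.
Context {R : realType}.
Local Notation mu := (@lebesgue_measure R).
Implicit Types (f g a b : R -> R) (k : R -> R -> R).

Definition bounded_kernel (c : R) k : Prop :=
  measurable_fun [set: R * R] (fun p => k p.1 p.2) /\
  (forall x y, `|k x y| <= c).

Lemma bounded_kernel_measurable_r c k x : bounded_kernel c k ->
  measurable_fun setT (k x).
Proof.
move=> [mk _]; have := measurableT_comp mk (@measurable_pair1 _ _ R R x).
by [].
Qed.

Lemma bounded_kernel_measurable_l c k y : bounded_kernel c k ->
  measurable_fun setT (k ^~ y).
Proof.
move=> [mk _]; have := measurableT_comp mk (@measurable_pair2 _ _ R R y).
by [].
Qed.

Lemma integr_kernel c k b x : bounded_kernel c k -> integr b ->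
  integr (fun y => b y * k x y).
Proof.
move=> Hk Hb; apply: (@integr_bddM _ _ _ c) => //.
  exact: bounded_kernel_measurable_r Hk.
by case: Hk.
Qed.

Lemma kernel_integral_le c k b x : bounded_kernel c k -> integr b ->
  `|\int[mu]_y (b y * k x y)| <= c * \int[mu]_y `|b y|.
Proof.
move=> Hk Hb; apply: (le_trans (le_normr_Rintegral measurableT _)).
  exact: integr_kernel Hk Hb.
rewrite -RintegralZl//; last exact: integr_norm.
apply: le_Rintegral => //.
- exact/integr_norm/(integr_kernel _ Hk).
- exact/integrZ/integr_norm.
- by move=> y _; rewrite normrM mulrC ler_wpM2r//; case: Hk.
Qed.

Let kfun a b k (p : measurableTypeR R * measurableTypeR R) : \bar R :=
  (a p.1 * (b p.2 * k p.1 p.2))%:E.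

Let kfun_measurable c a b k : bounded_kernel c k -> integr a -> integr b ->
  measurable_fun setT (kfun a b k).
Proof.
move=> [mk _] /integr_measurable ma /integr_measurable mb.
apply/measurable_EFinP; apply: measurable_funM.
  by apply: measurableT_comp => //; exact: measurable_fst.
apply: measurable_funM => //.
by apply: measurableT_comp => //; exact: measurable_snd.
Qed.

Let kfun_integrable c a b k : bounded_kernel c k -> integr a -> integr b ->
  (mu \x mu)%E.-integrable setT (kfun a b k).
Proof.
move=> Hk Ha Hb; apply/integrable12ltyP; first exact: kfun_measurable Hk Ha Hb.
pose Ib := \int[mu]_y `|b y|.
apply: (@le_lt_trans _ _ (\int[mu]_x (`|a x| * (c * Ib))%:E)%E).
  apply: ge0_le_integral => //.
  - by move=> x _; apply: integral_ge0.
  - apply: (@measurable_fun_fubini_tonelli_F _ _ _ _ R mu (fun p => `|kfun a b k p|%E)).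
    + by apply: measurableT_comp => //; exact: kfun_measurable Hk Ha Hb.
    + by move=> p; exact: abse_ge0.
  - apply: measEFin; apply: measurable_funM => //.
    by apply: measurableT_comp => //; exact: integr_measurable.
  - move=> x _.
    have -> : (\int[mu]_y `|kfun a b k (x, y)| =
        \int[mu]_y (`|a x * (b y * k x y)|)%:E)%E by apply: eq_integral.
    rewrite integr_EFin; last exact/integr_norm/integrZ/(integr_kernel _ Hk).
    rewrite lee_fin /Ib -RintegralZl//; last exact: integr_norm.
    rewrite -RintegralZl//; last exact/integrZ/integr_norm.
    apply: le_Rintegral => //.
    + exact/integr_norm/integrZ/(integr_kernel _ Hk).
    + exact/integrZ/integrZ/integr_norm.
    + move=> y _; rewrite !normrM ler_wpM2l// mulrC ler_wpM2r//.
      by case: Hk.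
rewrite integr_EFin ?ltry//.
have /integr_norm/(integrZ (c * Ib)) := Ha.
by congr integr; apply/funext => x; rewrite mulrC.
Qed.

(** A bounded kernel keeps [a x * b y * k x y] integrable on the plane, so that
    the order of integration can be exchanged. *)
Lemma kernel_fubini c a b k : bounded_kernel c k -> integr a -> integr b ->
  \int[mu]_x (a x * \int[mu]_y (b y * k x y)) =
  \int[mu]_y (b y * \int[mu]_x (a x * k x y)).
Proof.
move=> Hk Ha Hb; rewrite /Rintegral; congr fine.
have := Fubini (kfun_integrable Hk Ha Hb); congr (_ = _).
- apply: eq_integral => x _; rewrite /fubini_F /kfun /=.
  rewrite integr_EFin; last exact/integrZ/(integr_kernel _ Hk).
  by rewrite RintegralZl//; exact: integr_kernel Hk _.
- apply: eq_integral => y _; rewrite /fubini_G /kfun /=.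
  have Iy : integr (fun x => a x * k x y).
    apply: (@integr_bddM _ _ _ c) => //.
      exact: bounded_kernel_measurable_l Hk.
    by case: Hk.
  have -> : (\int[mu]_x (a x * (b y * k x y))%:E =
      \int[mu]_x (b y * (a x * k x y))%:E)%E.
    by apply: eq_integral => x _; rewrite mulrCA.
  by rewrite integr_EFin ?RintegralZl//; exact: integrZ.
Qed.

(** Fubini's theorem makes [x |-> w x * \int b y * k x y] measurable for an
    integrable [w]; the nowhere vanishing [weight 1] can be divided out. *)
Lemma measurable_kernel_integral c b k : bounded_kernel c k -> integr b ->
  measurable_fun setT (fun x => \int[mu]_y (b y * k x y)).
Proof.
move=> Hk Hb.
have mf := measurable_fubini_F (kfun_integrable Hk (integr_weight (@ltr01 R)) Hb).
have mw : measurable_fun setT (fun x => weight 1 x * \int[mu]_y (b y * k x y)).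
  apply/measurable_EFinP; apply: eq_measurable_fun mf => x _.
  rewrite /fubini_F /kfun /= integr_EFin; last exact/integrZ/(integr_kernel _ Hk).
  by rewrite RintegralZl//; exact: integr_kernel Hk _.
rewrite (_ : (fun x => _) =
  (fun x => expR `|x| * (weight 1 x * \int[mu]_y (b y * k x y)))).
  apply: measurable_funM => //.
  apply: measurableT_comp => //; exact: measurable_expR.
apply/funext => x; rewrite mulrA /weight mul1r expRN divff ?mul1r//.
Qed.

End Kernels.

Section FourierIntegrals.
Context {R : realType}.
Local Notation mu := (@lebesgue_measure R).
Implicit Types (f g a b phi : R -> R).

(** The cosine and sine transforms ([phi = cos], [phi = sin]) are handled
    together; the complex transform is assembled from them. *)
Definition ktr phi a (x : R) : R := \int[mu]_t (a t * phi (x * t)).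

Definition bounded_continuous phi : Prop :=
  continuous phi /\ forall x, `|phi x| <= 1.

Lemma bounded_continuous_cos : bounded_continuous (@cos R).
Proof. by split; [exact: continuous_cos|exact: cos_max]. Qed.

Lemma bounded_continuous_sin : bounded_continuous (@sin R).
Proof. by split; [exact: continuous_sin|exact: sin_max]. Qed.

Lemma bounded_kernel_mul phi : bounded_continuous phi ->
  bounded_kernel 1 (fun x t => phi (x * t)).
Proof.
move=> [cphi bphi]; split => [|x y]; last exact: bphi.
apply: (@measurableT_comp _ _ _ _ _ _ phi).
  exact: continuous_measurable_fun.
by apply: measurable_funM; [exact: measurable_fst|exact: measurable_snd].
Qed.

Lemma measurable_ktr phi a : bounded_continuous phi -> integr a ->
  measurable_fun setT (ktr phi a).
Proof.
by move=> /bounded_kernel_mul Hk Ha; exact: measurable_kernel_integral Hk Ha.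
Qed.

Lemma ktr_le phi a x : bounded_continuous phi -> integr a ->
  `|ktr phi a x| <= \int[mu]_t `|a t|.
Proof.
move=> /bounded_kernel_mul Hk Ha.
by have := kernel_integral_le x Hk Ha; rewrite mul1r.
Qed.

Lemma integr_ktr phi a x : bounded_continuous phi -> integr a ->
  integr (fun t => a t * phi (x * t)).
Proof. by move=> /bounded_kernel_mul Hk Ha; exact: integr_kernel Hk Ha. Qed.

Lemma ktr_cosB a x s : integr a ->
  \int[mu]_t (a t * cos ((s - t) * x)) =
  cos (x * s) * ktr cos a x + sin (x * s) * ktr sin a x.
Proof.
move=> Ha; have Ic := integr_ktr x bounded_continuous_cos Ha.
have Is := integr_ktr x bounded_continuous_sin Ha.
rewrite -!RintegralZl// -RintegralD//; [|exact: integrZ..].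
by apply: eq_Rintegral => t _; rewrite mulrBl cosB ![x * _]mulrC; ring.
Qed.

Lemma ktr_sinB a x s : integr a ->
  \int[mu]_t (a t * sin ((s - t) * x)) =
  sin (x * s) * ktr cos a x - cos (x * s) * ktr sin a x.
Proof.
move=> Ha; have Ic := integr_ktr x bounded_continuous_cos Ha.
have Is := integr_ktr x bounded_continuous_sin Ha.
rewrite -!RintegralZl// -RintegralB//; [|exact: integrZ..].
by apply: eq_Rintegral => t _; rewrite mulrBl sinB ![x * _]mulrC; ring.
Qed.

(** Two applications of Fubini's theorem move the frequency integral inside;
    the weight makes everything absolutely convergent. *)
Lemma weighted_fubini (e : R) phi a b : 0 < e -> bounded_continuous phi ->
  integr a -> integr b ->
  measurable_fun [set: R * R] (fun p => \int[mu]_t (b t * phi ((p.2 - t) * p.1))) ->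
  \int[mu]_x (weight e x * \int[mu]_s (a s * \int[mu]_t (b t * phi ((s - t) * x)))) =
  \int[mu]_s (a s * \int[mu]_t (b t * \int[mu]_x (weight e x * phi ((s - t) * x)))).
Proof.
move=> e0 [cphi bphi] Ha Hb mD; have Iw := integr_weight e0.
have mphi : measurable_fun setT phi by exact: continuous_measurable_fun.
have Hs (s : R) : bounded_kernel 1 (fun x t => phi ((s - t) * x)).
  split => [|x t]; last exact: bphi.
  apply: (@measurableT_comp _ _ _ _ _ _ phi) => //.
  apply: measurable_funM; last exact: measurable_fst.
  by apply: measurable_funB; [exact: measurable_cst|exact: measurable_snd].
have HD : bounded_kernel (1 * \int[mu]_t `|b t|)
    (fun x s => \int[mu]_t (b t * phi ((s - t) * x))).
  by split => // x s; exact: (kernel_integral_le x (Hs s) Hb).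
rewrite (kernel_fubini HD Iw Ha); apply: eq_Rintegral => s _; congr (_ * _).
exact: (kernel_fubini (Hs s) Iw Hb).
Qed.

Let measurable_cos2 : measurable_fun [set: R * R] (fun p => cos (p.1 * p.2)).
Proof. by case: (bounded_kernel_mul bounded_continuous_cos). Qed.

Let measurable_sin2 : measurable_fun [set: R * R] (fun p => sin (p.1 * p.2)).
Proof. by case: (bounded_kernel_mul bounded_continuous_sin). Qed.

Let measurable_ktr_fst phi b : bounded_continuous phi -> integr b ->
  measurable_fun [set: R * R] (fun p => ktr phi b p.1).
Proof.
move=> Hphi Hb; apply: (@measurableT_comp _ _ _ _ _ _ (ktr phi b)).
  exact: measurable_ktr.
exact: measurable_fst.
Qed.

(** The addition formula turns the products of transforms into a double integral
    of [cos ((s - t) * x)], and integrating the weight in [x] produces the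
    Poisson kernel. *)
Lemma weighted_plancherel_cos (e : R) a b : 0 < e -> integr a -> integr b ->
  \int[mu]_x (weight e x * (ktr cos a x * ktr cos b x + ktr sin a x * ktr sin b x)) =
  \int[mu]_s (a s * \int[mu]_t (b t * poisson e (s - t))).
Proof.
move=> e0 Ha Hb.
have Hc := bounded_continuous_cos; have Hs := bounded_continuous_sin.
transitivity (\int[mu]_s (a s * \int[mu]_t (b t * \int[mu]_x
    (weight e x * cos ((s - t) * x)))) : R); last first.
  apply: eq_Rintegral => s _; congr (_ * _); apply: eq_Rintegral => t _.
  by rewrite weight_cosE.
rewrite -(weighted_fubini e0 Hc Ha Hb); last first.
  rewrite (_ : (fun p => _) = (fun p : R * R => cos (p.1 * p.2) * ktr cos b p.1 +
      sin (p.1 * p.2) * ktr sin b p.1)).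
    by apply: measurable_funD; apply: measurable_funM => //; exact: measurable_ktr_fst.
  by apply/funext => p; rewrite ktr_cosB.
apply: eq_Rintegral => x _; congr (_ * _).
have Ic := integr_ktr x Hc Ha; have Is := integr_ktr x Hs Ha.
under [RHS]eq_Rintegral do rewrite ktr_cosB//.
rewrite [ktr cos a x * _]mulrC [ktr sin a x * _]mulrC.
rewrite -!RintegralZl// -RintegralD//; [|exact: integrZ..].
by apply: eq_Rintegral => t _; ring.
Qed.

(** The same computation, with an odd function of [x] to integrate. *)
Lemma weighted_plancherel_sin (e : R) a b : 0 < e -> integr a -> integr b ->
  \int[mu]_x (weight e x * (ktr sin a x * ktr cos b x - ktr cos a x * ktr sin b x)) = 0.
Proof.
move=> e0 Ha Hb.
have Hc := bounded_continuous_cos; have Hs := bounded_continuous_sin.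
transitivity (\int[mu]_s (a s * \int[mu]_t (b t * \int[mu]_x
    (weight e x * sin ((s - t) * x)))) : R); last first.
  have E s : \int[mu]_t (b t * \int[mu]_x (weight e x * sin ((s - t) * x))) = 0.
    under eq_Rintegral do rewrite weight_sinE// mulr0.
    by rewrite Rintegral_cst// mul0r.
  under eq_Rintegral do rewrite E mulr0.
  by rewrite Rintegral_cst// mul0r.
rewrite -(weighted_fubini e0 Hs Ha Hb); last first.
  rewrite (_ : (fun p => _) = (fun p : R * R => sin (p.1 * p.2) * ktr cos b p.1 -
      cos (p.1 * p.2) * ktr sin b p.1)).
    by apply: measurable_funB; apply: measurable_funM => //; exact: measurable_ktr_fst.
  by apply/funext => p; rewrite ktr_sinB.
apply: eq_Rintegral => x _; congr (_ * _).
have Ic := integr_ktr x Hc Ha; have Is := integr_ktr x Hs Ha.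
under [RHS]eq_Rintegral do rewrite ktr_sinB//.
rewrite [ktr cos a x * _]mulrC [ktr sin a x * _]mulrC.
rewrite -!RintegralZl// -RintegralB//; [|exact: integrZ..].
by apply: eq_Rintegral => t _; ring.
Qed.

End FourierIntegrals.

(** * Plancherel and Parseval formulas *)

Section Plancherel.
Context {R : realType}.
Local Notation mu := (@lebesgue_measure R).
Implicit Types (f g a b phi : R -> R).

Definition supported (A : R) a : Prop := forall x, ~~ (- A <= x <= A) -> a x = 0.

Lemma supported_trunc A a : supported A a -> trunc A a = a.
Proof.
by move=> sa; apply/funext => x; rewrite truncE; case: ifPn => // /sa.
Qed.

Lemma trunc_supported A a : supported A (trunc A a).
Proof. by move=> x /negbTE; rewrite truncE => ->. Qed.

Lemma supported_integr A a : supported A a -> L2r a -> integr a.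
Proof. by move=> sa La; rewrite -(supported_trunc sa); exact: trunc_integr. Qed.

Lemma poissonN (e u : R) : poisson e (- u) = poisson e u.
Proof. by rewrite /poisson sqrrN. Qed.

Lemma poisson_le (e u : R) : 0 < e -> poisson e u <= 2 / e.
Proof.
move=> e0; rewrite /poisson.
have -> : 2 / e = 2 * e / e ^+ 2 by field; rewrite gt_eqF.
rewrite ler_wpM2l ?mulr_ge0 ?(ltW e0)// lef_pV2 ?posrE ?exprn_gt0//.
  by rewrite lerDl sqr_ge0.
by rewrite ltr_pwDl ?exprn_gt0// sqr_ge0.
Qed.

Lemma bounded_kernel_poisson (e : R) : 0 < e ->
  bounded_kernel (2 / e) (fun s t => poisson e (s - t)).
Proof.
move=> e0; split => [|x y].
  apply: (@measurableT_comp _ _ _ _ _ _ (poisson e)).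
    have /continuous_measurable_fun := @continuous_poisson R e e0 0.
    by under eq_fun do rewrite sub0r poissonN.
  by apply: measurable_funB; [exact: measurable_fst|exact: measurable_snd].
by rewrite ger0_norm ?poisson_le// ltW// poisson_gt0.
Qed.

(** Schur's test for the Poisson kernel, whose mass is at most [2 * pi]. *)
Lemma poisson_form_le (e A : R) a : 0 < e -> supported A a -> L2r a ->
  \int[mu]_s (a s * \int[mu]_t (a t * poisson e (s - t))) <= 2 * pi * nsq a.
Proof.
move=> e0 sa La; have Ia := supported_integr sa La; have [ma Ia2] := La.
have HP := bounded_kernel_poisson e0.
pose I : R -> R := \1_`[- A, A].
have II : integr I by exact: integrable_indic_itv.
have IE x : I x = if - A <= x <= A then 1 else 0.
  by rewrite /I indicE mem_setE in_itv; case: ifP.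
pose h s := \int[mu]_t (a t ^+ 2 * poisson e (s - t)).
have mh : measurable_fun setT h by exact: measurable_kernel_integral HP Ia2.
have hb s : `|h s| <= 2 / e * \int[mu]_t `|a t ^+ 2| by exact: kernel_integral_le HP Ia2.
have IIh : integr (fun s => I s * h s) by exact: integr_bddM II mh hb.
have -> : 2 * pi * nsq a = pi * nsq a + 2^-1 * (2 * pi * nsq a) by field.
(* Schur's test: [a s * a t] is at most [(a s ^ 2 + a t ^ 2) / 2]; the first
   half uses the mass of the kernel in [t], the second its mass in [s]. *)
apply: (@le_trans _ _ (\int[mu]_s (pi * a s ^+ 2 + 2^-1 * (I s * h s)))).
  apply: le_Rintegral => //.
  - apply: (integr_bddM Ia (measurable_kernel_integral HP Ia)) => s.
    exact: kernel_integral_le HP Ia.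
  - by apply: integrD; exact: integrZ.
  - move=> s _; rewrite IE; case: ifPn => [_|/sa ->]; last first.
      by rewrite !mul0r expr0n !mulr0 addr0.
    rewrite mul1r /h -!RintegralZl//; [|exact: integr_kernel HP _..].
    have [IP PM] := poisson_mass e0 s.
    apply: (@le_trans _ _ (\int[mu]_t (2^-1 * a s ^+ 2 * poisson e (s - t) +
        2^-1 * (a t ^+ 2 * poisson e (s - t))))).
      apply: le_Rintegral => //.
      + exact/integrZ/(integr_kernel _ HP).
      + by apply: integrD; apply: integrZ => //; exact: integr_kernel HP _.
      + move=> t _; rewrite mulrA -(mulrA 2^-1) -mulrDr -mulrDl mulrA.
        rewrite ler_wpM2r//; first exact/ltW/poisson_gt0.
        by have := sqr_ge0 (a s - a t); lra.
    rewrite RintegralD//; [|exact: integrZ|exact/integrZ/(integr_kernel _ HP)].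
    rewrite lerD2r RintegralZl//.
    have := sqr_ge0 (a s); nra.
rewrite RintegralD//; [|exact: integrZ..].
rewrite !RintegralZl// -/(nsq a) lerD2l ler_wpM2l// /h.
rewrite (kernel_fubini HP II Ia2) /nsq -RintegralZl//.
apply: le_Rintegral => //.
- apply: (integr_bddM Ia2 _ (c := 2 / e * \int[mu]_s `|I s|)).
    have HP' : bounded_kernel (2 / e) (fun t s : R => poisson e (s - t)).
      rewrite (_ : (fun t s => _) = (fun s t => poisson e (s - t)))//.
      by apply/funext => t; apply/funext => s; rewrite -poissonN opprB.
    exact: measurable_kernel_integral HP' II.
  move=> t; under eq_Rintegral do rewrite -poissonN opprB.
  exact: kernel_integral_le HP II.
- exact: integrZ.
- move=> t _; rewrite mulrC ler_wpM2r ?sqr_ge0//.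
  have /andP[_] := poisson_itv_le e0 t (- A) A.
  rewrite Rintegral_mkcond; apply: le_trans; rewrite le_eqVlt; apply/orP; left; apply/eqP.
  apply: eq_Rintegral => s _; rewrite IE patchE mem_setE in_itv/=.
  by case: ifP => _; rewrite ?mul0r// mul1r -poissonN opprB.
Qed.

Let eps (n : nat) : R := n.+1%:R^-1.

Let eps_gt0 n : 0 < eps n. Proof. by rewrite invr_gt0. Qed.

Lemma weight_cvg1 x : weight (eps n) x @[n --> \oo] --> (1 : R).
Proof.
have E : - (eps n * `|x|) @[n --> \oo] --> (0 : R).
  rewrite -(oppr0 R) -(mul0r `|x|); apply: cvgN; apply: cvgM; last exact: cvg_cst.
  exact: cvg_harmonic.
have := cvg_comp _ _ E (@continuous_expR R 0).
by rewrite expR0.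
Qed.

Lemma weighted_Rintegral_cvg f : integr f ->
  \int[mu]_x (weight (eps n) x * f x) @[n --> \oo] --> \int[mu]_x f x.
Proof.
move=> If; have mf := integr_measurable If.
apply: (@dominated_Rintegral _ _ _ (fun x => `|f x|) _ mf _ _ _).2.
- by move=> n; apply: measurable_funM => //; exact: measurable_weight.
- exact: integr_norm.
- move=> n x; rewrite normrM ler_piMl// ger0_norm ?(ltW (weight_gt0 _ _))//.
  exact/weight_le1/ltW.
- apply: aeW => x; rewrite -[X in _ --> X]mul1r; apply: cvgM; last exact: cvg_cst.
  exact: weight_cvg1.
Qed.

(** One half of Plancherel's theorem: the weights increase to 1 and the
    weighted norms stay below the Poisson form. *)
Lemma ktr_sum_bound A a : supported A a -> L2r a ->
  integr (fun x => ktr cos a x ^+ 2 + ktr sin a x ^+ 2) /\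
  \int[mu]_x (ktr cos a x ^+ 2 + ktr sin a x ^+ 2) <= 2 * pi * nsq a.
Proof.
move=> sa La; have Ia := supported_integr sa La.
have mc := measurable_ktr bounded_continuous_cos Ia.
have ms := measurable_ktr bounded_continuous_sin Ia.
have ms2 : measurable_fun setT (fun x => ktr cos a x ^+ 2 + ktr sin a x ^+ 2).
  by apply: measurable_funD; exact: measurable_funX.
apply: (@fatou_Rintegral _ (fun n x => weight (eps n) x *
    (ktr cos a x ^+ 2 + ktr sin a x ^+ 2))) => //.
- move=> n; apply: (integr_weightM (eps_gt0 n) (c := 2 * (\int[mu]_t `|a t|) ^+ 2)) => //.
  move=> x; rewrite ger0_norm ?addr_ge0 ?sqr_ge0// mulr_natl mulr2n.
  have sqr_bound phi : bounded_continuous phi ->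
      ktr phi a x ^+ 2 <= (\int[mu]_t `|a t|) ^+ 2.
    move=> Hphi; rewrite -[leLHS]real_normK ?num_real//.
    by apply: lerXn2r; rewrite ?nnegrE ?Rintegral_ge0//; exact: ktr_le.
  by apply: lerD; apply: sqr_bound;
    [exact: bounded_continuous_cos|exact: bounded_continuous_sin].
- by move=> n x; rewrite mulr_ge0 ?addr_ge0 ?sqr_ge0// ltW// weight_gt0.
- by move=> x; rewrite addr_ge0 ?sqr_ge0.
- apply: aeW => x; rewrite -[X in _ --> X]mul1r; apply: cvgM; last exact: cvg_cst.
  exact: weight_cvg1.
- move=> n; apply: le_trans (poisson_form_le (eps_gt0 n) sa La).
  by rewrite -weighted_plancherel_cos.
Qed.

Definition trig phi : Prop := phi = cos \/ phi = sin.

Lemma trig_bounded_continuous phi : trig phi -> bounded_continuous phi.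
Proof.
by case=> ->; [exact: bounded_continuous_cos|exact: bounded_continuous_sin].
Qed.

Lemma ktr_bound A phi a : trig phi -> supported A a -> L2r a ->
  L2r (ktr phi a) /\ nsq (ktr phi a) <= 2 * pi * nsq a.
Proof.
move=> tphi sa La; have [Is Ns] := ktr_sum_bound sa La.
have Ia := supported_integr sa La.
have mphi := measurable_ktr (trig_bounded_continuous tphi) Ia.
have le2 x : ktr phi a x ^+ 2 <= ktr cos a x ^+ 2 + ktr sin a x ^+ 2.
  by case: tphi => ->; rewrite ?lerDl ?lerDr sqr_ge0.
have I2 : integr (fun x => ktr phi a x ^+ 2).
  apply: integr_le Is _; first exact: measurable_funX.
  by move=> x; rewrite ger0_norm ?sqr_ge0.
by split => //; apply: le_trans Ns; apply: le_Rintegral.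
Qed.

Lemma indic_itv_L2r (c d : R) : L2r (\1_`[c, d] : R -> R).
Proof.
have I := @integrable_indic_itv R c d true false.
split; first exact: (integr_measurable I).
rewrite (_ : (fun x => _) = \1_`[c, d])//.
by apply/funext => x; rewrite indicE; case: (_ \in _); rewrite ?expr1n// expr0n.
Qed.

Lemma indic_itv_supported (c d : R) :
  supported (Num.max `|c| `|d|) (\1_`[c, d] : R -> R).
Proof.
move=> x xcd; rewrite indicE mem_setE in_itv/=; case: (boolP (_ <= _ <= _)) => //.
move=> /andP[cx xd]; move: xcd; rewrite -ler_norml.
have [x0|x0] := leP 0 x.
  by rewrite le_max (ger0_norm x0) (le_trans xd (ler_norm d)) orbT.
by rewrite le_max (ltr0_norm x0) -normrN (le_trans _ (ler_norm (- c))) ?lerN2.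
Qed.

(** The arctangent primitive saturates at [pi / 2] or [- pi / 2] on either side
    of [s]; at an end point of the interval the limit is [pi], half the mass. *)
Lemma poisson_itv_cvg (c d s : R) : c <= d -> s != c -> s != d ->
  \int[mu]_(t in `[c, d]) poisson (eps n) (s - t) @[n --> \oo] -->
  2 * pi * \1_`[c, d] s.
Proof.
move=> cd sc sd.
have E n : \int[mu]_(t in `[c, d]) poisson (eps n) (s - t) =
    2 * atan (n.+1%:R * (d - s)) - 2 * atan (n.+1%:R * (c - s)).
  by rewrite poisson_itv// /eps invrK -!(mulrBr n.+1%:R).
under eq_cvg do rewrite E.
have pos (u : R) : 0 < u -> atan (n.+1%:R * u) @[n --> \oo] --> pi / 2.
  move=> u0; have ey : n.+1%:R * u @[n --> \oo] --> +oo.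
    apply/cvgryPge => A; have /cvgryPge/(_ (A / u)) := @cvgr_idn R.
    apply: filterS => n; rewrite ler_pdivrMr// => /le_trans; apply.
    by rewrite ler_wpM2r ?(ltW u0)// ler_nat.
  by have := cvg_comp _ _ ey (@cvgy_atan R).
have neg (u : R) : u < 0 -> atan (n.+1%:R * u) @[n --> \oo] --> - (pi / 2).
  move=> u0; have := pos (- u); rewrite oppr_gt0 => /(_ u0) H.
  rewrite (_ : (fun n => _) = (fun n : nat => - atan (n.+1%:R * - u))).
    exact: cvgN.
  by apply/funext => n; rewrite mulrN atanN opprK.
have [s_c|s_c] := ltP s c.
  have s_d : s < d by rewrite (lt_le_trans s_c).
  have -> : 2 * @pi R * \1_`[c, d] s = 2 * (pi / 2) - 2 * (pi / 2).
    by rewrite indicE mem_setE in_itv /= (lt_geF s_c) /= mulr0 subrr.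
  by apply: cvgB; apply: cvgM; try exact: cvg_cst; apply: pos; rewrite subr_gt0.
have c_s : c < s by rewrite lt_neqAle eq_sym sc.
have [s_d|s_d] := leP s d.
  have -> : 2 * @pi R * \1_`[c, d] s = 2 * (pi / 2) - 2 * (- (pi / 2)).
    by rewrite indicE mem_setE in_itv /= s_c s_d /=; field.
  apply: cvgB; apply: cvgM; try exact: cvg_cst.
    by apply: pos; rewrite subr_gt0 lt_neqAle sd.
  by apply: neg; rewrite subr_lt0.
have -> : 2 * @pi R * \1_`[c, d] s = 2 * - (pi / 2) - 2 * - (pi / 2).
  by rewrite indicE mem_setE in_itv /= (lt_geF s_d) andbF /= mulr0 subrr.
by apply: cvgB; apply: cvgM; try exact: cvg_cst; apply: neg; rewrite subr_lt0.
Qed.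

(** The Poisson kernel is an approximate identity, so the weighted identity
    becomes Parseval's formula against the indicator of an interval. *)
Lemma parseval_itv_cos A a (c d : R) : c <= d -> supported A a -> L2r a ->
  \int[mu]_x (ktr cos a x * ktr cos (\1_`[c, d]) x +
              ktr sin a x * ktr sin (\1_`[c, d]) x) =
  2 * pi * \int[mu]_(x in `[c, d]) a x.
Proof.
move=> cd sa La; have Ia := supported_integr sa La.
set b : R -> R := \1_`[c, d].
have Lb : L2r b := indic_itv_L2r c d; have sb : supported _ b := @indic_itv_supported c d.
have Ib := supported_integr sb Lb.
have [Lca _] := ktr_bound (or_introl erefl) sa La.
have [Lsa _] := ktr_bound (or_intror erefl) sa La.
have [Lcb _] := ktr_bound (or_introl erefl) sb Lb.
have [Lsb _] := ktr_bound (or_intror erefl) sb Lb.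
set D := fun x => _.
have ID : integr D by apply: integrD; exact: L2r_mul.
have L := weighted_Rintegral_cvg ID.
pose Q n s := \int[mu]_(t in `[c, d]) poisson (eps n) (s - t).
have QE n s : \int[mu]_t (b t * poisson (eps n) (s - t)) = Q n s.
  rewrite /Q [RHS]Rintegral_mkcond; apply: eq_Rintegral => t _.
  by rewrite /b indicE patchE; case: (_ \in _); rewrite ?mul1r ?mul0r.
have mQ n : measurable_fun setT (Q n).
  have := measurable_kernel_integral (bounded_kernel_poisson (eps_gt0 n)) Ib.
  by congr measurable_fun; apply/funext => s; exact: QE.
have mb : measurable_fun setT b by case: Lb.
have ma : measurable_fun setT a by case: La.
have L' : \int[mu]_s (a s * Q n s) @[n --> \oo] --> \int[mu]_s (a s * (2 * pi * b s)).
  apply: (@dominated_Rintegral _ _ _ (fun x => 2 * pi * `|a x|) _ _ _ _ _).2.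
  - by move=> n; apply: measurable_funM.
  - by apply: measurable_funM => //; apply: measurable_funM.
  - exact/integrZ/integr_norm.
  - move=> n x; rewrite normrM mulrC ler_wpM2r//.
    by have /andP[Q0 Q1] := poisson_itv_le (eps_gt0 n) x c d; rewrite ger0_norm.
  - exists [set c; d]; split.
    + exact: measurableU.
    + apply/eqP; rewrite eq_le measure_ge0 andbT.
      apply: (@le_trans _ _ (mu [set c] + mu [set d])%E); first exact: measureU2.
      have m0 (x : R) : mu [set x] = 0%E by exact: lebesgue_measure_set1.
      by rewrite !m0 adde0.
    + move=> s /= Hs; apply: contrapT => /not_orP[/eqP sc /eqP sd]; apply: Hs.
      by apply: cvgM; [exact: cvg_cst|exact: poisson_itv_cvg].
have E n : \int[mu]_x (weight (eps n) x * D x) = \int[mu]_s (a s * Q n s).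
  rewrite (weighted_plancherel_cos (eps_gt0 n) Ia Ib).
  by apply: eq_Rintegral => s _; rewrite QE.
rewrite -(cvg_lim (@Rhausdorff R) L); under eq_fun do rewrite E.
rewrite (cvg_lim (@Rhausdorff R) L').
have -> : \int[mu]_s (a s * (2 * pi * b s)) = \int[mu]_s (2 * pi * (a \_ `[c, d]) s).
  apply: eq_Rintegral => s _; rewrite /b indicE patchE.
  by case: (_ \in _); rewrite ?mulr1 ?mulr0// mulrC.
by rewrite RintegralZl// -?Rintegral_mkcond//; exact: restrict_itv_integr.
Qed.

(** The mixed products integrate to 0 already with the weight. *)
Lemma parseval_itv_sin A a (c d : R) : supported A a -> L2r a ->
  \int[mu]_x (ktr sin a x * ktr cos (\1_`[c, d]) x -
              ktr cos a x * ktr sin (\1_`[c, d]) x) = 0.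
Proof.
move=> sa La; have Ia := supported_integr sa La.
set b : R -> R := \1_`[c, d].
have Lb : L2r b := indic_itv_L2r c d; have sb : supported _ b := @indic_itv_supported c d.
have Ib := supported_integr sb Lb.
have [Lca _] := ktr_bound (or_introl erefl) sa La.
have [Lsa _] := ktr_bound (or_intror erefl) sa La.
have [Lcb _] := ktr_bound (or_introl erefl) sb Lb.
have [Lsb _] := ktr_bound (or_intror erefl) sb Lb.
set D := fun x => _.
have ID : integr D by apply: integrB; exact: L2r_mul.
have L := weighted_Rintegral_cvg ID.
rewrite -(cvg_lim (@Rhausdorff R) L); apply: (cvg_lim (@Rhausdorff R)).
under eq_cvg do rewrite (weighted_plancherel_sin (eps_gt0 _) Ia Ib).
exact: cvg_cst.
Qed.

End Plancherel.

(** * Cosine and sine transforms on L^2 and their inversion *)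

Section TrigTransformL2.
Context {R : realType}.
Local Notation mu := (@lebesgue_measure R).
Implicit Types (f g h a b phi : R -> R).

Lemma nsq_cvg_pairing (T : Type) (F : set_system T) {FF : Filter F}
    (fn : T -> R -> R) f g :
  (forall n, L2r (fn n)) -> L2r f -> L2r g ->
  nsq (fun x => fn n x - f x) @[n --> F] --> (0 : R) ->
  \int[mu]_x (fn n x * g x) @[n --> F] --> \int[mu]_x (f x * g x).
Proof.
move=> Lfn Lf Lg H.
have H0 := nsq_cvg0_pairing (fun n => L2rB (Lfn n) Lf) Lg H.
have E n : \int[mu]_x ((fn n x - f x) * g x) =
    \int[mu]_x (fn n x * g x) - \int[mu]_x (f x * g x).
  rewrite -RintegralB//; [|exact: L2r_mul..].
  by apply: eq_Rintegral => x _; rewrite mulrBl.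
rewrite (_ : (fun n => _) =
    (fun n => \int[mu]_x ((fn n x - f x) * g x) + \int[mu]_x (f x * g x))).
  by have := cvgD (H0 FF) (cvg_cst (\int[mu]_x (f x * g x))); rewrite add0r => /(_ FF FF).
by apply/funext => n; rewrite E subrK.
Qed.

Lemma Rintegral_itv_indic (c d : R) f :
  \int[mu]_(x in `[c, d]) f x = \int[mu]_x (f x * \1_`[c, d] x).
Proof.
rewrite Rintegral_mkcond; apply: eq_Rintegral => x _.
by rewrite patchE indicE; case: (_ \in _); rewrite ?mulr1 ?mulr0.
Qed.

Lemma ktrB phi a b x : bounded_continuous phi -> integr a -> integr b ->
  ktr phi a x - ktr phi b x = ktr phi (fun t => a t - b t) x.
Proof.
move=> Hphi Ha Hb; rewrite /ktr -RintegralB//; [|exact: integr_ktr..].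
by apply: eq_Rintegral => t _; rewrite mulrBl.
Qed.

(** On L^2 the transform is a relation: the integral may diverge, and the limit
    of the truncated integrals is only defined almost everywhere. *)
Definition is_ktr phi a h : Prop :=
  L2r h /\
  nsq (fun x => ktr phi (trunc A a) x - h x) @[A --> +oo] --> (0 : R).

Let tail A a : R := nsq (fun x => a x - trunc A a x).

Lemma ktr_trunc_L2r phi a A : trig phi -> L2r a -> L2r (ktr phi (trunc A a)).
Proof.
by move=> tphi La; case: (ktr_bound tphi (@trunc_supported R A a) (trunc_L2r A La)).
Qed.

Lemma ktr_trunc_bound phi a A : trig phi -> L2r a ->
  nsq (ktr phi (trunc A a)) <= 2 * pi * nsq a.
Proof.
move=> tphi La.
have [_] := ktr_bound tphi (@trunc_supported R A a) (trunc_L2r A La).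
move/le_trans; apply; rewrite ler_wpM2l ?mulr_ge0 ?pi_ge0//.
exact: nsq_trunc_le.
Qed.

Lemma ktr_trunc_cauchy phi a (A B : R) : trig phi -> L2r a -> A <= B ->
  nsq (fun x => ktr phi (trunc B a) x - ktr phi (trunc A a) x) <=
  2 * pi * tail A a.
Proof.
move=> tphi La AB.
have Hphi := trig_bounded_continuous tphi.
have LB := L2rB (trunc_L2r B La) (trunc_L2r A La).
have sB : supported B (fun t => trunc B a t - trunc A a t).
  move=> x xB; rewrite !truncE (negbTE xB) ifF ?subrr//.
  apply: contraNF xB => /andP[Ax xA].
  by rewrite (le_trans _ Ax) ?lerN2// (le_trans xA).
have [_ le2] := ktr_bound tphi sB LB.
apply: le_trans (ler_wpM2l _ (nsq_trunc_tail AB La)); last first.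
  by rewrite mulr_ge0 ?pi_ge0.
apply: le_trans le2; rewrite le_eqVlt; apply/orP; left; apply/eqP.
by apply: eq_Rintegral => x _; rewrite ktrB//; exact: trunc_integr.
Qed.

Lemma tail_le (A B : R) a : A <= B -> L2r a -> tail B a <= tail A a.
Proof.
move=> AB La; rewrite -[leRHS]mul1r -(expr1n R 2); apply: nsq_le.
- by case: (L2rB La (trunc_L2r B La)).
- by apply: L2rB => //; exact: trunc_L2r.
- move=> x; rewrite mul1r !truncE; case: ifPn => [_|xB].
    by rewrite subrr normr0.
  rewrite ifF//; apply: contraNF xB => /andP[Ax xA].
  by rewrite (le_trans _ Ax) ?lerN2// (le_trans xA).
Qed.

Lemma ktr_trunc_linear phi (a b : R) f g A x : bounded_continuous phi ->
  L2r f -> L2r g ->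
  ktr phi (trunc A (fun t => a * f t + b * g t)) x =
  a * ktr phi (trunc A f) x + b * ktr phi (trunc A g) x.
Proof.
move=> Hphi Lf Lg; have I1 := integr_ktr x Hphi (trunc_integr A Lf).
have I2 := integr_ktr x Hphi (trunc_integr A Lg).
rewrite /ktr -!RintegralZl// -RintegralD//; [|exact: integrZ..].
apply: eq_Rintegral => t _; rewrite !truncE; case: ifP => _; first by ring.
by rewrite !mul0r !mulr0 addr0.
Qed.

(** The truncated transforms form a Cauchy family, since [ktr_bound] controls
    their differences by the tail of [a]. *)
Lemma is_ktr_exists phi a : trig phi -> L2r a -> exists h, is_ktr phi a h.
Proof.
move=> tphi La; pose F n := ktr phi (trunc n%:R a).
have LF n : L2r (F n) by exact: ktr_trunc_L2r.
have tail0 : 2 * pi * tail n%:R a @[n --> \oo] --> (0 : R).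
  rewrite -(mulr0 (2 * pi)); apply: cvgM; first exact: cvg_cst.
  by have := cvg_comp _ _ (@cvgr_idn R) (nsq_trunc_cvg La).
have cF n m : (n <= m)%N -> nsq (fun x => F m x - F n x) <= 2 * pi * tail n%:R a.
  by move=> nm; apply: ktr_trunc_cauchy => //; rewrite ler_nat.
have [h Lh hF] := L2r_complete LF cF tail0.
exists h; split => //.
have bnd A : nsq (fun x => ktr phi (trunc A a) x - h x) <= 8 * pi * tail A a.
  pose n := Num.bound `|A|.
  have An : A <= n%:R.
    by rewrite (le_trans (ler_norm A))// ltW// archi_boundP.
  rewrite (_ : (fun x => _) = (fun x => (F n x - h x) -
      (F n x - ktr phi (trunc A a) x))); last by apply/funext => x; ring.
  apply: le_trans (nsqB_le (L2rB (LF n) Lh) (L2rB (LF n) (ktr_trunc_L2r A tphi La))) _.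
  rewrite (nsqBC (F n) h).
  have h1 : nsq (fun x => h x - F n x) <= 2 * pi * tail n%:R a := hF n.
  have h2 : nsq (fun x => F n x - ktr phi (trunc A a) x) <= 2 * pi * tail A a :=
    ktr_trunc_cauchy tphi La An.
  have h3 : 2 * pi * tail n%:R a <= 2 * pi * tail A a.
    by rewrite ler_wpM2l ?mulr_ge0 ?pi_ge0// tail_le.
  have -> : 8 * pi * tail A a = 2 * (2 * pi * tail A a) + 2 * (2 * pi * tail A a).
    by ring.
  exact: (lerD (ler_wpM2l (ler0n R 2) (le_trans h1 h3)) (ler_wpM2l (ler0n R 2) h2)).
apply: (@squeeze_cvgr _ _ _ _ (fun=> 0) (fun A => 8 * pi * tail A a)).
- by apply: nearW => A; rewrite nsq_ge0 bnd.
- exact: cvg_cst.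
- rewrite -(mulr0 (8 * pi)); apply: cvgM; first exact: cvg_cst.
  exact: nsq_trunc_cvg.
Qed.

Lemma is_ktr_linear phi (a b : R) (f1 f2 h1 h2 : R -> R) : trig phi ->
  L2r f1 -> L2r f2 -> is_ktr phi f1 h1 -> is_ktr phi f2 h2 ->
  is_ktr phi (fun t => a * f1 t + b * f2 t) (fun x => a * h1 x + b * h2 x).
Proof.
move=> tphi L1 L2' [Lh1 K1] [Lh2 K2]; have Hphi := trig_bounded_continuous tphi.
split; first by apply: L2rD; exact: L2rZ.
have E A x : ktr phi (trunc A (fun t => a * f1 t + b * f2 t)) x =
    a * ktr phi (trunc A f1) x + b * ktr phi (trunc A f2) x.
  exact: ktr_trunc_linear.
have L0 : 2 * (a ^+ 2 * nsq (fun x => ktr phi (trunc A f1) x - h1 x)) +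
    2 * (b ^+ 2 * nsq (fun x => ktr phi (trunc A f2) x - h2 x))
    @[A --> +oo] --> (0 : R).
  rewrite [X in _ --> X](_ : 0 = 2 * (a ^+ 2 * 0) + 2 * (b ^+ 2 * 0)); last by ring.
  by apply: cvgD; apply: cvgM; [exact: cvg_cst| |exact: cvg_cst|];
    apply: cvgM => //; exact: cvg_cst.
apply: (@squeeze_cvgr _ _ _ _ (fun=> 0) _ _ _ _ _ L0); last exact: cvg_cst.
apply: nearW => A; rewrite nsq_ge0 /=.
have LB1 := L2rB (ktr_trunc_L2r A tphi L1) Lh1.
have LB2 := L2rB (ktr_trunc_L2r A tphi L2') Lh2.
rewrite (_ : (fun x => _) = (fun x => a * (ktr phi (trunc A f1) x - h1 x) +
    b * (ktr phi (trunc A f2) x - h2 x))); last by apply/funext => x; rewrite E; ring.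
by rewrite -!nsqZ//; apply: nsqD_le; exact: L2rZ.
Qed.

Lemma is_ktr_bound phi a h : trig phi -> L2r a -> is_ktr phi a h ->
  nsq h <= 4 * pi * nsq a.
Proof.
move=> tphi La [Lh Hh].
have L0 : 2 * (2 * pi * nsq a) + 2 * nsq (fun x => ktr phi (trunc A a) x - h x)
    @[A --> +oo] --> 4 * pi * nsq a.
  rewrite (_ : 4 * pi * nsq a = 2 * (2 * pi * nsq a) + 2 * 0); last by ring.
  apply: cvgD; first exact: cvg_cst.
  by apply: cvgM => //; exact: cvg_cst.
apply: (cvgr_to_ge L0); apply: nearW => A.
have LA := ktr_trunc_L2r A tphi La.
have := nsqB_le LA (L2rB LA Lh).
rewrite (_ : (fun x => ktr phi (trunc A a) x - (ktr phi (trunc A a) x - h x)) = h).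
  move/le_trans; apply; rewrite lerD2r ler_wpM2l//.
  exact: ktr_trunc_bound.
by apply/funext => x; ring.
Qed.

Let nsq_trunc_cvg' a : L2r a ->
  nsq (fun x => trunc A a x - a x) @[A --> +oo] --> (0 : R).
Proof. by move=> La; under eq_cvg do rewrite nsqBC; exact: nsq_trunc_cvg. Qed.

(** The transforms are symmetric for the L^2 pairing, by Fubini's theorem on
    truncations. *)
Lemma is_ktr_adjoint phi a h (c d : R) : trig phi -> L2r a -> is_ktr phi a h ->
  \int[mu]_(x in `[c, d]) h x = \int[mu]_t (a t * ktr phi (\1_`[c, d]) t).
Proof.
move=> tphi La [Lh Hh]; have Hphi := trig_bounded_continuous tphi.
set b : R -> R := \1_`[c, d].
have Lb : L2r b := indic_itv_L2r c d.
have sb : supported _ b := @indic_itv_supported R c d.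
have Ib := supported_integr sb Lb.
have [Lkb _] := ktr_bound tphi sb Lb.
have LA A := ktr_trunc_L2r A tphi La.
have C1 : \int[mu]_x (ktr phi (trunc A a) x * b x) @[A --> +oo] -->
    \int[mu]_x (h x * b x) by exact: nsq_cvg_pairing.
have C2 : \int[mu]_x (trunc A a x * ktr phi b x) @[A --> +oo] -->
    \int[mu]_x (a x * ktr phi b x).
  by apply: nsq_cvg_pairing => // [A|]; [exact: trunc_L2r|exact: nsq_trunc_cvg'].
have E A : \int[mu]_x (ktr phi (trunc A a) x * b x) =
    \int[mu]_x (trunc A a x * ktr phi b x).
  have IA := trunc_integr A La.
  transitivity (\int[mu]_x (b x * \int[mu]_t (trunc A a t * phi (x * t)))).
    by apply: eq_Rintegral => x _; rewrite mulrC.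
  rewrite (kernel_fubini (bounded_kernel_mul Hphi) Ib IA).
  apply: eq_Rintegral => t _; congr (_ * _).
  by apply: eq_Rintegral => x _; rewrite (mulrC x).
rewrite Rintegral_itv_indic -(cvg_lim (@Rhausdorff R) C1).
by under eq_fun do rewrite E; exact: (cvg_lim (@Rhausdorff R) C2).
Qed.

(** Parseval's formula passes to the limit of the truncations of [a]. *)
Lemma is_ktr_parseval_cos a hc hs (c d : R) : c <= d -> L2r a ->
  is_ktr cos a hc -> is_ktr sin a hs ->
  \int[mu]_x (hc x * ktr cos (\1_`[c, d]) x) +
  \int[mu]_x (hs x * ktr sin (\1_`[c, d]) x) = 2 * pi * \int[mu]_(x in `[c, d]) a x.
Proof.
move=> cd La [Lhc Hc] [Lhs Hs].
set b : R -> R := \1_`[c, d].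
have Lb : L2r b := indic_itv_L2r c d.
have sb : supported _ b := @indic_itv_supported R c d.
have [Lcb _] := ktr_bound (or_introl erefl) sb Lb.
have [Lsb _] := ktr_bound (or_intror erefl) sb Lb.
have Lc A := ktr_trunc_L2r A (or_introl erefl : trig cos) La.
have Ls A := ktr_trunc_L2r A (or_intror erefl : trig sin) La.
pose D A := \int[mu]_x (ktr cos (trunc A a) x * ktr cos b x) +
  \int[mu]_x (ktr sin (trunc A a) x * ktr sin b x).
have C1 : D A @[A --> +oo] -->
    \int[mu]_x (hc x * ktr cos b x) + \int[mu]_x (hs x * ktr sin b x).
  by apply: cvgD; exact: nsq_cvg_pairing.
have DE A : D A = 2 * pi * \int[mu]_x (trunc A a x * b x).
  rewrite /D -RintegralD//; [|exact: L2r_mul..].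
  by rewrite (parseval_itv_cos cd (@trunc_supported R A a) (trunc_L2r A La))
    Rintegral_itv_indic.
have C2 : D A @[A --> +oo] --> 2 * pi * \int[mu]_x (a x * b x).
  under eq_cvg do rewrite DE.
  apply: cvgM; first exact: cvg_cst.
  by apply: nsq_cvg_pairing => // [A|]; [exact: trunc_L2r|exact: nsq_trunc_cvg'].
by rewrite Rintegral_itv_indic -(cvg_lim (@Rhausdorff R) C1) (cvg_lim (@Rhausdorff R) C2).
Qed.

Lemma is_ktr_parseval_sin a hc hs (c d : R) : L2r a ->
  is_ktr cos a hc -> is_ktr sin a hs ->
  \int[mu]_x (hs x * ktr cos (\1_`[c, d]) x) -
  \int[mu]_x (hc x * ktr sin (\1_`[c, d]) x) = 0.
Proof.
move=> La [Lhc Hc] [Lhs Hs].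
set b : R -> R := \1_`[c, d].
have Lb : L2r b := indic_itv_L2r c d.
have sb : supported _ b := @indic_itv_supported R c d.
have [Lcb _] := ktr_bound (or_introl erefl) sb Lb.
have [Lsb _] := ktr_bound (or_intror erefl) sb Lb.
have Lc A := ktr_trunc_L2r A (or_introl erefl : trig cos) La.
have Ls A := ktr_trunc_L2r A (or_intror erefl : trig sin) La.
pose D A := \int[mu]_x (ktr sin (trunc A a) x * ktr cos b x) -
  \int[mu]_x (ktr cos (trunc A a) x * ktr sin b x).
have C1 : D A @[A --> +oo] -->
    \int[mu]_x (hs x * ktr cos b x) - \int[mu]_x (hc x * ktr sin b x).
  by apply: cvgB; exact: nsq_cvg_pairing.
have DE A : D A = 0.
  rewrite /D -RintegralB//; [|exact: L2r_mul..].
  exact: (parseval_itv_sin c d (@trunc_supported R A a) (trunc_L2r A La)).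
rewrite -(cvg_lim (@Rhausdorff R) C1); apply: (cvg_lim (@Rhausdorff R)).
by under eq_cvg do rewrite DE; exact: cvg_cst.
Qed.

(** Inversion formula [C C + S S = 2 pi]. Both sides have the same integral over
    every interval: the adjoint identity moves the outer transforms to the
    indicator of the interval, and Parseval's formula removes the inner ones. *)
Lemma is_ktr_inversion_cos a hc hs hcc hss : L2r a ->
  is_ktr cos a hc -> is_ktr sin a hs -> is_ktr cos hc hcc -> is_ktr sin hs hss ->
  {ae mu, forall x, hcc x + hss x = 2 * pi * a x}.
Proof.
move=> La Hc Hs Hcc Hss.
have [[Lhc _] [Lhs _]] := (Hc, Hs); have [[Lhcc _] [Lhss _]] := (Hcc, Hss).
have L : L2r (fun x => hcc x + hss x - 2 * pi * a x).
  by apply: L2rB; [exact: L2rD|exact: L2rZ].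
suff : {ae mu, forall x, hcc x + hss x - 2 * pi * a x = 0}.
  by apply: filterS => x /eqP; rewrite subr_eq0 => /eqP.
apply: itv_integral_eq0_ae => // c d.
have [cd|dc] := leP c d; last by rewrite set_itv_ge ?bnd_simp -?ltNge// Rintegral_set0.
have Lb := indic_itv_L2r c d.
rewrite Rintegral_itv_indic.
transitivity (\int[mu]_x (hcc x * \1_`[c, d] x) + \int[mu]_x (hss x * \1_`[c, d] x) -
    2 * pi * \int[mu]_x (a x * \1_`[c, d] x)).
  rewrite -RintegralZl//; last exact: L2r_mul.
  rewrite -RintegralD//; [|exact: L2r_mul..].
  rewrite -RintegralB//; [|by apply: integrD; exact: L2r_mul|exact/integrZ/L2r_mul].
  by apply: eq_Rintegral => x _; ring.
rewrite -!Rintegral_itv_indic (is_ktr_adjoint c d (or_introl erefl) Lhc Hcc).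
rewrite (is_ktr_adjoint c d (or_intror erefl) Lhs Hss).
by rewrite (is_ktr_parseval_cos cd La Hc Hs) subrr.
Qed.

(** Companion formula [C S = S C], by the same argument. *)
Lemma is_ktr_inversion_sin a hc hs hcs hsc : L2r a ->
  is_ktr cos a hc -> is_ktr sin a hs -> is_ktr cos hs hcs -> is_ktr sin hc hsc ->
  {ae mu, forall x, hcs x = hsc x}.
Proof.
move=> La Hc Hs Hcs Hsc.
have [[Lhc _] [Lhs _]] := (Hc, Hs); have [[Lhcs _] [Lhsc _]] := (Hcs, Hsc).
suff : {ae mu, forall x, hcs x - hsc x = 0}.
  by apply: filterS => x /eqP; rewrite subr_eq0 => /eqP.
apply: itv_integral_eq0_ae => [|c d]; first exact: L2rB.
have Lb := indic_itv_L2r c d.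
rewrite Rintegral_itv_indic.
transitivity (\int[mu]_x (hcs x * \1_`[c, d] x) - \int[mu]_x (hsc x * \1_`[c, d] x)).
  rewrite -RintegralB//; [|exact: L2r_mul..].
  by apply: eq_Rintegral => x _; ring.
rewrite -!Rintegral_itv_indic (is_ktr_adjoint c d (or_introl erefl) Lhs Hcs).
rewrite (is_ktr_adjoint c d (or_intror erefl) Lhc Hsc).
exact: (is_ktr_parseval_sin c d La Hc Hs).
Qed.

End TrigTransformL2.

(** * Square integrable complex functions *)

Local Open Scope complex_scope.

Section ComplexL2.
Context {R : realType}.
Local Notation mu := (@lebesgue_measure R).
Local Notation Re := (@complex.Re R).
Local Notation Im := (@complex.Im R).
Implicit Types (g h G H : R -> R[i]) (z w c : R[i]).

Lemma cmodE z : cmod z = Num.sqrt (Re z ^+ 2 + Im z ^+ 2).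
Proof. by case: z. Qed.

Lemma cmod_ge0 z : 0 <= cmod z.
Proof. by rewrite cmodE sqrtr_ge0. Qed.

Lemma cmod_sq z : cmod z ^+ 2 = Re z ^+ 2 + Im z ^+ 2.
Proof. by rewrite cmodE sqr_sqrtr// addr_ge0// sqr_ge0. Qed.

Lemma cReD z w : Re (z + w) = Re z + Re w. Proof. by case: z w => [? ?] []. Qed.
Lemma cImD z w : Im (z + w) = Im z + Im w. Proof. by case: z w => [? ?] []. Qed.
Lemma cReN z : Re (- z) = - Re z. Proof. by case: z. Qed.
Lemma cImN z : Im (- z) = - Im z. Proof. by case: z. Qed.
Lemma cReB z w : Re (z - w) = Re z - Re w. Proof. by rewrite cReD cReN. Qed.
Lemma cImB z w : Im (z - w) = Im z - Im w. Proof. by rewrite cImD cImN. Qed.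
Lemma cReM z w : Re (z * w) = Re z * Re w - Im z * Im w.
Proof. by case: z w => [? ?] []. Qed.
Lemma cImM z w : Im (z * w) = Re z * Im w + Im z * Re w.
Proof. by case: z w => [? ?] []. Qed.

Lemma complex_eq z w : Re z = Re w -> Im z = Im w -> z = w.
Proof. by case: z w => [? ?] [? ?] /= -> ->. Qed.

Lemma cmodM z w : cmod (z * w) = cmod z * cmod w.
Proof. exact: Normc.normcM. Qed.

Lemma cmodV z : cmod z^-1 = (cmod z)^-1.
Proof. exact: Normc.normcV. Qed.

Lemma cmod_real (r : R) : cmod r%:C = `|r|.
Proof. by rewrite cmodE /= expr0n addr0 sqrtr_sqr. Qed.

Lemma ler_Re_cmod z : Re z <= cmod z.
Proof.
rewrite (le_trans (ler_norm _))// -sqrtr_sqr cmodE ler_sqrt ?addr_ge0 ?sqr_ge0//.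
by rewrite lerDl sqr_ge0.
Qed.

Lemma cmod_expi (t : R) : cmod (expi t) = 1.
Proof. by rewrite cmodE /= cos2Dsin2 sqrtr1. Qed.

Lemma cmod_cexp z : cmod (cexp z) = expR (Re z).
Proof. by rewrite /cexp cmodM cmod_real cmod_expi mulr1 ger0_norm ?expR_ge0. Qed.

Lemma cmod_eq0 z : (cmod z == 0) = (z == 0).
Proof.
apply/eqP/eqP => [/Normc.eq0_normc//|->].
by rewrite cmodE /= expr0n addr0 sqrtr0.
Qed.

Lemma ler_cmodD z c : cmod (z + c) <= cmod z + cmod c.
Proof.
have := ler_normD z c.
by rewrite !normc_def -!cmodE -[X in _ <= X]rmorphD lecR.
Qed.

Lemma ler_cmodB z c : cmod (z - c) <= cmod z + cmod c.
Proof.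
apply: le_trans (ler_cmodD _ _) _.
by rewrite lerD2l (cmodE (- c)) cReN cImN !sqrrN -cmodE.
Qed.

Definition L2c g : Prop := L2r (Re \o g) /\ L2r (Im \o g).

Definition csq g : R := nsq (Re \o g) + nsq (Im \o g).

Lemma csq_ge0 g : 0 <= csq g. Proof. by rewrite addr_ge0 ?nsq_ge0. Qed.

Lemma L2norm_integral g :
  L2norm g = ((\int[mu]_t (Re (g t) ^+ 2 + Im (g t) ^+ 2)%:E) `^ 2^-1)%E.
Proof.
rewrite /L2norm unlock; congr (_ `^ _)%E; apply: eq_integral => t _.
by rewrite /= ger0_norm ?cmod_ge0// powR_mulrn ?cmod_ge0// cmod_sq.
Qed.

Lemma L2normE g : L2c g -> L2norm g = (Num.sqrt (csq g))%:E.
Proof.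
move=> [[mr Ir] [mi Ii]]; rewrite L2norm_integral integr_EFin; last exact: integrD.
by rewrite poweR_EFin powR12_sqrt RintegralD// ?csq_ge0.
Qed.

Lemma csqE g : L2c g -> csq g = \int[mu]_t (Re (g t) ^+ 2 + Im (g t) ^+ 2).
Proof. by move=> [[_ Ir] [_ Ii]]; rewrite /csq /nsq -RintegralD. Qed.

(** Passage from the norm in the extended reals to components, where the real
    theory applies. *)
Lemma L2P g : L2 g <-> L2c g.
Proof.
split=> [[mr mi fin]|Lg]; last first.
  by split; [case: Lg => -[]|case: Lg => _ []|rewrite L2normE// ltry].
have I : integr (fun t => Re (g t) ^+ 2 + Im (g t) ^+ 2).
  apply: integr_ge0P.
  - by apply: measurable_funD; exact: measurable_funX.
  - by move=> t; rewrite addr_ge0 ?sqr_ge0.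
  - by move: fin; rewrite L2norm_integral; apply: lty_poweRy; rewrite invr_eq0.
split; split => //.
  apply: integr_le I _ => [|t]; first exact: measurable_funX.
  by rewrite ger0_norm ?sqr_ge0// lerDl sqr_ge0.
apply: integr_le I _ => [|t]; first exact: measurable_funX.
by rewrite ger0_norm ?sqr_ge0// lerDr sqr_ge0.
Qed.

Lemma L2cD g h : L2c g -> L2c h -> L2c (fun t => g t + h t).
Proof.
move=> [gr gi] [hr hi]; split.
  have := L2rD gr hr; congr L2r; apply/funext => t; exact/esym/cReD.
have := L2rD gi hi; congr L2r; apply/funext => t; exact/esym/cImD.
Qed.

Lemma L2cZ z g : L2c g -> L2c (fun t => z * g t).
Proof.
move=> [gr gi]; split.
  have := L2rB (L2rZ (Re z) gr) (L2rZ (Im z) gi).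
  by congr L2r; apply/funext => t; exact/esym/cReM.
have := L2rD (L2rZ (Re z) gi) (L2rZ (Im z) gr).
by congr L2r; apply/funext => t; exact/esym/cImM.
Qed.

Lemma L2cB g h : L2c g -> L2c h -> L2c (fun t => g t - h t).
Proof.
move=> Lg Lh; have := L2cD Lg (L2cZ (-1) Lh).
by congr L2c; apply/funext => t; rewrite mulN1r.
Qed.

Lemma csqD_le g h : L2c g -> L2c h ->
  csq (fun t => g t + h t) <= 2 * csq g + 2 * csq h.
Proof.
move=> [gr gi] [hr hi]; have := nsqD_le gr hr; have := nsqD_le gi hi.
rewrite /csq (_ : Re \o (fun t => g t + h t) = fun t => (Re \o g) t + (Re \o h) t).
  rewrite (_ : Im \o (fun t => g t + h t) = fun t => (Im \o g) t + (Im \o h) t).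
    lra.
  by apply/funext => t /=; rewrite cImD.
by apply/funext => t /=; rewrite cReD.
Qed.

Lemma csqN g : csq (fun t => - g t) = csq g.
Proof.
rewrite /csq; congr (_ + _).
  rewrite -[RHS]nsqN; congr nsq; apply/funext => t; exact: cReN.
rewrite -[RHS]nsqN; congr nsq; apply/funext => t; exact: cImN.
Qed.

Lemma csqB_le g h : L2c g -> L2c h ->
  csq (fun t => g t - h t) <= 2 * csq g + 2 * csq h.
Proof.
move=> Lg Lh; rewrite -(csqN h); apply: csqD_le => //.
have := L2cZ (-1) Lh; congr L2c; apply/funext => t; exact: mulN1r.
Qed.

Lemma csqBC g h : csq (fun t => g t - h t) = csq (fun t => h t - g t).
Proof. by rewrite -csqN; congr csq; apply/funext => t; rewrite opprB. Qed.

Lemma csq_le_cmod (c : R) g h : 0 <= c ->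
  measurable_fun setT (Re \o g) -> measurable_fun setT (Im \o g) -> L2c h ->
  (forall t, cmod (g t) <= c * cmod (h t)) ->
  L2c g /\ csq g <= c ^+ 2 * csq h.
Proof.
move=> c0 mr mi [[mhr Ihr] [mhi Ihi]] gh.
have gh2 t : Re (g t) ^+ 2 + Im (g t) ^+ 2 <=
    c ^+ 2 * (Re (h t) ^+ 2 + Im (h t) ^+ 2).
  rewrite -!cmod_sq -exprMn lerXn2r ?nnegrE ?cmod_ge0//.
  by rewrite mulr_ge0// cmod_ge0.
have I2 : integr (fun t => c ^+ 2 * (Re (h t) ^+ 2 + Im (h t) ^+ 2)).
  by apply: integrZ; exact: integrD.
have Lr : L2r (Re \o g).
  split => //; apply: integr_le I2 _; first exact: measurable_funX.
  move=> t; rewrite ger0_norm ?sqr_ge0// (le_trans _ (gh2 t))// lerDl.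
  exact: sqr_ge0.
have Li : L2r (Im \o g).
  split => //; apply: integr_le I2 _; first exact: measurable_funX.
  move=> t; rewrite ger0_norm ?sqr_ge0// (le_trans _ (gh2 t))// lerDr.
  exact: sqr_ge0.
split; first by split.
have [_ Ir] := Lr; have [_ Ii] := Li.
have [Lg Lh] : L2c g /\ L2c h by [].
rewrite !csqE// -RintegralZl//; last by apply: integrD.
by apply: le_Rintegral => //; exact: integrD.
Qed.

Lemma csqZ z g : L2c g -> csq (fun t => z * g t) <= cmod z ^+ 2 * csq g.
Proof.
move=> Lg; have [[mr _] [mi _]] := L2cZ z Lg.
apply: (csq_le_cmod _ mr mi Lg _).2; first exact: cmod_ge0.
by move=> t; rewrite cmodM.
Qed.

Lemma csq_eq0 g : L2c g -> csq g = 0 -> {ae mu, forall t, g t = 0}.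
Proof.
move=> [Lr Li] /eqP; rewrite paddr_eq0 ?nsq_ge0// => /andP[/eqP r0 /eqP i0].
apply: filterS2 (nsq_eq0 Lr r0) (nsq_eq0 Li i0) => t /= ? ?.
exact: complex_eq.
Qed.

Lemma csq_ae g h : L2c g -> L2c h -> {ae mu, forall t, g t = h t} -> csq g = csq h.
Proof.
move=> [[mgr _] [mgi _]] [[mhr _] [mhi _]] gh.
have E (P : R[i] -> R) : measurable_fun setT (P \o g) ->
    measurable_fun setT (P \o h) -> nsq (P \o g) = nsq (P \o h).
  move=> mg mh; rewrite /nsq /Rintegral; congr fine; apply: ae_eq_integral => //.
  - by apply: measEFin; exact: measurable_funX.
  - by apply: measEFin; exact: measurable_funX.
  - by apply: filterS gh => t /= ->.
by rewrite /csq (E Re)// (E Im).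
Qed.

Lemma L2c_ae g h : L2c g -> measurable_fun setT (Re \o h) ->
  measurable_fun setT (Im \o h) -> {ae mu, forall t, g t = h t} -> L2c h.
Proof.
move=> [[mgr Igr] [mgi Igi]] mhr mhi gh.
have E (P : R[i] -> R) : measurable_fun setT (P \o g) ->
    integr (fun t => (P \o g) t ^+ 2) ->
    measurable_fun setT (P \o h) -> L2r (P \o h).
  move=> mg Ig mh; split => //; apply: integr_ge0P.
  - exact: measurable_funX.
  - by move=> t; exact: sqr_ge0.
  - rewrite -(_ : \int[mu]_t ((P \o g) t ^+ 2)%:E = \int[mu]_t ((P \o h) t ^+ 2)%:E)%E.
      by rewrite integr_EFin// ltry.
    apply: ae_eq_integral => //.
    + by apply: measEFin; exact: measurable_funX.
    + by apply: measEFin; exact: measurable_funX.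
    + by apply: filterS gh => t /= ->.
by split; exact: E.
Qed.

Lemma sqrt_cvg0 (T : Type) (F : set_system T) {FF : Filter F} (u : T -> R) :
  (forall x, 0 <= u x) ->
  (u x @[x --> F] --> (0 : R)) <-> ((Num.sqrt (u x))%:E @[x --> F] --> 0%E).
Proof.
move=> u0; split => [/cvgr0Pnorm_lt H|/fine_cvgP[_ /cvgr0Pnorm_lt H]].
  apply/fine_cvgP; split; first exact: nearW.
  apply/cvgr0Pnorm_lt => e e0; have := H _ (exprn_gt0 2 e0).
  apply: filterS => x /=; rewrite !ger0_norm ?sqrtr_ge0// => ux.
  by rewrite -(ger0_norm (ltW e0)) -sqrtr_sqr ltr_sqrt// exprn_gt0.
apply/cvgr0Pnorm_lt => e e0.
have se : 0 < Num.sqrt e by rewrite sqrtr_gt0.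
have := H _ se; apply: filterS => x /=; rewrite !ger0_norm ?sqrtr_ge0//.
by rewrite ltr_sqrt.
Qed.

End ComplexL2.

(** * The Fourier transform on L^2 *)

Section FourierL2.
Context {R : realType}.
Local Notation mu := (@lebesgue_measure R).
Local Notation Re := (@complex.Re R).
Local Notation Im := (@complex.Im R).
Implicit Types (g h G H : R -> R[i]) (c s : R -> R).

Let kappa : R := (Num.sqrt (2 * pi))^-1.

Let kappa2 : kappa ^+ 2 * (2 * pi) = 1.
Proof.
have p0 : 0 < 2 * pi :> R by rewrite mulr_gt0// pi_gt0.
by rewrite /kappa exprVn sqr_sqrtr ?(ltW p0)// mulVf// gt_eqF.
Qed.

Definition is_sign (e : R) : Prop := e = 1 \/ e = -1.

Let is_sign_sq e : is_sign e -> e ^+ 2 = 1.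
Proof. by case=> ->; rewrite ?sqrrN expr1n. Qed.

(** The Fourier transform with sign [e] of a function whose real and imaginary
    parts have cosine transforms [c1], [c2] and sine transforms [s1], [s2]. *)
Definition trig_combine (e : R) c1 c2 s1 s2 (x : R) : R[i] :=
  (kappa * (c1 x - e * s2 x)) +i* (kappa * (c2 x + e * s1 x)).

Lemma trig_combine_L2 e c1 c2 s1 s2 : is_sign e ->
  L2r c1 -> L2r c2 -> L2r s1 -> L2r s2 ->
  L2c (trig_combine e c1 c2 s1 s2) /\
  csq (trig_combine e c1 c2 s1 s2) <=
  2 * kappa ^+ 2 * (nsq c1 + nsq c2 + nsq s1 + nsq s2).
Proof.
move=> /is_sign_sq e2 L1 L2 L3 L4.
have Le3 := L2rZ e L3; have Le4 := L2rZ e L4.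
have LD := L2rD L2 Le3; have LB := L2rB L1 Le4.
split; first by split; [exact: (L2rZ kappa LB)|exact: (L2rZ kappa LD)].
rewrite /csq (nsqZ kappa LB) (nsqZ kappa LD) -mulrDr -mulrA mulrCA.
rewrite ler_wpM2l ?sqr_ge0//.
have := nsqB_le L1 Le4; have := nsqD_le L2 Le3.
rewrite !nsqZ// e2 !mul1r; lra.
Qed.

Lemma truncated_ftE e A g x : is_sign e -> L2c g ->
  truncated_ft e A g x = trig_combine e
    (ktr cos (trunc A (Re \o g))) (ktr cos (trunc A (Im \o g)))
    (ktr sin (trunc A (Re \o g))) (ktr sin (trunc A (Im \o g))) x.
Proof.
move=> He [Lr Li].
have ce u : cos (e * u) = cos u by case: He => ->; rewrite ?mul1r// mulN1r cosN.
have se u : sin (e * u) = e * sin u.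
  by case: He => ->; rewrite ?mul1r// !mulN1r sinN.
have Ir phi : bounded_continuous phi ->
    integr (fun t => trunc A (Re \o g) t * phi (x * t)).
  by move=> Hphi; apply: integr_ktr => //; exact: trunc_integr.
have Ii phi : bounded_continuous phi ->
    integr (fun t => trunc A (Im \o g) t * phi (x * t)).
  by move=> Hphi; apply: integr_ktr => //; exact: trunc_integr.
have Hc := @bounded_continuous_cos R; have Hs := @bounded_continuous_sin R.
rewrite /truncated_ft /cintegral /trig_combine -/kappa.
apply: complex_eq; rewrite ?cReM ?cImM /= ?mul0r ?subr0 ?addr0; congr (_ * _).
- rewrite /ktr -RintegralZl; [|by []|exact: Ii].
  rewrite -RintegralB; [|by []|exact: Ir|exact/integrZ/Ii].
  rewrite [LHS]Rintegral_mkcond; apply: eq_Rintegral => t _.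
  rewrite /trunc !patchE; case: ifP => _; last by rewrite !mul0r mulr0 subr0.
  by rewrite cReM /= ce se; ring.
- rewrite /ktr -RintegralZl; [|by []|exact: Ir].
  rewrite -RintegralD; [|by []|exact: Ii|exact/integrZ/Ir].
  rewrite [LHS]Rintegral_mkcond; apply: eq_Rintegral => t _.
  rewrite /trunc !patchE; case: ifP => _; last by rewrite !mul0r mulr0 addr0.
  by rewrite cImM /= ce se; ring.
Qed.

Lemma truncated_ft_L2c e A g : is_sign e -> L2c g -> L2c (truncated_ft e A g).
Proof.
move=> He Lg; have [Lr Li] := Lg.
rewrite (_ : truncated_ft e A g = trig_combine e
    (ktr cos (trunc A (Re \o g))) (ktr cos (trunc A (Im \o g)))
    (ktr sin (trunc A (Re \o g))) (ktr sin (trunc A (Im \o g)))).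
  by apply: (trig_combine_L2 He _ _ _ _).1; apply: ktr_trunc_L2r => //; (by left) || by right.
by apply/funext => x; exact: truncated_ftE.
Qed.

Lemma is_L2_ftP e g h : is_sign e -> L2c g ->
  is_L2_ft e g h <->
  L2c h /\ csq (fun x => truncated_ft e A g x - h x) @[A --> +oo] --> (0 : R).
Proof.
move=> He Lg; have LA A := truncated_ft_L2c A He Lg.
have E : L2c h -> (fun A => L2dist (truncated_ft e A g) h) =
    (fun A => (Num.sqrt (csq (fun x => truncated_ft e A g x - h x)))%:E).
  by move=> Lh; apply/funext => A; rewrite /L2dist L2normE//; exact: L2cB.
split=> [[/L2P Lh]|[Lh]].
  by rewrite E// => ?; split => //; apply/sqrt_cvg0 => // A; exact: csq_ge0.
move=> H0; split; first exact/L2P.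
by rewrite E//; apply/sqrt_cvg0 => // A; exact: csq_ge0.
Qed.

(** Differences of transforms are again of the form [trig_combine], so that
    convergence of the four real transforms suffices. *)
Lemma is_L2_ft_trig e g c1 c2 s1 s2 : is_sign e -> L2c g ->
  is_ktr cos (Re \o g) c1 -> is_ktr cos (Im \o g) c2 ->
  is_ktr sin (Re \o g) s1 -> is_ktr sin (Im \o g) s2 ->
  is_L2_ft e g (trig_combine e c1 c2 s1 s2).
Proof.
move=> He Lg [L1 K1] [L2' K2] [L3 K3] [L4 K4]; have [Lr Li] := Lg.
have tc : trig (@cos R) by left.
have ts : trig (@sin R) by right.
apply/(is_L2_ftP _ He Lg); split.
  exact: (trig_combine_L2 He L1 L2' L3 L4).1.
pose d (phi f h : R -> R) (A x : R) := ktr phi (trunc A f) x - h x.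
have Ld (phi f h : R -> R) A : trig phi -> L2r f -> L2r h -> L2r (d phi f h A).
  by move=> tphi Lf Lh; apply: L2rB => //; exact: ktr_trunc_L2r.
have E A : (fun x => truncated_ft e A g x - trig_combine e c1 c2 s1 s2 x) =
    trig_combine e (d cos (Re \o g) c1 A) (d cos (Im \o g) c2 A)
      (d sin (Re \o g) s1 A) (d sin (Im \o g) s2 A).
  apply/funext => x; rewrite truncated_ftE//; apply: complex_eq;
    by rewrite ?cReB ?cImB /= /d; ring.
apply: (@squeeze_cvgr _ _ _ _ (fun=> 0) (fun A => 2 * kappa ^+ 2 *
  (nsq (d cos (Re \o g) c1 A) + nsq (d cos (Im \o g) c2 A) +
   nsq (d sin (Re \o g) s1 A) + nsq (d sin (Im \o g) s2 A)))).
- apply: nearW => A; rewrite csq_ge0 E /=.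
  by apply: (trig_combine_L2 He _ _ _ _).2; exact: Ld.
- exact: cvg_cst.
- rewrite [X in _ --> X](_ : 0 = 2 * kappa ^+ 2 * (0 + 0 + 0 + 0)); last by ring.
  by apply: cvgM; [exact: cvg_cst|do 3 apply: cvgD => //].
Qed.

Lemma is_L2_ft_unique e g h h' : is_sign e -> L2c g ->
  is_L2_ft e g h -> is_L2_ft e g h' -> {ae mu, forall x, h x = h' x}.
Proof.
move=> He Lg /(is_L2_ftP _ He Lg)[Lh K] /(is_L2_ftP _ He Lg)[Lh' K'].
suff : csq (fun x => h x - h' x) = 0.
  move=> /(csq_eq0 (L2cB Lh Lh')); apply: filterS => x /eqP.
  by rewrite subr_eq0 => /eqP.
apply/eqP; rewrite eq_le csq_ge0 andbT.
have L0 : 2 * csq (fun x => truncated_ft e A g x - h' x) +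
    2 * csq (fun x => truncated_ft e A g x - h x) @[A --> +oo] --> (0 : R).
  rewrite -[X in _ --> X](addr0) -(mulr0 2).
  by apply: cvgD; apply: cvgM => //; exact: cvg_cst.
apply: (cvgr_to_ge L0); apply: nearW => A.
have LA := truncated_ft_L2c A He Lg.
rewrite (_ : (fun x => h x - h' x) = (fun x => (truncated_ft e A g x - h' x) -
  (truncated_ft e A g x - h x))); last by apply/funext => x; ring.
exact: csqB_le (L2cB LA Lh') (L2cB LA Lh).
Qed.

Lemma is_L2_ft_exists e g : is_sign e -> L2c g -> exists h, is_L2_ft e g h.
Proof.
move=> He Lg; have [Lr Li] := Lg.
have tc : trig (@cos R) by left.
have ts : trig (@sin R) by right.
have [c1 H1] := is_ktr_exists tc Lr; have [c2 H2] := is_ktr_exists tc Li.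
have [s1 H3] := is_ktr_exists ts Lr; have [s2 H4] := is_ktr_exists ts Li.
by exists (trig_combine e c1 c2 s1 s2); exact: is_L2_ft_trig.
Qed.

(** Plancherel's theorem up to a constant: [8] is [2 * kappa ^ 2] from
    [trig_combine_L2] times [2 * (4 * pi)] from the real transforms. *)
Lemma is_L2_ft_bound e g h : is_sign e -> L2c g -> is_L2_ft e g h ->
  csq h <= 8 * csq g.
Proof.
move=> He Lg K; have [Lr Li] := Lg.
have tc : trig (@cos R) by left.
have ts : trig (@sin R) by right.
have [c1 H1] := is_ktr_exists tc Lr; have [c2 H2] := is_ktr_exists tc Li.
have [s1 H3] := is_ktr_exists ts Lr; have [s2 H4] := is_ktr_exists ts Li.
have K' := is_L2_ft_trig He Lg H1 H2 H3 H4.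
have [[/L2P Lh _] [/L2P Lh' _]] := (K, K').
rewrite (csq_ae Lh Lh' (is_L2_ft_unique He Lg K K')).
have [[L1 _] [L2' _] [L3 _] [L4 _]] := And4 H1 H2 H3 H4.
apply: le_trans (trig_combine_L2 He L1 L2' L3 L4).2 _.
have B1 := is_ktr_bound tc Lr H1; have B2 := is_ktr_bound tc Li H2.
have B3 := is_ktr_bound ts Lr H3; have B4 := is_ktr_bound ts Li H4.
have -> : 8 * csq g = 2 * kappa ^+ 2 * (8 * @pi R * csq g).
  rewrite (_ : 2 * kappa ^+ 2 * (8 * @pi R * csq g) =
    kappa ^+ 2 * (2 * pi) * (8 * csq g)); last by ring.
  by rewrite kappa2 mul1r.
apply: ler_wpM2l; first by rewrite mulr_ge0// sqr_ge0.
have -> : 8 * @pi R * csq g = 4 * pi * nsq (Re \o g) + 4 * pi * nsq (Im \o g) +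
    4 * pi * nsq (Re \o g) + 4 * pi * nsq (Im \o g) by rewrite /csq; ring.
by do 3 apply: lerD => //.
Qed.

Lemma is_L2_ftD e g h G H : is_sign e -> L2c g -> L2c h ->
  is_L2_ft e g G -> is_L2_ft e h H ->
  is_L2_ft e (fun t => g t + h t) (fun x => G x + H x).
Proof.
move=> He Lg Lh /(is_L2_ftP _ He Lg)[LG KG] /(is_L2_ftP _ He Lh)[LH KH].
have Lgh := L2cD Lg Lh; apply/(is_L2_ftP _ He Lgh); split; first exact: L2cD.
have ktrD phi (f1 f2 : R -> R) A x : bounded_continuous phi -> L2r f1 -> L2r f2 ->
    ktr phi (trunc A (fun t => f1 t + f2 t)) x =
    ktr phi (trunc A f1) x + ktr phi (trunc A f2) x.
  move=> Hphi L1 L2'; rewrite /ktr -RintegralD//;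
    [|by apply: integr_ktr => //; exact: trunc_integr..].
  apply: eq_Rintegral => t _; rewrite !truncE; case: ifP => _; first by rewrite mulrDl.
  by rewrite !mul0r addr0.
have E A x : truncated_ft e A (fun t => g t + h t) x =
    truncated_ft e A g x + truncated_ft e A h x.
  have [[Lgr Lgi] [Lhr Lhi]] := (Lg, Lh).
  have Hc := @bounded_continuous_cos R; have Hs := @bounded_continuous_sin R.
  rewrite !truncated_ftE// /trig_combine.
  rewrite (_ : Re \o _ = fun t => (Re \o g) t + (Re \o h) t); last first.
    by apply/funext => t; rewrite /= cReD.
  rewrite (_ : Im \o (fun t => g t + h t) = fun t => (Im \o g) t + (Im \o h) t); last first.
    by apply/funext => t; rewrite /= cImD.
  by rewrite !ktrD//; apply: complex_eq; rewrite ?cReD ?cImD /=; ring.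
have L0 : 2 * csq (fun x => truncated_ft e A g x - G x) +
    2 * csq (fun x => truncated_ft e A h x - H x) @[A --> +oo] --> (0 : R).
  rewrite -[X in _ --> X](addr0) -(mulr0 2).
  by apply: cvgD; apply: cvgM => //; exact: cvg_cst.
apply: (@squeeze_cvgr _ _ _ _ (fun=> 0) _ _ _ _ _ L0); last exact: cvg_cst.
apply: nearW => A; rewrite csq_ge0 /=.
rewrite (_ : (fun x => _) = (fun x => (truncated_ft e A g x - G x) +
    (truncated_ft e A h x - H x))); last by apply/funext => x; rewrite E; ring.
by apply: csqD_le; apply: L2cB => //; exact: truncated_ft_L2c.
Qed.

Lemma is_L2_ftZ e (z : R[i]) g G : is_sign e -> L2c g ->
  is_L2_ft e g G -> is_L2_ft e (fun t => z * g t) (fun x => z * G x).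
Proof.
move=> He Lg /(is_L2_ftP _ He Lg)[LG KG].
have Lzg := L2cZ z Lg; apply/(is_L2_ftP _ He Lzg); split; first exact: L2cZ.
have E A x : truncated_ft e A (fun t => z * g t) x = z * truncated_ft e A g x.
  have [Lgr Lgi] := Lg.
  have Hc := @bounded_continuous_cos R; have Hs := @bounded_continuous_sin R.
  rewrite !truncated_ftE// /trig_combine.
  rewrite (_ : Re \o _ = fun t => Re z * (Re \o g) t + (- Im z) * (Im \o g) t); last first.
    by apply/funext => t; rewrite /= cReM mulNr.
  rewrite (_ : Im \o (fun t => z * g t) =
      fun t => Re z * (Im \o g) t + Im z * (Re \o g) t); last first.
    by apply/funext => t; rewrite /= cImM.
  by rewrite !ktr_trunc_linear//; apply: complex_eq; rewrite ?cReM ?cImM /=; ring.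
have L0 : cmod z ^+ 2 * csq (fun x => truncated_ft e A g x - G x)
    @[A --> +oo] --> (0 : R).
  by rewrite -(mulr0 (cmod z ^+ 2)); apply: cvgM => //; exact: cvg_cst.
apply: (@squeeze_cvgr _ _ _ _ (fun=> 0) _ _ _ _ _ L0); last exact: cvg_cst.
apply: nearW => A; rewrite csq_ge0 /=.
rewrite (_ : (fun x => _) = (fun x => z * (truncated_ft e A g x - G x))); last first.
  by apply/funext => x; rewrite E; ring.
by apply: csqZ; apply: L2cB => //; exact: truncated_ft_L2c.
Qed.

End FourierL2.

(** * Fourier inversion *)

Section Inversion.
Context {R : realType}.
Local Notation mu := (@lebesgue_measure R).
Local Notation Re := (@complex.Re R).
Local Notation Im := (@complex.Im R).
Implicit Types (g h G H : R -> R[i]).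

(** Both signs at once: [ft (-1)] and [ft 1] are convertible to [fourier] and
    [ifourier]. *)
Definition ft (e : R) g : R -> R[i] := xget (cst 0) [set h | is_L2_ft e g h].

Lemma ftP e g : is_sign e -> L2c g -> is_L2_ft e g (ft e g).
Proof. by move=> He Lg; have := xgetPex (cst 0) (is_L2_ft_exists He Lg). Qed.

Lemma ft_L2c e g : is_sign e -> L2c g -> L2c (ft e g).
Proof. by move=> He Lg; have [/L2P] := ftP He Lg. Qed.

Lemma ft_dist e g h : is_sign e -> L2c g -> L2c h ->
  csq (fun x => ft e g x - ft e h x) <= 8 * csq (fun t => g t - h t).
Proof.
move=> He Lg Lh.
have K := is_L2_ftD He Lg (L2cZ (-1) Lh) (ftP He Lg) (is_L2_ftZ (-1) He Lh (ftP He Lh)).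
have := is_L2_ft_bound He (L2cD Lg (L2cZ (-1) Lh)) K.
rewrite (_ : (fun t => g t + -1 * h t) = (fun t => g t - h t)); last first.
  by apply/funext => t; rewrite mulN1r.
by rewrite (_ : (fun t => ft e g t + -1 * ft e h t) =
  (fun t => ft e g t - ft e h t))//; apply/funext => t; rewrite mulN1r.
Qed.

Lemma ft_ae e g h : is_sign e -> L2c g -> L2c h ->
  {ae mu, forall t, g t = h t} -> {ae mu, forall x, ft e g x = ft e h x}.
Proof.
move=> He Lg Lh gh.
suff : csq (fun x => ft e g x - ft e h x) = 0.
  move=> /(csq_eq0 (L2cB (ft_L2c He Lg) (ft_L2c He Lh))).
  by apply: filterS => x /eqP; rewrite subr_eq0 => /eqP.
apply/eqP; rewrite eq_le csq_ge0 andbT (le_trans (ft_dist He Lg Lh))//.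
have -> : csq (fun t => g t - h t) = csq (fun t => g t - g t).
  by apply: csq_ae; [exact: L2cB|exact: L2cB|apply: filterS gh => t /= ->].
rewrite (_ : (fun t => g t - g t) = fun t => 0 * g t); last first.
  by apply/funext => t; rewrite subrr mul0r.
by rewrite (le_trans (ler_wpM2l _ (csqZ 0 Lg)))// cmod_sq /= expr0n addr0 mul0r mulr0.
Qed.

Lemma ftD e g h (a b : R[i]) : is_sign e -> L2c g -> L2c h ->
  {ae mu, forall x, ft e (fun t => a * g t + b * h t) x = a * ft e g x + b * ft e h x}.
Proof.
move=> He Lg Lh; have Lag := L2cZ a Lg; have Lbh := L2cZ b Lh.
have L := L2cD Lag Lbh.
apply: (is_L2_ft_unique He L (ftP He L)).
by apply: is_L2_ftD => //; apply: is_L2_ftZ => //; exact: ftP.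
Qed.

(** With [C] and [S] the cosine and sine transforms, the two signs compose to
    [(C + i S) (C - i S) = C C + S S + i (S C - C S)], up to the normalisation,
    and the real inversion formulas apply to the two parts of [g]. *)
Lemma ftK g : L2c g -> {ae mu, forall t, ft 1 (ft (-1) g) t = g t}.
Proof.
move=> Lg; have [Lr Li] := Lg.
have He : is_sign (-1 : R) by right.
have He1 : is_sign (1 : R) by left.
have tc : trig (@cos R) by left.
have ts : trig (@sin R) by right.
have [c1 C1] := is_ktr_exists tc Lr; have [c2 C2] := is_ktr_exists tc Li.
have [s1 S1] := is_ktr_exists ts Lr; have [s2 S2] := is_ktr_exists ts Li.
have [[Lc1 _] [Lc2 _] [Ls1 _] [Ls2 _]] := And4 C1 C2 S1 S2.
have [cc1 CC1] := is_ktr_exists tc Lc1; have [cc2 CC2] := is_ktr_exists tc Lc2.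
have [cs1 CS1] := is_ktr_exists tc Ls1; have [cs2 CS2] := is_ktr_exists tc Ls2.
have [sc1 SC1] := is_ktr_exists ts Lc1; have [sc2 SC2] := is_ktr_exists ts Lc2.
have [ss1 SS1] := is_ktr_exists ts Ls1; have [ss2 SS2] := is_ktr_exists ts Ls2.
have KG := is_L2_ft_trig He Lg C1 C2 S1 S2.
have LG := (trig_combine_L2 He Lc1 Lc2 Ls1 Ls2).1.
have EG := is_L2_ft_unique He Lg (ftP He Lg) KG.
set k : R := (Num.sqrt (2 * pi))^-1.
have k2 : k ^+ 2 * (2 * pi) = 1.
  have p0 : 0 < 2 * pi :> R by rewrite mulr_gt0// pi_gt0.
  by rewrite /k exprVn sqr_sqrtr ?(ltW p0)// mulVf// gt_eqF.
have RG : Re \o trig_combine (-1) c1 c2 s1 s2 = fun x => k * c1 x + k * s2 x.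
  by apply/funext => x; rewrite /trig_combine /= -/k; ring.
have IG : Im \o trig_combine (-1) c1 c2 s1 s2 = fun x => k * c2 x + (- k) * s1 x.
  by apply/funext => x; rewrite /trig_combine /= -/k; ring.
have K1 := is_ktr_linear k k tc Lc1 Ls2 CC1 CS2.
have K2 := is_ktr_linear k (- k) tc Lc2 Ls1 CC2 CS1.
have K3 := is_ktr_linear k k ts Lc1 Ls2 SC1 SS2.
have K4 := is_ktr_linear k (- k) ts Lc2 Ls1 SC2 SS1.
rewrite -RG in K1 K3; rewrite -IG in K2 K4.
have E1 := ft_ae He1 (ft_L2c He Lg) LG EG.
have E2 := is_L2_ft_unique He1 LG (ftP He1 LG) (is_L2_ft_trig He1 LG K1 K2 K3 K4).
have I1 := is_ktr_inversion_cos Lr C1 S1 CC1 SS1.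
have I2 := is_ktr_inversion_cos Li C2 S2 CC2 SS2.
have I3 := is_ktr_inversion_sin Lr C1 S1 CS1 SC1.
have I4 := is_ktr_inversion_sin Li C2 S2 CS2 SC2.
apply: filterS2 (filterI E1 E2) (filterI (filterI I1 I2) (filterI I3 I4)).
move=> x [-> ->] [[i1 i2] [i3 i4]]; apply: complex_eq; rewrite /trig_combine /= -/k.
- rewrite (_ : k * _ = k ^+ 2 * (cc1 x + ss1 x) + k ^+ 2 * (cs2 x - sc2 x)); last by ring.
  by rewrite i1 i4 subrr mulr0 addr0 mulrA k2 mul1r.
- rewrite (_ : k * _ = k ^+ 2 * (cc2 x + ss2 x) + k ^+ 2 * (sc1 x - cs1 x)); last by ring.
  by rewrite i2 i3 subrr mulr0 addr0 mulrA k2 mul1r.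
Qed.

End Inversion.

(** * Measurability and bounds for the symbol *)

Section ComplexMeasurability.
Context {R : realType}.
Local Notation Re := (@complex.Re R).
Local Notation Im := (@complex.Im R).
Implicit Types (g h : R -> R[i]) (f : R -> R).

Definition cmeasurable g : Prop :=
  measurable_fun setT (Re \o g) /\ measurable_fun setT (Im \o g).

Lemma cmeasurable_complex f1 f2 : measurable_fun setT f1 ->
  measurable_fun setT f2 -> cmeasurable (fun x => f1 x +i* f2 x).
Proof. by []. Qed.

Lemma cmeasurable_cst (z : R[i]) : cmeasurable (fun=> z).
Proof. by split; exact: measurable_cst. Qed.

Lemma cmeasurableD g h : cmeasurable g -> cmeasurable h ->
  cmeasurable (fun x => g x + h x).
Proof.
move=> [gr gi] [hr hi]; split.
  by have := measurable_funD gr hr; congr measurable_fun; apply/funext => x /=; rewrite cReD.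
by have := measurable_funD gi hi; congr measurable_fun; apply/funext => x /=; rewrite cImD.
Qed.

Lemma cmeasurableM g h : cmeasurable g -> cmeasurable h ->
  cmeasurable (fun x => g x * h x).
Proof.
move=> [gr gi] [hr hi]; split.
  have := measurable_funB (measurable_funM gr hr) (measurable_funM gi hi).
  by congr measurable_fun; apply/funext => x /=; rewrite cReM.
have := measurable_funD (measurable_funM gr hi) (measurable_funM gi hr).
by congr measurable_fun; apply/funext => x /=; rewrite cImM.
Qed.

Lemma cmeasurableB g h : cmeasurable g -> cmeasurable h ->
  cmeasurable (fun x => g x - h x).
Proof.
move=> mg mh; have := cmeasurableD mg (cmeasurableM (cmeasurable_cst (-1)) mh).
by congr cmeasurable; apply/funext => x; rewrite mulN1r.
Qed.

Lemma cmeasurableV g : cmeasurable g -> cmeasurable (fun x => (g x)^-1).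
Proof.
move=> [gr gi].
have mn : measurable_fun setT (fun x => (Re (g x) ^+ 2 + Im (g x) ^+ 2)^-1).
  rewrite (_ : (fun x => _) = (fun x => (Re (g x) ^+ 2 + Im (g x) ^+ 2) `^ (-1))).
    apply: (measurableT_comp (measurable_powR _)).
    by apply: measurable_funD; exact: measurable_funX.
  by apply/funext => x; rewrite powR_inv1// addr_ge0 ?sqr_ge0.
split.
  have := measurable_funM gr mn.
  by congr measurable_fun; apply/funext => x /=; case: (g x).
have mi : measurable_fun setT (fun x => - Im (g x)) by exact: measurableT_comp.
have := measurable_funM mi mn.
congr measurable_fun; apply/funext => x /=; case: (g x) => a b /=.
by rewrite mulNr.
Qed.

Lemma measurable_sqrt : measurable_fun setT (@Num.sqrt R).
Proof. by apply: continuous_measurable_fun; exact: sqrt_continuous. Qed.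

Lemma cmeasurable_sqrtc g : cmeasurable g -> cmeasurable (fun x => sqrtc (g x)).
Proof.
move=> [gr gi].
have mn : measurable_fun setT (fun x => Num.sqrt (Re (g x) ^+ 2 + Im (g x) ^+ 2)).
  apply: (measurableT_comp measurable_sqrt).
  by apply: measurable_funD; exact: measurable_funX.
split.
  have := measurableT_comp measurable_sqrt
    (measurable_funM (measurable_funD mn gr) (measurable_cst (2^-1 : R))).
  by congr measurable_fun; apply/funext => x /=; case: (g x).
have ms : measurable_fun setT (fun x => if Im (g x) < 0 then -1 else 1 : R).
  by apply: measurable_fun_ifT => //; exact: measurable_fun_ltr.
have := measurable_funM ms (measurableT_comp measurable_sqrt
    (measurable_funM (measurable_funB mn gr) (measurable_cst (2^-1 : R)))).
congr measurable_fun; apply/funext => x /=; case: (g x) => a b /=; congr (_ * _).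
by case: sgrP => //; rewrite ?eqxx// => b0; rewrite ?(gt_eqF b0) ?(lt_eqF b0).
Qed.

Lemma cmeasurable_cexp g : cmeasurable g -> cmeasurable (fun x => cexp (g x)).
Proof.
move=> [gr gi].
have me : measurable_fun setT (fun x => expR (Re (g x))).
  exact: (measurableT_comp (@measurable_expR R)).
have mc : measurable_fun setT (fun x => cos (Im (g x))).
  apply: (@measurableT_comp _ _ _ _ _ _ (@cos R)) => //.
  by apply: continuous_measurable_fun; exact: continuous_cos.
have ms : measurable_fun setT (fun x => sin (Im (g x))).
  apply: (@measurableT_comp _ _ _ _ _ _ (@sin R)) => //.
  by apply: continuous_measurable_fun; exact: continuous_sin.
have := cmeasurable_complex (measurable_funM me mc) (measurable_funM me ms).
congr cmeasurable; apply/funext => x; apply: complex_eq;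
  by rewrite /cexp ?cReM ?cImM /= mul0r ?subr0 ?addr0.
Qed.

End ComplexMeasurability.

Section Symbol.
Context {R : realType}.
Local Notation Re := (@complex.Re R).
Local Notation Im := (@complex.Im R).
Implicit Types (z w : R[i]).

Lemma cmod_zfreq_le (nu xi : R) : 0 < nu -> cmod (zfreq nu xi) <= nu + `|xi|.
Proof.
move=> nu0; rewrite cmodE /= -[leRHS]ger0_norm ?addr_ge0 ?(ltW nu0)//.
rewrite -sqrtr_sqr ler_sqrt ?sqr_ge0// sqrrD real_normK ?num_real//.
rewrite lerD2r lerDl mulrn_wge0// mulr_ge0// ltW//.
Qed.

Variables (alpha beta nu x0 : R).
Hypotheses (halpha : 0 < alpha ^+ 2) (hnu : 0 < nu) (hbeta : 0 <= beta)
  (hx0 : 0 < x0).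

Definition disc (xi : R) : R[i] :=
  (beta ^+ 2)%:C + (4 * alpha ^+ 2)%:C * zfreq nu xi.

(** The characteristic roots of [- alpha^2 r^2 + beta r + z = 0]. *)
Definition root_minus (xi : R) : R[i] :=
  (beta%:C - sqrtc (disc xi)) / (2 * alpha ^+ 2)%:C.

Definition root_plus (xi : R) : R[i] :=
  (beta%:C + sqrtc (disc xi)) / (2 * alpha ^+ 2)%:C.

Lemma Re_disc xi : Re (disc xi) = beta ^+ 2 + 4 * alpha ^+ 2 * nu.
Proof. by rewrite /disc cReD cReM /= mul0r subr0. Qed.

(** The real part of the principal root is [sqrt ((|z| + Re z) / 2)]. *)
Lemma Re_sqrtc_ge z : Num.sqrt (Re z) <= Re (sqrtc z).
Proof.
case: z => a b /=; rewrite ler_wsqrtr// ler_pdivlMr// mulr_natr mulr2n lerD2r.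
by have := ler_Re_cmod (a +i* b); rewrite cmodE.
Qed.

Definition disc0 : R := Num.sqrt (beta ^+ 2 + 4 * alpha ^+ 2 * nu).

Lemma disc0_gt : beta < disc0.
Proof.
have h : 0 < 4 * alpha ^+ 2 * nu by apply: mulr_gt0 => //; exact: mulr_gt0.
rewrite -[ltLHS](ger0_norm hbeta) -sqrtr_sqr ltr_sqrt ?ltrDl//.
by rewrite ltr_wpDl ?sqr_ge0.
Qed.

Lemma Re_sqrt_disc xi : disc0 <= Re (sqrtc (disc xi)).
Proof. by have := Re_sqrtc_ge (disc xi); rewrite Re_disc. Qed.

(** A decay rate of the bounded exponential that is uniform in the frequency; it
    keeps the denominator of [Lambda] away from 0. *)
Definition decay : R := (disc0 - beta) / (2 * alpha ^+ 2).

Lemma decay_gt0 : 0 < decay.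
Proof. by apply: divr_gt0; [rewrite subr_gt0 disc0_gt|exact: mulr_gt0]. Qed.

Lemma Re_divC z (r : R) : Re (z / r%:C) = Re z / r.
Proof.
by case: z => a b; rewrite -fmorphV cReM /= mulr0 subr0.
Qed.

Lemma Re_root_minus xi : Re (root_minus xi) <= - decay.
Proof.
rewrite /root_minus Re_divC cReB [Re beta%:C]/= /decay -mulNr opprB.
apply: ler_wpM2r; first by rewrite invr_ge0 mulr_ge0// sqr_ge0.
by rewrite lerD2l lerN2 Re_sqrt_disc.
Qed.

Lemma Re_root_plus xi : 0 < Re (root_plus xi).
Proof.
rewrite /root_plus Re_divC cReD [Re beta%:C]/=; apply: divr_gt0; last exact: mulr_gt0.
by rewrite ltr_wpDl// (lt_le_trans _ (Re_sqrt_disc xi))// (le_lt_trans hbeta disc0_gt).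
Qed.

Definition attenuation : R := expR (- decay * x0).

Lemma attenuation_lt1 : attenuation < 1.
Proof. by rewrite /attenuation -expR0 ltr_expR mulNr oppr_lt0 mulr_gt0// decay_gt0. Qed.

Lemma LambdaE xi : Lambda alpha beta nu x0 xi =
  zfreq nu xi / (1 - cexp (root_minus xi * x0%:C)).
Proof. by []. Qed.

Lemma cmod_denominator_ge xi :
  1 - attenuation <= cmod (1 - cexp (root_minus xi * x0%:C)).
Proof.
apply: le_trans (ler_Re_cmod _); rewrite cReB [Re 1]/= lerD2l lerN2.
apply: le_trans (ler_Re_cmod _) _; rewrite cmod_cexp ler_expR cReM [Re x0%:C]/= [Im x0%:C]/= mulr0 subr0.
by rewrite ler_wpM2r ?(ltW hx0)// Re_root_minus.
Qed.

Lemma denominator_neq0 xi : 1 - cexp (root_minus xi * x0%:C) != 0.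
Proof.
rewrite -cmod_eq0 gt_eqF// (lt_le_trans _ (cmod_denominator_ge xi))//.
by rewrite subr_gt0 attenuation_lt1.
Qed.

Lemma cmod_Lambda_le xi :
  cmod (Lambda alpha beta nu x0 xi) <= (1 - attenuation)^-1 * (nu + `|xi|).
Proof.
have q0 : 0 < 1 - attenuation by rewrite subr_gt0 attenuation_lt1.
rewrite LambdaE cmodM cmodV mulrC ler_pM ?invr_ge0 ?cmod_ge0//.
  rewrite lef_pV2 ?cmod_denominator_ge ?posrE//.
  exact: lt_le_trans (cmod_denominator_ge xi).
exact: cmod_zfreq_le.
Qed.

Lemma cmeasurable_Lambda : cmeasurable (Lambda alpha beta nu x0).
Proof.
have mz : cmeasurable (zfreq nu).
  by apply: cmeasurable_complex => //; exact: measurable_id.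
apply: cmeasurableM => //; apply: cmeasurableV; apply: cmeasurableB.
  exact: cmeasurable_cst.
apply: cmeasurable_cexp; apply: cmeasurableM; last exact: cmeasurable_cst.
apply: cmeasurableM; last exact: cmeasurable_cst.
apply: cmeasurableB; first exact: cmeasurable_cst.
apply: cmeasurable_sqrtc; apply: cmeasurableD; first exact: cmeasurable_cst.
by apply: cmeasurableM => //; exact: cmeasurable_cst.
Qed.

Definition filter_factor (mu xi : R) : R := (1 + mu ^+ 2 * xi ^+ 2)^-1.

Lemma filter_factor_ge0 mu xi : 0 <= filter_factor mu xi.
Proof. by rewrite invr_ge0 addr_ge0// mulr_ge0 ?sqr_ge0. Qed.

Lemma filter_factor_le1 mu xi : filter_factor mu xi <= 1.
Proof.
have D1 : 1 <= 1 + mu ^+ 2 * xi ^+ 2 by rewrite lerDl mulr_ge0 ?sqr_ge0.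
by rewrite /filter_factor invf_le1// (lt_le_trans ltr01 D1).
Qed.

Definition regularized_bound : R := (1 - attenuation)^-1 * (nu + 1).

Lemma regularized_bound_ge0 : 0 <= regularized_bound.
Proof.
rewrite mulr_ge0 ?invr_ge0 ?subr_ge0 ?(ltW attenuation_lt1)//.
by rewrite addr_ge0// ltW.
Qed.

(** The symbol grows like the frequency, the filter decays like [(mu * xi) ^ -2];
    the product is largest at frequencies of order [1 / mu]. *)
Lemma cmod_regularized_le mu xi : 0 < mu < 1 ->
  cmod (Lambda alpha beta nu x0 xi / (1 + mu ^+ 2 * xi ^+ 2)%:C) <=
  regularized_bound / mu.
Proof.
move=> /andP[mu0 mu1]; have q0 : 0 < 1 - attenuation by rewrite subr_gt0 attenuation_lt1.
have D0 : 0 < 1 + mu ^+ 2 * xi ^+ 2 by rewrite ltr_wpDr// mulr_ge0 ?sqr_ge0.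
rewrite cmodM cmodV cmod_real (gtr0_norm D0) ler_pdivrMr//.
apply: le_trans (cmod_Lambda_le xi) _.
rewrite /regularized_bound -2![leRHS]mulrA ler_pM2l ?invr_gt0//.
rewrite mulrCA -ler_pdivrMl ?invr_gt0// invrK.
have -> : xi ^+ 2 = `|xi| ^+ 2 by rewrite real_normK ?num_real.
have := normr_ge0 xi; move: `|xi| => x xge0.
have := sqr_ge0 (mu * x - 1); have : 0 <= mu * x by rewrite mulr_ge0// ltW.
have : mu * nu <= nu by rewrite ler_piMl// ltW.
have : 0 <= nu * (mu ^+ 2 * x ^+ 2) by rewrite !mulr_ge0 ?sqr_ge0// ltW.
nra.
Qed.

Lemma cmeasurable_regularized mu : cmeasurable (fun xi =>
  Lambda alpha beta nu x0 xi / (1 + mu ^+ 2 * xi ^+ 2)%:C).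
Proof.
apply: cmeasurableM; first exact: cmeasurable_Lambda.
apply: cmeasurableV; apply: cmeasurable_complex; last exact: measurable_cst.
apply: measurable_funD; first exact: measurable_cst.
apply: measurable_funM; first exact: measurable_cst.
by apply: measurable_funX; exact: measurable_id.
Qed.

End Symbol.

(** * The differential equation in the frequency domain *)

Section ComplexDerivative.
Context {R : realType}.
Local Notation Re := (@complex.Re R).
Local Notation Im := (@complex.Im R).
Implicit Types (g h p : R -> R[i]) (c d z : R[i]) (x : R).

Definition is_cderive g x d : Prop :=
  is_derive x 1 (fun t => Re (g t)) (Re d) /\
  is_derive x 1 (fun t => Im (g t)) (Im d).

Lemma cderivableP g x : cderivable g x -> is_cderive g x (cderive g x).
Proof. by move=> [dr di]; split; rewrite /= derive1E; exact: derivableP. Qed.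

Lemma is_cderive_eq g x d d' : is_cderive g x d -> d = d' -> is_cderive g x d'.
Proof. by move=> + <-. Qed.

Lemma is_cderiveM g h x d d' : is_cderive g x d -> is_cderive h x d' ->
  is_cderive (fun t => g t * h t) x (g x * d' + h x * d).
Proof.
move=> [gr gi] [hr hi]; split.
  under eq_fun do rewrite cReM.
  apply: (is_derive_eq (is_deriveB (is_derive_mul gr hr) (is_derive_mul gi hi))).
  by rewrite cReD !cReM; ring.
under eq_fun do rewrite cImM.
apply: (is_derive_eq (is_derive_add (is_derive_mul gr hi) (is_derive_mul gi hr))).
by rewrite cImD !cImM; ring.
Qed.

Lemma is_cderive_cst z x : is_cderive (fun=> z) x 0.
Proof. by split; exact: is_derive_cst. Qed.

Lemma is_cderiveZ z g x d : is_cderive g x d ->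
  is_cderive (fun t => z * g t) x (z * d).
Proof.
move=> dg; apply: is_cderive_eq (is_cderiveM (is_cderive_cst z x) dg) _.
by rewrite mulr0 addr0.
Qed.

Lemma is_cderiveD g h x d d' : is_cderive g x d -> is_cderive h x d' ->
  is_cderive (fun t => g t + h t) x (d + d').
Proof.
move=> [gr gi] [hr hi]; split.
  under eq_fun do rewrite cReD.
  by rewrite cReD; exact: is_derive_add.
under eq_fun do rewrite cImD.
by rewrite cImD; exact: is_derive_add.
Qed.

Lemma cexpE z : cexp z = (expR (Re z) * cos (Im z)) +i* (expR (Re z) * sin (Im z)).
Proof.
by apply: complex_eq; rewrite /cexp ?cReM ?cImM /= mul0r ?subr0 ?addr0.
Qed.

Lemma cexp0 : cexp (0 : R[i]) = 1.
Proof. by rewrite cexpE /= expR0 cos0 sin0 mulr1 mulr0. Qed.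

Lemma cexpD z c : cexp (z + c) = cexp z * cexp c.
Proof.
rewrite !cexpE; apply: complex_eq; rewrite ?cReM ?cImM /= cReD cImD expRD ?cosD ?sinD;
  ring.
Qed.

Lemma is_cderive_cexp c x :
  is_cderive (fun t => cexp (c * t%:C)) x (c * cexp (c * x%:C)).
Proof.
have EE (t : R) : cexp (c * t%:C) =
    (expR (Re c * t) * cos (Im c * t)) +i* (expR (Re c * t) * sin (Im c * t)).
  by rewrite cexpE; case: c => a b /=; rewrite !mulr0 subr0 add0r.
have de := is_derive_scale_comp (Re c) x (@is_derive_expR R).
have dc := is_derive_scale_comp (Im c) x (@is_derive_cos R).
have ds := is_derive_scale_comp (Im c) x (@is_derive_sin R).
split.
  under eq_fun do rewrite EE.
  apply: (is_derive_eq (is_derive_mul de dc)).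
  by rewrite EE cReM /=; ring.
under eq_fun do rewrite EE.
apply: (is_derive_eq (is_derive_mul de ds)).
by rewrite EE cImM /=; ring.
Qed.

Lemma is_cderive0_cst g : (forall x, is_cderive g x 0) -> forall x y, g x = g y.
Proof.
move=> dg x y; apply: complex_eq.
  by apply: (@is_derive_0_is_cst R (fun t => Re (g t))) => t; case: (dg t).
by apply: (@is_derive_0_is_cst R (fun t => Im (g t))) => t; case: (dg t).
Qed.

(** The product of [p] with the inverse exponential has derivative 0. *)
Lemma ode_first_order c p : (forall x, is_cderive p x (c * p x)) ->
  forall x, p x = p 0 * cexp (c * x%:C).
Proof.
move=> dp x.
have D (t : R) : is_cderive (fun t => p t * cexp (- c * t%:C)) t 0.
  apply: is_cderive_eq (is_cderiveM (dp t) (is_cderive_cexp (- c) t)) _.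
  by ring.
have := is_cderive0_cst D x 0; rewrite mulr0 cexp0 mulr1 => <-.
by rewrite -mulrA -cexpD -mulrDl addNr mul0r cexp0 mulr1.
Qed.

End ComplexDerivative.

Section SourceODE.
Context {R : realType}.
Local Notation Re := (@complex.Re R).
Local Notation Im := (@complex.Im R).
Variables (alpha beta nu : R).
Hypotheses (halpha : 0 < alpha ^+ 2) (hnu : 0 < nu) (hbeta : 0 <= beta).
Variables (v : R -> R[i]) (F : R[i]) (xi : R).
Local Notation z := (zfreq nu xi).
Local Notation rp := (root_plus alpha beta nu xi).
Local Notation rm := (root_minus alpha beta nu xi).
Local Notation a2 := ((alpha ^+ 2)%:C).

Hypothesis dv : forall x, cderivable v x.
Hypothesis ddv : forall x, cderivable (cderive v) x.
Hypothesis ode : forall x,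
  - a2 * cderive (cderive v) x + beta%:C * cderive v x + z * v x = F.

Let alpha_neq0 : alpha != 0.
Proof. by apply: contraTneq halpha => ->; rewrite expr0n ltxx. Qed.

Let a2_neq0 : a2 != 0.
Proof. by rewrite fmorph_eq0 gt_eqF. Qed.

Let rootE : ((2 * alpha ^+ 2)%:C : R[i]) = 2 * a2.
Proof. by rewrite rmorphM rmorph_nat. Qed.

Lemma zfreq_neq0 : z != 0.
Proof. by rewrite eq_complex /= gt_eqF. Qed.

Lemma root_sum : a2 * (rp + rm) = beta%:C.
Proof.
rewrite /root_plus /root_minus rootE; field.
by rewrite fmorph_eq0 alpha_neq0.
Qed.

Lemma root_prod : a2 * (rp * rm) = - z.
Proof.
have sq := sqr_sqrtc (disc alpha beta nu xi).
have E : a2 * (rp * rm) = (beta%:C ^+ 2 - sqrtc (disc alpha beta nu xi) ^+ 2) / (4 * a2).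
  by rewrite /root_plus /root_minus rootE; field; rewrite fmorph_eq0 alpha_neq0.
rewrite E sq /disc rmorphXn rmorphM rmorph_nat; field.
by rewrite fmorph_eq0 alpha_neq0.
Qed.

Lemma root_diff_neq0 : rp - rm != 0.
Proof.
have E : a2 * (rp - rm) = sqrtc (disc alpha beta nu xi).
  by rewrite /root_plus /root_minus rootE; field; rewrite fmorph_eq0 alpha_neq0.
have : a2 * (rp - rm) != 0.
  rewrite E sqrtc_eq0; apply/eqP => d0.
  have := Re_disc alpha beta nu xi; rewrite d0 /= => /esym/eqP.
  by rewrite gt_eqF// ltr_wpDl ?sqr_ge0//; apply: mulr_gt0 => //; exact: mulr_gt0.
by apply: contra_neq => ->; rewrite mulr0.
Qed.

Let w x := v x - F / z.

Let dw x : is_cderive w x (cderive v x).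
Proof.
apply: is_cderive_eq (is_cderiveD (cderivableP (dv x)) (is_cderive_cst (- (F / z)) x)) _.
by rewrite addr0.
Qed.

Let second_derivative x :
  a2 * cderive (cderive v) x = beta%:C * cderive v x + z * w x.
Proof.
rewrite /w -(ode x) mulrBr [z * (_ / z)]mulrC divfK ?zfreq_neq0//.
by ring.
Qed.

Let p x := cderive v x - rm * w x.
Let q x := cderive v x - rp * w x.

Let dcombine (r : R[i]) x :
  is_cderive (fun t => cderive v t - r * w t) x (cderive (cderive v) x - r * cderive v x).
Proof.
have := is_cderiveD (cderivableP (ddv x)) (is_cderiveZ (- r) (dw x)).
rewrite mulNr; congr is_cderive; apply/funext => t; by rewrite mulNr.
Qed.

(** The second order operator factors through its characteristic roots. *)
Let pE x : p x = p 0 * cexp (rp * x%:C).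
Proof.
apply: ode_first_order => t; apply: is_cderive_eq (dcombine rm t) _.
apply: (mulfI a2_neq0); rewrite mulrBr second_derivative -root_sum /p.
rewrite (_ : z = - (a2 * (rp * rm))); first by ring.
by rewrite root_prod opprK.
Qed.

Let qE x : q x = q 0 * cexp (rm * x%:C).
Proof.
apply: ode_first_order => t; apply: is_cderive_eq (dcombine rp t) _.
apply: (mulfI a2_neq0); rewrite mulrBr second_derivative -root_sum /q.
rewrite (_ : z = - (a2 * (rp * rm))); first by ring.
by rewrite root_prod opprK.
Qed.

(** Boundedness at infinity kills the growing exponential, which grows at least
    linearly; what is left is fixed by the value at 0. *)
Lemma bounded_ode_solution (l x : R) : v 0 = 0 ->
  cmod (v t) @[t --> +oo] --> l -> v x = F / z * (1 - cexp (rm * x%:C)).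
Proof.
move=> v0 vl.
have rpos : 0 < Re rp by exact: Re_root_plus.
have rneg : Re rm <= 0.
  have : Re rm <= - decay alpha beta nu by exact: Re_root_minus.
  by move/le_trans; apply; rewrite oppr_le0 ltW// decay_gt0.
have p0 : p 0 = 0.
  apply/eqP; rewrite -cmod_eq0 eq_le cmod_ge0 andbT leNgt; apply/negP => p0.
  (* [p = (rp - rm) * w + q] is bounded since [v] is, and [q] does not grow. *)
  pose C := cmod (rp - rm) * (l + 1 + cmod (F / z)) + cmod (q 0).
  have bnd : \forall t \near +oo, cmod (p 0) * (1 + Re rp * t) <= C.
    have vb : \forall t \near +oo, cmod (v t) <= l + 1.
      by apply: (cvgr_le _ vl); rewrite ltrDl.
    apply: filterS2 vb (nbhs_pinfty_ge (num_real 0)) => t vt t0.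
    apply: (@le_trans _ _ (cmod (p t))).
      rewrite (pE t) cmodM cmod_cexp ler_wpM2l ?cmod_ge0//.
      by rewrite cReM /= mulr0 subr0 expR_ge1Dx.
    have -> : p t = (rp - rm) * w t + q t by rewrite /p /q; ring.
    apply: le_trans (ler_cmodD _ _) _; apply: lerD.
      rewrite cmodM ler_wpM2l ?cmod_ge0//.
      by apply: le_trans (ler_cmodB _ _) _; rewrite lerD2r.
    rewrite (qE t) cmodM cmod_cexp ler_piMr ?cmod_ge0//.
    by rewrite -expR0 ler_expR cReM /= mulr0 subr0 mulr_le0_ge0.
  have far : \forall t \near +oo, C / (cmod (p 0) * Re rp) < t.
    exact: nbhs_pinfty_gt (num_real _).
  have [t [pt Ct]] := filter_ex (filterI bnd far).
  have pr : 0 < cmod (p 0) * Re rp by rewrite mulr_gt0.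
  move: Ct; rewrite ltr_pdivrMr// => Ct.
  have : C < C by apply: lt_le_trans pt; nra.
  by rewrite ltxx.
have wE t : (rp - rm) * w t = - (q 0 * cexp (rm * t%:C)).
  rewrite -(qE t); have -> : (rp - rm) * w t = p t - q t by rewrite /p /q; ring.
  by rewrite (pE t) p0 mul0r sub0r.
have w0 : w 0 = - (F / z) by rewrite /w v0 sub0r.
have Ew : w x = - (F / z) * cexp (rm * x%:C).
  apply: (mulfI root_diff_neq0); rewrite wE.
  have := wE 0; rewrite mulr0 cexp0 mulr1 w0 => /(congr1 -%R); rewrite opprK => <-.
  by ring.
have -> : v x = w x + F / z by rewrite /w subrK.
by rewrite Ew; ring.
Qed.

End SourceODE.

(** * The regularized operators *)

Section RegularizedOperators.
Context {R : realType}.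
Local Notation mu := (@lebesgue_measure R).
Local Notation Re := (@complex.Re R).
Local Notation Im := (@complex.Im R).
Variables (alpha beta nu x0 : R).
Hypotheses (halpha : 0 < alpha ^+ 2) (hnu : 0 < nu) (hbeta : 0 <= beta)
  (hx0 : 0 < x0).
Implicit Types (m g h y f : R -> R[i]).

Local Notation Lam := (Lambda alpha beta nu x0).

Let sN : is_sign (-1 : R). Proof. by right. Qed.
Let s1 : is_sign (1 : R). Proof. by left. Qed.

(** The Fourier multiplier with symbol [m]; both [T_op] and [R_op] are of this
    form. *)
Definition multiplier m y : R -> R[i] := ft 1 (fun xi => m xi * ft (-1) y xi).

Section BoundedSymbol.
Variables (m : R -> R[i]) (B : R).
Hypotheses (mm : cmeasurable m) (B0 : 0 <= B) (mB : forall xi, cmod (m xi) <= B).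

Lemma bounded_symbol g : L2c g ->
  L2c (fun xi => m xi * g xi) /\ csq (fun xi => m xi * g xi) <= B ^+ 2 * csq g.
Proof.
move=> Lg; have [[mr _] [mi _]] := Lg.
have [pr pi] : cmeasurable (fun xi => m xi * g xi) by exact: cmeasurableM.
apply: csq_le_cmod => // t.
by rewrite cmodM ler_wpM2r// cmod_ge0.
Qed.

Lemma multiplier_L2c g : L2c g -> L2c (multiplier m g).
Proof. by move=> Lg; apply: ft_L2c => //; exact: (bounded_symbol (ft_L2c sN Lg)).1. Qed.

(** The two transforms contribute a factor 8 each. *)
Lemma multiplier_dist g h : L2c g -> L2c h ->
  csq (fun t => multiplier m g t - multiplier m h t) <=
  64 * B ^+ 2 * csq (fun t => g t - h t).
Proof.
move=> Lg Lh; have LG := ft_L2c sN Lg; have LH := ft_L2c sN Lh.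
apply: le_trans (ft_dist s1 (bounded_symbol LG).1 (bounded_symbol LH).1) _.
rewrite (_ : (fun t => m t * _ - _) =
    (fun t => m t * (ft (-1) g t - ft (-1) h t))); last first.
  by apply/funext => t; rewrite mulrBr.
have -> : 64 * B ^+ 2 * csq (fun t => g t - h t) =
    8 * (B ^+ 2 * (8 * csq (fun t => g t - h t))) by ring.
rewrite ler_wpM2l//; apply: le_trans (bounded_symbol (L2cB LG LH)).2 _.
by rewrite ler_wpM2l ?sqr_ge0//; exact: ft_dist.
Qed.

Lemma multiplier_linear (a b : R[i]) g h : L2c g -> L2c h ->
  {ae mu, forall t, multiplier m (fun s => a * g s + b * h s) t =
    a * multiplier m g t + b * multiplier m h t}.
Proof.
move=> Lg Lh; have LG := ft_L2c sN Lg; have LH := ft_L2c sN Lh.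
have Lgh := L2cD (L2cZ a Lg) (L2cZ b Lh).
have L1 := (bounded_symbol (ft_L2c sN Lgh)).1.
have LmG := (bounded_symbol LG).1; have LmH := (bounded_symbol LH).1.
have L2' := L2cD (L2cZ a LmG) (L2cZ b LmH).
have E : {ae mu, forall xi, m xi * ft (-1) (fun s => a * g s + b * h s) xi =
    a * (m xi * ft (-1) g xi) + b * (m xi * ft (-1) h xi)}.
  by apply: filterS (ftD a b sN Lg Lh) => xi ->; rewrite mulrDr !(mulrCA (m xi)).
apply: filterS2 (ft_ae s1 L1 L2' E) (ftD a b s1 LmG LmH) => t e1 e2.
exact: (etrans e1 e2).
Qed.

Lemma multiplier_bounded_linear : bounded_linear_L2 (multiplier m).
Proof.
split.
- by move=> g /L2P Lg; apply/L2P; exact: multiplier_L2c.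
- by move=> a b g h /L2P Lg /L2P Lh; exact: multiplier_linear.
- exists (8 * B) => g /L2P Lg; have LG := ft_L2c sN Lg.
  have Lm := (bounded_symbol LG).1.
  rewrite (L2normE (multiplier_L2c Lg)) (L2normE Lg).
  rewrite -EFinM lee_fin -[X in X * _]ger0_norm ?mulr_ge0//.
  rewrite -sqrtr_sqr -sqrtrM ?sqr_ge0// ler_wsqrtr//.
  apply: le_trans (is_L2_ft_bound s1 Lm (ftP s1 Lm)) _.
  have -> : (8 * B) ^+ 2 * csq g = 8 * (B ^+ 2 * (8 * csq g)) by ring.
  rewrite ler_wpM2l//; apply: le_trans (bounded_symbol LG).2 _.
  rewrite ler_wpM2l ?sqr_ge0//.
  exact: is_L2_ft_bound (ftP sN Lg).
Qed.

End BoundedSymbol.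

Lemma T_opE y : T_op alpha beta nu x0 y = multiplier Lam y.
Proof. by []. Qed.

Definition rsymbol (r xi : R) : R[i] := Lam xi / (1 + r ^+ 2 * xi ^+ 2)%:C.

Lemma R_opE r y : R_op alpha beta nu x0 r y = multiplier (rsymbol r) y.
Proof. by []. Qed.

Let K := regularized_bound alpha beta nu x0.

Let rsymbol_bound r : 0 < r < 1 -> forall xi, cmod (rsymbol r xi) <= K / r.
Proof. by move=> r01 xi; exact: cmod_regularized_le. Qed.

Let bound_ge0 r : 0 < r < 1 -> 0 <= K / r.
Proof.
by move=> /andP[r0 _]; rewrite divr_ge0 ?(ltW r0)//; exact: regularized_bound_ge0.
Qed.

Lemma rsymbol_measurable r : cmeasurable (rsymbol r).
Proof. exact: cmeasurable_regularized. Qed.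

Let rsymbolE r g xi : rsymbol r xi * g xi = (filter_factor r xi)%:C * (Lam xi * g xi).
Proof. by rewrite /rsymbol /filter_factor fmorphV; ring. Qed.

(** On the domain of [T_op] the filter only shrinks [Lam * ft y]; in contrast to
    the bound [K / r], this is uniform in [r]. *)
Lemma rsymbol_dom_L2c r y : L2c (fun xi => Lam xi * ft (-1) y xi) ->
  L2c (fun xi => rsymbol r xi * ft (-1) y xi).
Proof.
move=> Lh; have mf : cmeasurable (fun xi => (filter_factor r xi)%:C).
  apply: cmeasurable_complex; last exact: measurable_cst.
  have [mr _] : cmeasurable (fun xi => ((1 + r ^+ 2 * xi ^+ 2)%:C)^-1 : R[i]).
    apply: cmeasurableV; apply: cmeasurable_complex; last exact: measurable_cst.
    apply: measurable_funD; first exact: measurable_cst.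
    apply: measurable_funM; first exact: measurable_cst.
    by apply: measurable_funX; exact: measurable_id.
  move: mr; congr measurable_fun; apply/funext => xi.
  by rewrite /comp -fmorphV.
have [pr pi] : cmeasurable (fun xi => rsymbol r xi * ft (-1) y xi).
  have [[hr _] [hi _]] := Lh.
  have := cmeasurableM mf (conj hr hi); congr cmeasurable.
  by apply/funext => xi; rewrite rsymbolE.
have le xi : cmod (rsymbol r xi * ft (-1) y xi) <= 1 * cmod (Lam xi * ft (-1) y xi).
  rewrite rsymbolE cmodM cmod_real mul1r ler_piMl ?cmod_ge0//.
  by rewrite ger0_norm ?filter_factor_ge0 ?filter_factor_le1.
exact: (csq_le_cmod ler01 pr pi Lh le).1.
Qed.

(** Dominated convergence on the frequency side: the filter increases to 1 as
    [r] tends to 0, and the inverse transform is continuous. *)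
Lemma regularized_cvg y : L2c y -> L2c (fun xi => Lam xi * ft (-1) y xi) ->
  csq (fun t => multiplier (rsymbol r) y t - multiplier Lam y t) @[r --> 0^'+] -->
  (0 : R).
Proof.
move=> Ly Lh; set h := fun xi => Lam xi * _ in Lh *.
apply/cvg_at_rightP => u [u0 ucv].
pose d n xi := rsymbol (u n) xi * ft (-1) y xi - h xi.
have Lr n := rsymbol_dom_L2c (u n) Lh.
have Ld n : L2c (d n) := L2cB (Lr n) Lh.
have d2 n t : Re (d n t) ^+ 2 + Im (d n t) ^+ 2 =
    (filter_factor (u n) t - 1) ^+ 2 * (Re (h t) ^+ 2 + Im (h t) ^+ 2).
  have -> : d n t = (filter_factor (u n) t - 1)%:C * h t.
    by rewrite /d rsymbolE -/(h t) rmorphB rmorph1 mulrBl mul1r.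
  by rewrite cReM cImM /= !mul0r subr0 addr0; ring.
have [[mr Ir] [mi Ii]] := Lh.
have Ih : integr (fun t => Re (h t) ^+ 2 + Im (h t) ^+ 2) by exact: integrD.
have cd : csq (d n) @[n --> \oo] --> (0 : R).
  have -> : (0 : R) = \int[mu]_x (cst (0 : R) x) by rewrite Rintegral_cst// mul0r.
  under eq_cvg do rewrite csqE//.
  apply: (@dominated_Rintegral _ _ _ _ _ _ Ih _ _).2.
  - move=> n; have [[dr _] [di _]] := Ld n.
    by apply: measurable_funD; exact: measurable_funX.
  - exact: measurable_cst.
  - move=> n t; rewrite d2 normrM [X in _ * X]ger0_norm ?addr_ge0 ?sqr_ge0//.
    rewrite ler_piMl ?addr_ge0 ?sqr_ge0// ger0_norm ?sqr_ge0//.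
    by have := filter_factor_ge0 (u n) t; have := filter_factor_le1 (u n) t; nra.
  - apply: aeW => t.
    have fc : filter_factor (u n) t @[n --> \oo] --> (1 : R).
      rewrite [X in _ --> X](_ : 1 = (1 + 0 * 0 * t ^+ 2)^-1); last first.
        by rewrite !mul0r addr0 invr1.
      apply: cvgV; first by rewrite !mul0r addr0 oner_eq0.
      apply: cvgD; first exact: cvg_cst.
      by apply: cvgM; [under eq_cvg do rewrite expr2; exact: cvgM|exact: cvg_cst].
    have -> : cst (0 : R) t = (1 - 1) * (1 - 1) * (Re (h t) ^+ 2 + Im (h t) ^+ 2).
      by rewrite subrr !mul0r.
    under eq_cvg do rewrite d2 expr2.
    apply: cvgM; last exact: cvg_cst.
    by apply: cvgM; apply: cvgB => //; exact: cvg_cst.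
apply: (@squeeze_cvgr _ _ _ _ (fun=> 0) (fun n => 8 * csq (d n))).
- by apply: nearW => n; rewrite csq_ge0 /=; exact: (ft_dist s1 (Lr n) Lh).
- exact: cvg_cst.
- by rewrite -(mulr0 8); apply: cvgM => //; exact: cvg_cst.
Qed.

Lemma R_op_regularization :
  regularization_strategy (T_dom alpha beta nu x0) (T_op alpha beta nu x0)
    (R_op alpha beta nu x0).
Proof.
split=> [r r01|y [/L2P Ly /L2P Lh]].
  exact: (multiplier_bounded_linear (rsymbol_measurable r) (bound_ge0 r01) (rsymbol_bound r01)).
have E r : L2dist (R_op alpha beta nu x0 r y) (T_op alpha beta nu x0 y) =
    (Num.sqrt (csq (fun t => multiplier (rsymbol r) y t - multiplier Lam y t)))%:E.
  rewrite /L2dist R_opE T_opE L2normE//; apply: L2cB.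
    exact: (ft_L2c s1 (rsymbol_dom_L2c r Lh)).
  exact: (ft_L2c s1 Lh).
under eq_cvg do rewrite E.
apply/sqrt_cvg0; first by move=> r; exact: csq_ge0.
exact: regularized_cvg.
Qed.

(** A choice with [mu -> 0] and [delta / mu -> 0], since the norm of the
    regularized operator grows like [1 / mu]. *)
Definition choice_rule (delta : R) : R := Num.min (Num.sqrt delta) 2^-1.

Lemma choice_rule_a_priori : a_priori_rule choice_rule.
Proof.
move=> delta d0; rewrite /choice_rule lt_min sqrtr_gt0 d0 invr_gt0 ltr0n /=.
by rewrite gt_min invf_lt1 ?ltr1n// orbT.
Qed.

Lemma choice_rule_ratio (delta : R) : 0 < delta ->
  delta ^+ 2 / choice_rule delta ^+ 2 <= delta + 4 * delta ^+ 2.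
Proof.
move=> d0; rewrite /choice_rule.
have [_|_] := leP (Num.sqrt delta) 2^-1.
  rewrite sqr_sqrtr ?(ltW d0)// expr2 mulfK ?gt_eqF//.
  by rewrite lerDl mulr_ge0// sqr_ge0.
rewrite exprVn invrK mulrC (_ : 2 ^+ 2 = 4); last by ring.
by rewrite lerDr ltW.
Qed.

Lemma choice_rule_cvg : choice_rule delta @[delta --> 0^'+] --> (0 : R).
Proof.
apply: (@squeeze_cvgr _ _ _ _ (fun=> 0) (@Num.sqrt R)).
- near=> delta; have d0 : 0 < delta by near: delta; exact: nbhs_right_gt.
  have /andP[/ltW -> _] /= := choice_rule_a_priori d0.
  by rewrite /choice_rule ge_min lexx.
- exact: cvg_cst.
- apply: cvg_at_right_filter; rewrite -[X in _ --> X]sqrtr0.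
  exact: sqrt_continuous.
Unshelve. all: by end_near. Qed.

(** The error splits into the propagated data error, at most
    [8 * K * delta / mu], and the approximation error for exact data. *)
Lemma choice_rule_convergent y : T_dom alpha beta nu x0 y ->
  convergent_regularization (T_op alpha beta nu x0) (R_op alpha beta nu x0)
    choice_rule y.
Proof.
move=> [/L2P Ly /L2P Lh]; split; first exact: choice_rule_cvg.
have LT : L2c (multiplier Lam y) := ft_L2c s1 Lh.
pose e r := csq (fun t => multiplier (rsymbol r) y t - multiplier Lam y t).
have e0 : e (choice_rule delta) @[delta --> 0^'+] --> (0 : R).
  apply/cvg_at_rightP => u [u0 ucv].
  have /cvg_at_rightP ecv := regularized_cvg Ly Lh.
  apply: (ecv (fun n => choice_rule (u n))); split.
    by move=> n; case/andP: (choice_rule_a_priori (u0 n)).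
  by have /cvg_at_rightP := choice_rule_cvg; apply; split.
(* The squared error: [64 * (K / mu) ^ 2 * delta ^ 2] for the noise, [e] for the
   exact data, and a factor 2 for their sum. *)
pose G (delta : R) := 2 * (64 * K ^+ 2 * (delta + 4 * delta ^+ 2)) + 2 * e (choice_rule delta).
have G0 delta : 0 < delta -> 0 <= G delta.
  move=> d0; have d2 : 0 <= delta + 4 * delta ^+ 2.
    by apply: addr_ge0; [exact: ltW|apply: mulr_ge0 => //; exact: sqr_ge0].
  by rewrite /G addr_ge0// mulr_ge0// ?csq_ge0// mulr_ge0// mulr_ge0// sqr_ge0.
have Gcv : G delta @[delta --> 0^'+] --> (0 : R).
  rewrite [X in _ --> X](_ : 0 = 2 * (64 * K ^+ 2 * (0 + 4 * (0 * 0))) + 2 * 0); last first.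
    by ring.
  apply: cvgD; apply: cvgM; try exact: cvg_cst; last exact: e0.
  apply: cvgM; first exact: cvg_cst.
  have id0 : delta @[delta --> 0^'+] --> (0 : R).
    by apply: cvg_at_right_filter; exact: cvg_id.
  apply: cvgD => //; apply: cvgM; first exact: cvg_cst.
  by under eq_cvg do rewrite expr2; exact: cvgM.
have bnd (delta : R) yd : 0 < delta -> L2 yd -> (L2dist y yd <= delta%:E)%E ->
    (L2dist (R_op alpha beta nu x0 (choice_rule delta) yd) (T_op alpha beta nu x0 y) <=
     (Num.sqrt (G delta))%:E)%E.
  move=> d0 /L2P Lyd; rewrite /L2dist R_opE T_opE.
  have r01 := choice_rule_a_priori d0.
  set r := choice_rule delta in r01 *.
  have mr := rsymbol_measurable r; have b0 := bound_ge0 r01.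
  have bs := rsymbol_bound r01.
  have LRd : L2c (multiplier (rsymbol r) yd) := multiplier_L2c mr b0 bs Lyd.
  have LR : L2c (multiplier (rsymbol r) y) := multiplier_L2c mr b0 bs Ly.
  rewrite (L2normE (L2cB Ly Lyd)) (L2normE (L2cB LRd LT)) !lee_fin => dist.
  rewrite ler_wsqrtr//.
  rewrite (_ : (fun t => _) = (fun t =>
      (multiplier (rsymbol r) yd t - multiplier (rsymbol r) y t) +
      (multiplier (rsymbol r) y t - multiplier Lam y t))); last first.
    by apply/funext => t; rewrite addrA subrK.
  apply: le_trans (csqD_le (L2cB LRd LR) (L2cB LR LT)) _.
  rewrite /G -/r lerD2r ler_wpM2l//.
  apply: le_trans (multiplier_dist mr b0 bs Lyd Ly) _.
  rewrite csqBC; move: dist; have := csq_ge0 (fun t => y t - yd t).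
  move: (csq _) => c c0 dist.
  have r0 : 0 < r by case/andP: r01.
  have -> : 64 * (K / r) ^+ 2 * c = 64 * K ^+ 2 * (c / r ^+ 2).
    by field; rewrite gt_eqF.
  apply: ler_wpM2l; first by rewrite mulr_ge0// sqr_ge0.
  apply: le_trans (choice_rule_ratio d0).
  rewrite ler_wpM2r ?invr_ge0 ?sqr_ge0//.
  by rewrite -(sqr_sqrtr c0) lerXn2r ?nnegrE ?sqrtr_ge0// ltW.
have sG : (Num.sqrt (G delta))%:E @[delta --> 0^'+] --> 0%E.
  apply/fine_cvgP; split; first exact: nearW.
  have := cvg_comp _ _ Gcv (@sqrt_continuous R 0).
  by rewrite sqrtr0.
apply: (@squeeze_cvge _ _ _ _ (fun=> 0%E) _ (fun delta => (Num.sqrt (G delta))%:E)) => //;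
  last exact: cvg_cst.
near=> delta; have d0 : 0 < delta by near: delta; exact: nbhs_right_gt.
apply/andP; split.
  apply: (@le_trans _ _ (L2dist (R_op alpha beta nu x0 (choice_rule delta) y)
      (T_op alpha beta nu x0 y))); first exact: Lnorm_ge0.
  apply: ereal_sup_ubound; exists y => //; split; first exact/L2P.
  rewrite /L2dist (L2normE (L2cB Ly Ly)) lee_fin.
  rewrite (_ : (fun t => _) = fun t => 0 * y t); last first.
    by apply/funext => t; rewrite subrr mul0r.
  have -> : csq (fun t => 0 * y t) = 0.
    apply/eqP; rewrite eq_le csq_ge0 andbT.
    by have := csqZ 0 Ly; rewrite cmod_sq /= expr0n addr0 mul0r.
  by rewrite sqrtr0 ltW.
apply: ge_ereal_sup => _ [yd [Lyd dist] <-]; exact: bnd.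
Unshelve. all: by end_near. Qed.

(** The bounded solution vanishing at 0 takes the value
    [f / z * (1 - exp (rm * x0))] at [x0], with [rm] the root of negative real
    part; solving for [f] produces the symbol. *)
Lemma frequency_system_Lambda (u : R -> R -> R[i]) y f :
  frequency_system alpha beta nu x0 u y f ->
  {ae mu, forall xi, ft (-1) f xi = Lam xi * ft (-1) y xi}.
Proof.
move=> [uhat _]; apply: filterS => xi /= [sys v0 vx0 [M [l [vl _]]]].
have : uhat x0 xi = ft (-1) f xi / zfreq nu xi *
    (1 - cexp (root_minus alpha beta nu xi * x0%:C)).
  exact: (@bounded_ode_solution R alpha beta nu halpha hnu hbeta (uhat ^~ xi)
    (ft (-1) f xi) xi (fun x => let: And3 a _ _ := sys x in a)
    (fun x => let: And3 _ b _ := sys x in b)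
    (fun x => let: And3 _ _ c := sys x in c) l x0 v0 vl).
rewrite vx0 => E.
have d0 := denominator_neq0 halpha hnu hbeta hx0 xi.
have z0 : zfreq nu xi != 0 := zfreq_neq0 hnu xi.
apply: etrans (congr1 (fun w => Lam xi * w) (esym E)).
rewrite LambdaE; move: (ft _ _ _) (zfreq _ _) (1 - _) d0 z0 => a b c d0 z0.
by field; rewrite d0 z0.
Qed.

End RegularizedOperators.

Theorem theorem3p1 (R : realType) (alpha beta nu x0 : R)
  (halpha : 0 < alpha ^+ 2) (hnu : 0 < nu) (hbeta : 0 <= beta) (hx0 : 0 < x0)
  (u : R -> R -> R[i]) (y f : R -> R[i])
  (hu : forall x, L2 (u x)) (hy : L2 y) (hf : L2 f)
  (hsys : frequency_system alpha beta nu x0 u y f) :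
  [/\ T_dom alpha beta nu x0 y,
      {ae lebesgue_measure, forall t, T_op alpha beta nu x0 y t = f t},
      regularization_strategy (T_dom alpha beta nu x0) (T_op alpha beta nu x0)
        (R_op alpha beta nu x0) &
      exists2 mu : R -> R, a_priori_rule mu &
        convergent_regularization (T_op alpha beta nu x0)
          (R_op alpha beta nu x0) mu y].
Proof.
have sN : is_sign (-1 : R) by right.
have s1 : is_sign (1 : R) by left.
have /L2P Ly := hy; have /L2P Lf := hf.
have E := frequency_system_Lambda halpha hnu hbeta hx0 hsys.
have Lyh : L2c (ft (-1) y) := ft_L2c sN Ly.
have Lfh : L2c (ft (-1) f) := ft_L2c sN Lf.
pose h xi := Lambda alpha beta nu x0 xi * ft (-1) y xi.
have Lh : L2c h.
  have [[yr _] [yi _]] := Lyh.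
  have [hr hi] : cmeasurable h := cmeasurableM (cmeasurable_Lambda alpha beta nu x0) (conj yr yi).
  exact: (L2c_ae Lfh hr hi E).
have dom : T_dom alpha beta nu x0 y by split=> //; exact/L2P.
split=> //.
- have E' : {ae lebesgue_measure, forall xi : R, h xi = ft (-1) f xi}.
    by apply: filterS E => xi /esym.
  apply: filterS2 (ft_ae s1 Lh Lfh E') (ftK Lf) => t e1 e2.
  exact: (etrans e1 e2).
- exact: R_op_regularization.
- by exists (@choice_rule R); [exact: choice_rule_a_priori|exact: choice_rule_convergent].
Qed.
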